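(* Let $\mathcal{A}$ be a hyperplane arrangement in $V=\mathbb{K}^\ell$ and let $H\in\mathcal{A}$. Assume that $\mathcal{A}$ is tame and that $\mathcal{A}$ is locally free along $H$. Then the Ziegler restriction $(\mathcal{A}^H,m^H)$ is tame, i.e., $\mathrm{pd}_{\overline{S}}\,\Omega^p(\mathcal{A}^H,m^H)\le p$ for $0\le p\le\ell-1$, where $\overline{S}=S/\alpha_HS$.
   Context: Let $\mathbb{K}$ be a field, $V=\mathbb{K}^\ell$, $S=\mathbb{K}[x_1,\ldots,x_\ell]$ the coordinate ring of $V$. An arrangement $\mathcal{A}$ in $V$ is a finite set of linear hyperplanes of $V$; for each $H\in\mathcal{A}$ fix a linear form $\alpha_H\in V^*$ with $H=\ker\alpha_H$. A multiplicity is a function $m:\mathcal{A}\to\mathbb{Z}_{>0}$, the pair $(\mathcal{A},m)$ is a multiarrangement, and $Q(\mathcal{A},m)=\prod_{H\in\mathcal{A}}\alpha_H^{m(H)}$. Let $\Omega^1_V=\bigoplus_{i=1}^\ell S\,dx_i$ and $\Omega^p_V=\wedge^p\Omega^1_V$. For $0\le p\le\ell$, $$\Omega^p(\mathcal{A},m)=\{\omega\in \tfrac{1}{Q(\mathcal{A},m)}\Omega^p_V \mid Q(\mathcal{A},m)\,d\alpha_H\wedge\omega\in\alpha_H^{m(H)}\Omega^{p+1}_V\ (\forall H\in\mathcal{A})\},$$ and $\Omega^p(\mathcal{A})=\Omega^p(\mathcal{A},1)$ for the constant multiplicity $1$. $\mathcal{A}$ is free if $\Omega^1(\mathcal{A})$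 is a free $S$-module. $(\mathcal{A},m)$ is tame if $\mathrm{pd}_S\,\Omega^p(\mathcal{A},m)\le p$ for all $p$; $\mathcal{A}$ is tame if $(\mathcal{A},1)$ is. For $x\in V$ let $\mathcal{A}_x=\{L\in\mathcal{A}\mid x\in L\}$; $\mathcal{A}$ is locally free along $X\subset V$ if $\mathcal{A}_x$ is free for all $0\ne x\in X$. For $H\in\mathcal{A}$, $\mathcal{A}^H=\{H\cap L\mid L\in\mathcal{A}\setminus\{H\}\}$, an arrangement in $H\cong\mathbb{K}^{\ell-1}$ with coordinate ring $\overline{S}$. The Ziegler restriction of $\mathcal{A}$ onto $H$ is the multiarrangement $(\mathcal{A}^H,m^H)$ in $H$ with $m^H(X)=|\{L\in\mathcal{A}\setminus\{H\}\mid L\cap H=X\}|$ for $X\in\mathcal{A}^H$. *)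

(* Defs.v *)
From HB Require Import structures.
From mathcomp Require Import all_boot all_order all_algebra finmap.
From mathcomp Require Import fraction mpoly boolp.

Set Implicit Arguments.
Unset Strict Implicit.
Unset Printing Implicit Defensive.

Import GRing.Theory.

Local Open Scope fset_scope.
Local Open Scope ring_scope.

Section HomologicalAlgebra.
Variable R : pzRingType.

Definition is_basis (M : lmodType R) (I : choiceType) (b : I -> M) : Prop :=
  (forall x : M, exists (s : seq I) (c : I -> R),
      x = \sum_(i <- s) c i *: b i) /\
  (forall (s : seq I) (c : I -> R), uniq s ->
      \sum_(i <- s) c i *: b i = 0 -> forall i, i \in s -> c i = 0).

Definition free_module (M : lmodType R) : Prop :=
  exists (I : choiceType) (b : I -> M), is_basis b.

Definition projective_module (P : lmodType R) : Prop :=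
  forall (M N : lmodType R) (f : {linear M -> N}) (g : {linear P -> N}),
    (forall y : N, exists x : M, f x = y) ->
    exists h : {linear P -> M}, forall x : P, f (h x) = g x.

(* pd_R M <= n: there is a projective resolution
   0 -> P_n -> ... -> P_1 -> P_0 -> M -> 0. *)
Definition pd_le (M : lmodType R) (n : nat) : Prop :=
  exists (P : nat -> lmodType R)
         (d : forall i, {linear P i.+1 -> P i})
         (e : {linear P 0 -> M}),
    [/\ forall i, projective_module (P i),
        forall i, (n < i)%N -> forall x : P i, x = 0,
        forall y : M, exists x : P 0, e x = y,
        forall x : P 0, e x = 0 <-> exists y, d 0 y = x &
        forall i (x : P i.+1), d i x = 0 <-> exists y, d i.+1 y = x].

End HomologicalAlgebra.

(* {fraction R} as an R-module; the pointwise instance on {ffun _ -> _} then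
   makes rational differential forms a module over the polynomial ring. *)
Section FractionModule.
Variable R : idomainType.

Definition frac_scale (a : R) (x : {fraction R}) : {fraction R} :=
  tofrac a * x.

Fact frac_scaleA a b x : frac_scale a (frac_scale b x) = frac_scale (a * b) x.
Proof. by rewrite /frac_scale mulrA tofracM. Qed.

Fact frac_scale1 : left_id 1 frac_scale.
Proof. by move=> x; rewrite /frac_scale tofrac1 mul1r. Qed.

Fact frac_scaleDr : right_distributive frac_scale +%R.
Proof. by move=> a x y; rewrite /frac_scale mulrDr. Qed.

Fact frac_scaleDl x : {morph frac_scale^~ x : a b / a + b}.
Proof. by move=> a b; rewrite /frac_scale tofracD mulrDl. Qed.

HB.instance Definition _ := GRing.Zmodule_isLmodule.Build R {fraction R}
  frac_scaleA frac_scale1 frac_scaleDr frac_scaleDl.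

End FractionModule.

(* The exterior algebra over R on generators dx_0, ..., dx_(n-1): an element w
   stands for \sum_I w I dx_I, where dx_I is the wedge product of the dx_i,
   i \in I, taken in increasing order. *)
Section Exterior.
Variables (R : comNzRingType) (n : nat).

Definition ext := {ffun {set 'I_n} -> R}.

Definition inversions (I J : {set 'I_n}) : nat :=
  #|[set ij : 'I_n * 'I_n |
      [&& ij.1 \in I, ij.2 \in J & (ij.2 < ij.1)%N]]|.

Definition wedge (w v : ext) : ext :=
  [ffun J : {set 'I_n} => \sum_(I : {set 'I_n} | I \subset J)
     (-1) ^+ inversions I (J :\: I) * (w I * v (J :\: I))].

Definition ext_deg (p : nat) (w : ext) : Prop :=
  forall I : {set 'I_n}, #|I| != p -> w I = 0.

End Exterior.

Section LogarithmicForms.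
Variables (K : fieldType) (l : nat).

Local Notation V := 'rV[K]_l.
Local Notation S := {mpoly K[l]}.

Definition polyform := {ffun {set 'I_l} -> S}.
Definition ratform := {ffun {set 'I_l} -> {fraction S}}.
HB.instance Definition _ := GRing.Lmodule.on ratform.

Definition form_frac (w : polyform) : ratform := [ffun I => tofrac (w I)].

Definition dform (f : S) : polyform :=
  [ffun J : {set 'I_l} => \sum_(i < l | J == [set i]) f^`M(i)].

Definition lin_poly (f : 'Hom(V, K^o)) : S :=
  \sum_(i < l) (f (delta_mx 0 i) : K) *: 'X_i.

Definition is_arrangement (A : {fset {vspace V}}) : Prop :=
  forall H, H \in A -> (\dim H).+1 = l.

Definition defining_forms (A : {fset {vspace V}})
    (alpha : {vspace V} -> 'Hom(V, K^o)) : Prop :=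
  forall H, H \in A -> lker (alpha H) = H.

Section Omega.
Variables (A : {fset {vspace V}}) (alpha : {vspace V} -> 'Hom(V, K^o)).
Variables (m : {vspace V} -> nat) (p : nat).

Definition defining_poly : S := \prod_(H <- A) lin_poly (alpha H) ^+ m H.

Definition is_log_form (w : ratform) : Prop :=
  (exists2 eta : polyform, ext_deg p eta &
     defining_poly *: w = form_frac eta) /\
  (forall H, H \in A ->
     exists2 theta : polyform, ext_deg p.+1 theta &
       defining_poly *: (wedge (form_frac (dform (lin_poly (alpha H)))) w
                           : ratform)
       = lin_poly (alpha H) ^+ m H *: form_frac theta).

Definition log_form : {pred ratform} := fun w => `[< is_log_form w >].

Fact form_fracP (a : S) (u v : polyform) :
  form_frac [ffun I => a * u I + v I] = a *: form_frac u + form_frac v.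
Proof.
apply/ffunP => I; rewrite /form_frac !ffunE tofracD tofracM.
by [].
Qed.

Fact ext_degP q (a : S) (u v : polyform) :
  ext_deg q u -> ext_deg q v -> ext_deg q ([ffun I => a * u I + v I] : polyform).
Proof. by move=> du dv I qI; rewrite ffunE du // dv // mulr0 addr0. Qed.

Fact wedgeP (a : S) (t u v : ratform) :
  wedge t (a *: u + v) = (a *: (wedge t u : ratform) + wedge t v :> ratform).
Proof.
apply/ffunP => J; rewrite !ffunE scaler_sumr -big_split /=.
apply: eq_bigr => I _; rewrite !ffunE.
change (a *: u (J :\: I)) with (tofrac a * u (J :\: I)).
rewrite /GRing.scale /= /frac_scale !mulrDr; congr (_ + _).
by rewrite [t I * _]mulrCA [LHS]mulrCA.
Qed.

Fact log_form_submod_closed : submod_closed log_form.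
Proof.
have d0 q : ext_deg q (0 : polyform) by move=> I _; rewrite ffunE.
have f0 : form_frac 0 = 0 by apply/ffunP => I; rewrite !ffunE tofrac0.
split.
  apply/asboolP; split; first by exists 0; rewrite ?scaler0.
  move=> H _; exists 0 => //; rewrite f0 scaler0.
  have := wedgeP (-1) (form_frac (dform (lin_poly (alpha H)))) 0 0.
  by rewrite scaler0 addr0 scaleN1r addNr => ->; rewrite scaler0.
move=> a u v /asboolP[[eu deu Eu] Hu] /asboolP[[ev dev Ev] Hv].
apply/asboolP; split.
  exists [ffun I => a * eu I + ev I]; first exact: ext_degP.
  by rewrite form_fracP scalerDr scalerA mulrC -scalerA Eu Ev.
move=> H HA; have [tu dtu Tu] := Hu H HA; have [tv dtv Tv] := Hv H HA.
exists [ffun I => a * tu I + tv I]; first exact: ext_degP.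
rewrite form_fracP wedgeP !scalerDr Tv; congr (_ + _).
by rewrite scalerA mulrC -scalerA Tu !scalerA mulrC.
Qed.

HB.instance Definition _ :=
  GRing.isSubmodClosed.Build S ratform log_form log_form_submod_closed.

(* \Omega^p(A, m) as a module over S = K[x_1, ..., x_l]. *)
Record Omega := LogForm { log_val :> ratform; _ : log_val \in log_form }.

HB.instance Definition _ := [isSub for log_val].
HB.instance Definition _ := [Choice of Omega by <:].
HB.instance Definition _ := [SubChoice_isSubLmodule of Omega by <:].

End Omega.

Definition const1 : {vspace V} -> nat := fun=> 1%N.

Definition free_arrangement A alpha : Prop :=
  free_module (Omega A alpha const1 1).

Definition tame_multi A alpha m : Prop :=
  forall p, (p <= l)%N -> pd_le (Omega A alpha m p) p.

Definition tame A alpha : Prop := tame_multi A alpha const1.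

Definition localization (A : {fset {vspace V}}) (x : V) : {fset {vspace V}} :=
  [fset L in A | x \in L].

Definition locally_free_along A alpha (X : {pred V}) : Prop :=
  forall x, x \in X -> x != 0 -> free_arrangement (localization A x) alpha.

Definition restriction (A : {fset {vspace V}}) (H : {vspace V}) :
    {fset {vspace V}} :=
  [fset (H :&: L)%VS | L in A `\ H].

Definition ziegler_mult (A : {fset {vspace V}}) (H X : {vspace V}) : nat :=
  #|` [fset L in A `\ H | (L :&: H)%VS == X]|.

End LogarithmicForms.

(* Coordinates on a subspace H are a linear isomorphism phi from K^k onto H;
   subspaces of H and functions on them are transported to K^k along phi. *)
Section Coordinates.
Variables (K : fieldType) (k l : nat).
Variable phi : 'Hom('rV[K]_k, 'rV[K]_l).

Definition coordinates_of (H : {vspace 'rV[K]_l}) : Prop :=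
  lker phi = 0%VS /\ limg phi = H.

Definition pull_arrangement (B : {fset {vspace 'rV[K]_l}}) :
    {fset {vspace 'rV[K]_k}} :=
  [fset (phi @^-1: X)%VS | X in B].

Definition pull_mult (m : {vspace 'rV[K]_l} -> nat) (Y : {vspace 'rV[K]_k}) :
    nat :=
  m (phi @: Y)%VS.

End Coordinates.

(* Main.v *)
(* Put alpha = alpha_H. A log form w on A can be written (d alpha / alpha) w1 + w2
   with w2 free of d alpha and regular along H; restricting w2 to H gives a map
   from Omega^p(A) to Omega^p(A^H, m^H). Let Omega_0^p be the kernel of
   contraction with the Euler field. It is a direct summand of Omega^p(A), so
   tameness bounds its projective dimension by p, and on it the kernel of the
   restriction is alpha Omega_0^p. Hence the image N0 = Omega_0^p / alpha
   Omega_0^p has projective dimension at most p over S / alpha.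

   It remains to see that N0 is everything when p <= l - 3, since for p >= l - 2
   Hilbert's syzygy theorem suffices. For 0 != x in H the arrangement A_x is
   free, and dual bases show that the product of the alpha_L with L not through x
   multiplies every log form on (A^H, m^H) into N0. On the other hand N0 has
   depth at least 2, so a log form that all linear forms multiply into N0 already
   lies in N0. A descending induction on the set U of hyperplanes shows that the
   product of the alpha_L, L in U, multiplies every log form into N0: either the
   hyperplanes outside U and H share some x != 0, or their equations span the
   linear forms on H. For U empty this is the surjectivity. *)

Require Import Defs.
From HB Require Import structures.
From mathcomp Require Import all_boot all_order all_algebra finmap.
From mathcomp Require Import fraction mpoly boolp.
From mathcomp Require Import ring.
From mathcomp Require classical_sets monalg.

Set Implicit Arguments.
Unset Strict Implicit.
Unset Printing Implicit Defensive.

Import GRing.Theory.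
Local Open Scope ring_scope.

(** * Submodules, quotients and restriction of scalars *)

(** On all of Omega^p(A) the restriction kills every multiple of d alpha / alpha, so its kernel
    there is not alpha Omega^p(A). Contraction i_E with the Euler field E cures this: if i_E w = 0,
    then w = i_E((d alpha / alpha) wedge w2), so w2 determines w, and divisibility of w2 by alpha
    passes to w. The splitting is the identity w = i_E((d alpha / alpha) wedge w) + (d alpha /
    alpha) wedge i_E w, valid in every characteristic because E(alpha) = alpha.

    The bound p <= l - 3 comes from depth: over the l - 1 variables of H, projective dimension at
    most p leaves depth at least l - 1 - p, and 2 is wanted. For larger p, numerators embed the log
    forms on H in a free module, which lowers Hilbert's bound from l - 1 to l - 2.

    Poles are treated one hyperplane at a time: a form is described by its denominators, which are
    products of the alpha_L, and by its regularity at the generic point of each L. The arithmetic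
    behind this is the primality of linear forms. Depth is expressed by elements instead of Ext, so
    that inductions on syzygies and on the number of variables suffice. *)

Lemma linear_pack (R : pzRingType) (M N : lmodType R) (f : M -> N) :
  linear f -> exists g : {linear M -> N}, g =1 f.
Proof.
move=> lf; pose fL := GRing.isLinear.Build R M N *:%R f lf.
by exists (HB.pack_for {linear M -> N} f fL).
Qed.

Section Submodule.
Variables (R : pzRingType) (M : lmodType R) (Q : M -> Prop).
Hypotheses (Q0 : Q 0) (QP : forall a x y, Q x -> Q y -> Q (a *: x + y)).

Definition sub_pred : {pred M} := fun x => `[< Q x >].

Fact sub_pred_closed : submod_closed sub_pred.
Proof.
split; first exact/asboolP.
by move=> a u v /asboolP Qu /asboolP Qv; apply/asboolP/QP.
Qed.

HB.instance Definition _ :=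
  GRing.isSubmodClosed.Build R M sub_pred sub_pred_closed.

Record submodule := Submodule { sub_val :> M; _ : sub_val \in sub_pred }.
HB.instance Definition _ := [isSub for sub_val].
HB.instance Definition _ := [Choice of submodule by <:].
HB.instance Definition _ := [SubChoice_isSubLmodule of submodule by <:].

Lemma submodule_exists : exists (K : lmodType R) (i : {linear K -> M}),
  injective i /\ forall x, Q x <-> exists k, i k = x.
Proof.
have lf : linear (sub_val : submodule -> M) by [].
have [i iE] := linear_pack lf.
exists submodule, i; split; first by move=> x y; rewrite !iE; apply: val_inj.
move=> x; split=> [Qx|[k <-]]; last by rewrite iE; apply/asboolP; case: k.
have Px : x \in sub_pred by apply/asboolP.
by exists (Submodule Px); rewrite iE.
Qed.
End Submodule.

Section Quotient.
Variables (R : pzRingType) (M : lmodType R) (Q : M -> Prop).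
Hypotheses (Q0 : Q 0) (QP : forall a x y, Q x -> Q y -> Q (a *: x + y)).

Let P : {pred M} := sub_pred Q.
HB.instance Definition _ :=
  GRing.isSubmodClosed.Build R M P (sub_pred_closed Q0 QP).

Import ring_quotient.Quotient.
Import generic_quotient.
Local Open Scope quotient_scope.

Let qT : zmodType := {quot P}.
Definition quot_scale (a : R) (x : qT) : qT := \pi_({quot P}) (a *: repr x).

Lemma pi_scale a (x : M) : quot_scale a (\pi_({quot P}) x) = \pi_({quot P}) (a *: x).
Proof.
rewrite /quot_scale; apply/eqP; rewrite -[_ == _]idealrBE -scalerBr rpredZ //.
by rewrite idealrBE reprK.
Qed.

Lemma quot_repr (x : qT) : exists y, x = \pi_({quot P}) y.
Proof. by exists (repr x); rewrite reprK. Qed.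

Fact quot_scaleA a b x : quot_scale a (quot_scale b x) = quot_scale (a * b) x.
Proof. by have [y ->] := quot_repr x; rewrite !pi_scale scalerA. Qed.
Fact quot_scale1 : left_id 1 quot_scale.
Proof. by move=> x; have [y ->] := quot_repr x; rewrite pi_scale scale1r. Qed.
Fact quot_scaleDr : right_distributive quot_scale +%R.
Proof.
move=> a x y; have [{}x ->] := quot_repr x; have [{}y ->] := quot_repr y.
by rewrite -raddfD !pi_scale scalerDr raddfD.
Qed.
Fact quot_scaleDl x : {morph quot_scale^~ x : a b / a + b}.
Proof.
have [{}x ->] := quot_repr x => a b.
by rewrite !pi_scale scalerDl raddfD.
Qed.

Definition quot_module : Type := qT.
HB.instance Definition _ := GRing.Zmodule.on quot_module.
HB.instance Definition _ := GRing.Zmodule_isLmodule.Build R quot_module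
  quot_scaleA quot_scale1 quot_scaleDr quot_scaleDl.

Lemma quotient_exists : exists (C : lmodType R) (e : {linear M -> C}),
  (forall y, exists x, e x = y) /\ forall x, e x = 0 <-> Q x.
Proof.
have lf : linear ((fun x => \pi_({quot P}) x) : M -> quot_module).
  by move=> a x y; rewrite raddfD; congr (_ + _); rewrite -[LHS]pi_scale.
have [e eE] := linear_pack lf.
exists quot_module, e; split.
  by move=> y; have [x ->] := quot_repr y; exists x; rewrite eE.
move=> x; rewrite eE -(raddf0 (\pi_({quot P}))).
split=> [/eqP|Qx]; first by rewrite -[_ == _]idealrBE subr0 => /asboolP.
by apply/eqP; rewrite -[_ == _]idealrBE subr0; apply/asboolP.
Qed.
End Quotient.

(** A synonym of [N], so that the action of [R] through [f] does not clash with the action of [R']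
    that [N] already carries. *)
Definition restr_scalars (R R' : pzRingType) (f : {rmorphism R -> R'})
  (N : lmodType R') : Type := N.

Section RestrictScalars.
Variables (R R' : pzRingType) (f : {rmorphism R -> R'}) (N : lmodType R').
Local Notation T := (restr_scalars f N).

HB.instance Definition _ := GRing.Zmodule.on T.

Definition restr_scale (a : R) (x : T) : T := f a *: (x : N).

Fact restr_scaleA a b x : restr_scale a (restr_scale b x) = restr_scale (a * b) x.
Proof. by rewrite /restr_scale scalerA rmorphM. Qed.
Fact restr_scale1 : left_id 1 restr_scale.
Proof. by move=> x; rewrite /restr_scale rmorph1 scale1r. Qed.
Fact restr_scaleDr : right_distributive restr_scale +%R.
Proof. by move=> a x y; rewrite /restr_scale scalerDr. Qed.
Fact restr_scaleDl x : {morph restr_scale^~ x : a b / a + b}.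
Proof. by move=> a b; rewrite /restr_scale rmorphD scalerDl. Qed.

HB.instance Definition _ := GRing.Zmodule_isLmodule.Build R T
  restr_scaleA restr_scale1 restr_scaleDr restr_scaleDl.

Lemma restr_scaleE (a : R) (x : T) : a *: x = f a *: (x : N).
Proof. by []. Qed.
End RestrictScalars.

(** * Projective dimension *)

Section FreeModule.
Variables (R : nzRingType) (X : choiceType).
Import monalg.

Definition malg_map (N : lmodType R) (b : X -> N) (g : {malg R[X]}) : N :=
  \sum_(x <- msupp g) mcoeff x g *: b x.

Lemma malg_mapE (N : lmodType R) (b : X -> N) (g : {malg R[X]}) (D : {fset X}) :
  (msupp g `<=` D)%fset -> malg_map b g = \sum_(x <- D) mcoeff x g *: b x.
Proof.
move=> gD; apply: big_fset_incl => // x _ xg.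
by rewrite mcoeff_outdom // scale0r.
Qed.

Lemma malg_map_linear (N : lmodType R) (b : X -> N) : linear (malg_map b).
Proof.
move=> a f g; pose D := (msupp f `|` msupp g `|` msupp (a *: f + g))%fset.
have fD : (msupp f `<=` D)%fset by rewrite /D -fsetUA fsubsetUl.
have gD : (msupp g `<=` D)%fset by rewrite /D fsubsetU // fsubsetUr.
have hD : (msupp (a *: f + g) `<=` D)%fset by rewrite /D fsubsetUr.
rewrite (malg_mapE b fD) (malg_mapE b gD) (malg_mapE b hD).
rewrite scaler_sumr -big_split /=; apply: eq_bigr => x _.
by rewrite mcoeffD mcoeffZ scalerDl scalerA.
Qed.

Lemma malg_mapU (N : lmodType R) (b : X -> N) x :
  malg_map b (mkmalgU x 1) = b x.
Proof.
rewrite (@malg_mapE _ _ _ [fset x]%fset) ?msuppU_le //.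
by rewrite big_seq_fset1 mcoeffUU scale1r.
Qed.

Lemma malg_map_exists (N : lmodType R) (b : X -> N) :
  exists h : {linear {malg R[X]} -> N}, forall x, h (mkmalgU x 1) = b x.
Proof.
have [h hE] := linear_pack (malg_map_linear b).
by exists h => x; rewrite hE malg_mapU.
Qed.

Lemma malg_decomp (g : {malg R[X]}) :
  g = \sum_(x <- msupp g) mcoeff x g *: (mkmalgU x 1 : {malg R[X]}).
Proof.
rewrite {1}[g]monalgE; apply: eq_bigr => x _.
by apply/malgP => k; rewrite mcoeffZ !mcoeffU mulrnAr mulr1.
Qed.

Lemma malg_linear_ext (N : lmodType R) (f g : {linear {malg R[X]} -> N}) :
  (forall x, f (mkmalgU x 1) = g (mkmalgU x 1)) -> f =1 g.
Proof.
move=> fg u; rewrite [u]malg_decomp !linear_sum; apply: eq_bigr => x _.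
by rewrite !linearZ fg.
Qed.

Lemma malg_projective : projective_module {malg R[X]}.
Proof.
move=> M N f g fs.
have [b bE] := choice (fun x : X => fs (g (mkmalgU x 1))).
have [h hE] := malg_map_exists b; exists h => x.
have lf : linear (f \o h) by move=> a u v; rewrite /= !linearP.
have [fh fhE] := linear_pack lf.
rewrite -[LHS]/((f \o h) x) -fhE; apply: malg_linear_ext => y.
by rewrite fhE /= hE bE.
Qed.

(** The monoid algebra type serves only as the finitely supported functions from [X] to [R]; from
    here on it is used through its generators, [free_on_map], [free_on_rep] and [free_on_indep]. *)
Definition free_on : lmodType R := {malg R[X]}.
Definition free_gen (x : X) : free_on := mkmalgU x 1.

Lemma free_on_map (N : lmodType R) (b : X -> N) :
  exists h : {linear free_on -> N}, forall x, h (free_gen x) = b x.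
Proof. exact: malg_map_exists. Qed.

Lemma free_on_rep (g : free_on) : exists (D : {fset X}) (c : X -> R),
  g = \sum_(x <- D) c x *: free_gen x.
Proof. by exists (msupp g), (mcoeff^~ g); apply: malg_decomp. Qed.

Lemma free_on_indep (D : {fset X}) (c : X -> R) :
  \sum_(x <- D) c x *: free_gen x = 0 -> forall x, x \in D -> c x = 0.
Proof.
move=> /(congr1 (mcoeff _)) sum0 x xD; have {sum0} := sum0 x.
rewrite mcoeff0 raddf_sum /= (big_fsetD1 x) //= big_seq big1 => [|y].
  by rewrite mcoeffZ mcoeffUU mulr1 addr0.
by rewrite !inE mcoeffZ mcoeffU => /andP[/negPf-> _]; rewrite mulr0.
Qed.
End FreeModule.

Section Homological.
Variable R : nzRingType.
Implicit Types M N P K : lmodType R.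

Lemma free_cover M : exists e : {linear free_on R M -> M},
  forall y, exists x, e x = y.
Proof.
have [e eE] := malg_map_exists (id : M -> M).
by exists e => y; exists (free_gen R (y : M)); rewrite eE.
Qed.

(** The universal property of a kernel; the factorisations through syzygies below are obtained from
    it. *)
Lemma lift_injective M N P (i : {linear M -> N}) (f : {linear P -> N}) :
  injective i -> (forall x, exists k, i k = f x) ->
  exists g : {linear P -> M}, forall x, i (g x) = f x.
Proof.
move=> ii /choice[g gE].
have lg : linear g by move=> a x y; apply: ii; rewrite !linearP !gE linearP.
have [h hE] := linear_pack lg.
by exists h => x; rewrite hE.
Qed.

Lemma kernel_exists M N (f : {linear M -> N}) :
  exists (K : lmodType R) (i : {linear K -> M}),
    injective i /\ forall x, f x = 0 <-> exists k, i k = x.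
Proof.
apply: submodule_exists; first exact: linear0.
by move=> a x y fx fy; rewrite linearP fx fy scaler0 addr0.
Qed.

Definition short_exact K P M (i : {linear K -> P}) (e : {linear P -> M}) :=
  [/\ injective i, forall y, exists x, e x = y &
      forall x, e x = 0 <-> exists k, i k = x].

Lemma short_exact_exists P M (e : {linear P -> M}) :
  (forall y, exists x, e x = y) ->
  exists K (i : {linear K -> P}), short_exact i e.
Proof.
by move=> es; have [K [i [ii iE]]] := kernel_exists e; exists K, i; split.
Qed.

Definition retract M N := exists (i : {linear M -> N}) (r : {linear N -> M}),
  cancel i r.

Lemma projective_retract M P :
  retract M P -> projective_module P -> projective_module M.
Proof.
move=> [i [r ir]] hP A B f g fs.
have lf : linear (g \o r) by move=> a u v; rewrite /= !linearP.
have [gr grE] := linear_pack lf.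
have [h hE] := hP A B f gr fs.
have lh : linear (h \o i) by move=> a u v; rewrite /= !linearP.
have [hi hiE] := linear_pack lh.
by exists hi => x; rewrite hiE /= hE grE /= ir.
Qed.

Lemma projective_prod P Q : projective_module P -> projective_module Q ->
  projective_module (P * Q)%type.
Proof.
move=> hP hQ M N f g fs.
have l1 : linear (fun x : P => g (x, 0)).
  move=> a u v; rewrite -linearP; congr (g _).
  by congr (_, _); rewrite /= scaler0 addr0.
have l2 : linear (fun x : Q => g (0, x)).
  move=> a u v; rewrite -linearP; congr (g _).
  by congr (_, _); rewrite /= scaler0 addr0.
have [g1 g1E] := linear_pack l1; have [g2 g2E] := linear_pack l2.
have [h1 h1E] := hP M N f g1 fs; have [h2 h2E] := hQ M N f g2 fs.
have lh : linear (fun x : P * Q => h1 x.1 + h2 x.2).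
  by move=> a u v; rewrite /= !linearP scalerDr addrACA.
have [h hE] := linear_pack lh.
exists h => -[x y]; rewrite hE linearD h1E h2E g1E g2E -linearD; congr (g _).
by congr (_, _); rewrite /= ?addr0 ?add0r.
Qed.

(** Recursion on syzygies instead of whole resolutions, so that the bounds below go by induction on
    [k]; [pd_leP] identifies it with [pd_le]. *)
Fixpoint pdk (k : nat) (M : lmodType R) : Prop :=
  if k is k'.+1 then
    exists (P K : lmodType R) (i : {linear K -> P}) (e : {linear P -> M}),
      [/\ projective_module P, short_exact i e & pdk k' K]
  else projective_module M.

(* A variant of pdk quantifying over all covers; the two agree by Schanuel's
   argument. *)
Fixpoint pdk_all (k : nat) (M : lmodType R) : Prop :=
  if k is k'.+1 then
    forall (P K : lmodType R) (i : {linear K -> P}) (e : {linear P -> M}),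
      projective_module P -> short_exact i e -> pdk_all k' K
  else projective_module M.

(** A cover [e] of the summand [M] is completed to a cover of [N] by adding [(1 - i r) q], where [q]
    covers [N]. Applying [r] shows that [e] kills the first component of any element of the new
    kernel, which makes [K] a retract of that kernel. *)
Lemma pdk_all_retract k M N : retract M N -> pdk_all k N -> pdk_all k M.
Proof.
elim: k M N => [|k IH] M N [i [r ir]] /=.
  by apply: projective_retract; exists i, r.
move=> hN P K j e hP [ij es jE].
have [q qs] := free_cover N.
set Q := free_on R N in q qs.
have lf : linear (fun x : P * Q => i (e x.1) + (q x.2 - i (r (q x.2)))).
  move=> a u v; rewrite /= !linearP /= !scalerDr.
  by rewrite [X in _ + X = _]addrACA [LHS]addrACA.
have [f fE] := linear_pack lf.
have fs y : exists x, f x = y.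
  have [p pE] := es (r y); have [z zE] := qs y.
  by exists (p, z); rewrite fE /= pE zE addrC subrK.
have [L [m mE]] := short_exact_exists fs.
have hL : pdk_all k L.
  by apply: hN mE; apply: projective_prod => //; apply: malg_projective.
have [im _ mK] := mE.
apply: (IH _ _ _ hL).
have re x : f x = 0 -> e x.1 = 0.
  rewrite fE => /(congr1 r); rewrite linear0 linearD linearB !ir subrr addr0.
  by [].
have l1 : linear (fun x : K => (j x, 0) : P * Q).
  by move=> a u v; rewrite linearP; congr (_, _); rewrite /= scaler0 addr0.
have [j1 j1E] := linear_pack l1.
have [x|s sE] := @lift_injective _ _ _ m j1 im.
  apply/mK; rewrite fE j1E /= linear0 linear0 linear0 subr0 addr0.
  have -> : e (j x) = 0 by apply/jE; exists x.
  by rewrite linear0.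
have l2 : linear (fun x : L => (m x).1 : P).
  by move=> a u v; rewrite linearP.
have [p pE] := linear_pack l2.
have [x|t tE] := @lift_injective _ _ _ j p ij.
  by rewrite pE; apply/jE/re/mK; exists x.
by exists s, t => x; apply: ij; rewrite tE pE sE j1E.
Qed.

Lemma pdk_addproj k M P : projective_module P -> pdk k M ->
  pdk k (M * P)%type.
Proof.
case: k => [|k] hP /=; first by move=> hM; apply: projective_prod.
move=> [Q [K [i [e [hQ [ii es iE] hK]]]]].
have li : linear (fun x : K => (i x, 0) : Q * P).
  by move=> a u v; rewrite linearP; congr (_, _); rewrite /= scaler0 addr0.
have le : linear (fun x : Q * P => (e x.1, x.2) : M * P).
  by move=> a u v; rewrite /= linearP.
have [i' i'E] := linear_pack li; have [e' e'E] := linear_pack le.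
exists (Q * P)%type, K, i', e'; split=> //; first exact: projective_prod.
split.
- by move=> x y; rewrite !i'E => -[/ii].
- by move=> [y z]; have [x xE] := es y; exists (x, z); rewrite e'E /= xE.
- move=> [x y]; rewrite e'E /=; split.
    by case=> /iE[c <-] ->; exists c; rewrite i'E.
  case=> z; rewrite i'E => -[<- <-]; congr (_, _).
  by apply/iE; exists z.
Qed.

(** Schanuel's argument: lifts [s : P -> P'] and [t : P' -> P] between two covers of [M] make [K] a
    retract of [K' * P]. The section is [x |-> (a x, i x)] with [i' a = s i], the retraction
    [(x, y) |-> t (i' x) + (y - t (s y))]. *)
Lemma pdk_pdk_all k M : pdk k M -> pdk_all k M.
Proof.
elim: k M => [//|k IH] M [P' [K' [i' [e' [hP' [ii' es' iE'] hK']]]]].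
move=> P K i e hP [ii es iE].
have [s sE] := hP _ _ e' e es'; have [t tE] := hP' _ _ e e' es.
have hX : pdk_all k (K' * P)%type by apply/IH/pdk_addproj.
apply: pdk_all_retract hX.
have l1 : linear (s \o i) by move=> a u v; rewrite /= !linearP.
have [si siE] := linear_pack l1.
have [x|a aE] := @lift_injective _ _ _ i' si ii'.
  by apply/iE'; rewrite siE /= sE; apply/iE; exists x.
have l2 : linear (fun x : K => (a x, i x) : K' * P).
  by move=> c u v; rewrite !linearP.
have [j jE] := linear_pack l2.
have l3 : linear (fun x : K' * P => t (i' x.1) + (x.2 - t (s x.2))).
  move=> c u v; rewrite /= !linearP /= !scalerDr.
  by rewrite [X in _ + X = _]addrACA [LHS]addrACA.
have [r0 r0E] := linear_pack l3.
have [x|r rE] := @lift_injective _ _ _ i r0 ii.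
  apply/iE; rewrite r0E linearD linearB !tE sE subrr addr0.
  by apply/iE'; exists x.1.
exists j, r => x; apply: ii; rewrite rE r0E jE /= aE siE /=.
by rewrite addrC subrK.
Qed.

Lemma pdk_all_pdk k M : pdk_all k M -> pdk k M.
Proof.
elim: k M => [//|k IH] M hM.
have [e es] := free_cover M; have [K [i iE]] := short_exact_exists es.
exists (free_on R M), K, i, e; split=> //; first exact: malg_projective.
by apply: IH; apply: hM iE; apply: malg_projective.
Qed.

Lemma pdk_retract k M N : retract M N -> pdk k N -> pdk k M.
Proof. by move=> rMN /pdk_pdk_all/(pdk_all_retract rMN)/pdk_all_pdk. Qed.

Lemma pdk_syzygy k M P K (i : {linear K -> P}) (e : {linear P -> M}) :
  projective_module P -> short_exact i e -> pdk k.+1 M -> pdk k K.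
Proof. by move=> hP ie /pdk_pdk_all hM; apply: pdk_all_pdk; apply: hM ie. Qed.

Lemma pdk_iso k M N (i : {linear M -> N}) : injective i ->
  (forall y, exists x, i x = y) -> pdk k M -> pdk k N.
Proof.
move=> ii is_; apply: pdk_retract.
have lid : linear (@id N) by [].
have [j jE] := linear_pack lid.
have [x|s sE] := @lift_injective _ _ _ i j ii; first by rewrite jE.
by exists s, i => x; rewrite sE jE.
Qed.

Lemma pdk_projective k P : projective_module P -> pdk k P.
Proof.
elim: k P => [//|k IH] P hP.
have [K [i iE]] := @short_exact_exists P P idfun (fun y => ex_intro _ y erefl).
exists P, K, i, idfun; split=> //.
apply: IH; apply: (projective_retract _ hP).
have [ii _ ik] := iE.
have l0 : linear (fun _ : P => 0 : K) by move=> a u v; rewrite scaler0 addr0.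
have [z zE] := linear_pack l0.
exists i, z => x; rewrite zE; apply: ii; rewrite linear0; apply/esym/ik.
by exists x.
Qed.

Lemma pdkS k M : pdk k M -> pdk k.+1 M.
Proof.
elim: k M => [|k IH] M; first exact: pdk_projective.
move=> [P [K [i [e [hP ie hK]]]]].
by exists P, K, i, e; split=> //; apply: IH.
Qed.

Lemma pdk_le k k' M : (k <= k')%N -> pdk k M -> pdk k' M.
Proof.
move=> /subnK <-; elim: (k' - k)%N => [//|d IH] hM.
by rewrite addSn; apply/pdkS/IH.
Qed.

(** The horseshoe lemma: covers [P1] of [K] and [P2] of [A] give a cover [P1 * P2] of [X], whose
    kernel [Z] is an extension of [K2] by [K1]. For [k = 0] the sequence splits. *)
Lemma pdk_extension k (K X A : lmodType R) (i : {linear K -> X}) (e : {linear X -> A}) :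
  short_exact i e -> pdk k K -> pdk k A -> pdk k X.
Proof.
elim: k K X A i e => [|k IH] K X A i e [ii es iE].
  move=> hK hA; apply: (projective_retract _ (projective_prod hK hA)).
  have [s sE] := hA _ _ e idfun es.
  have l1 : linear (fun x => x - s (e x)).
    by move=> a u v; rewrite !linearP scalerDr [LHS]addrACA.
  have [q qE] := linear_pack l1.
  have [x|p pE] := @lift_injective _ _ _ i q ii.
    by rewrite qE; apply/iE; rewrite linearB sE subrr.
  have l2 : linear (fun x => (p x, e x) : K * A).
    by move=> a u v; rewrite !linearP.
  have [f fE] := linear_pack l2.
  have l3 : linear (fun x : K * A => i x.1 + s x.2).
    by move=> a u v; rewrite /= !linearP /= scalerDr addrACA.
  have [g gE] := linear_pack l3.
  by exists f, g => x; rewrite gE fE /= pE qE subrK.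
move=> [P1 [K1 [i1 [e1 [hP1 [ii1 es1 iE1] hK1]]]]].
move=> [P2 [K2 [i2 [e2 [hP2 [ii2 es2 iE2] hK2]]]]].
have [s sE] := hP2 _ _ e e2 es.
have l1 : linear (fun x : P1 * P2 => i (e1 x.1) + s x.2).
  by move=> a u v; rewrite /= !linearP /= scalerDr addrACA.
have [f fE] := linear_pack l1.
have eiK x : e (i x) = 0 by apply/iE; exists x.
have fs y : exists x, f x = y.
  have [p2 p2E] := es2 (e y).
  have /iE[c cE] : e (y - s p2) = 0 by rewrite linearB sE p2E subrr.
  have [p1 p1E] := es1 c.
  by exists (p1, p2); rewrite fE /= p1E cE subrK.
have [Z [j [ij _ jE]]] := short_exact_exists fs.
exists (P1 * P2)%type, Z, j, f; split=> //; first exact: projective_prod.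
have f0 x : f x = 0 -> e2 x.2 = 0.
  by rewrite fE => /(congr1 e); rewrite linearD eiK add0r linear0 sE.
have l2 : linear (fun x : Z => (j x).2) by move=> a u v; rewrite linearP.
have [j2 j2E] := linear_pack l2.
have [x|b bE] := @lift_injective _ _ _ i2 j2 ii2.
  by apply/iE2; rewrite j2E; apply/f0/jE; exists x.
have l3 : linear (fun x : K1 => (i1 x, 0) : P1 * P2).
  by move=> a u v; rewrite linearP; congr (_, _); rewrite /= scaler0 addr0.
have [j1 j1E] := linear_pack l3.
have [x|a aE] := @lift_injective _ _ _ j j1 ij.
  apply/jE; rewrite fE j1E /= linear0 addr0.
  have -> : e1 (i1 x) = 0 by apply/iE1; exists x.
  by rewrite linear0.
apply: (IH _ _ _ a b _ hK1 hK2); split.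
- by move=> x y /(congr1 j); rewrite !aE !j1E => -[/ii1].
- move=> y; have /iE[c cE] : e (- s (i2 y)) = 0.
    by rewrite linearN sE; apply/eqP; rewrite oppr_eq0; apply/eqP/iE2; exists y.
  have [p pE] := es1 c.
  have /jE[z zE] : f (p, i2 y) = 0 by rewrite fE /= pE cE addNr.
  by exists z; apply: ii2; rewrite bE j2E zE.
- move=> x; split=> [bx|[y <-]]; last first.
    by apply: ii2; rewrite bE j2E aE j1E linear0.
  have x2 : (j x).2 = 0 by rewrite -j2E -bE bx linear0.
  have /iE1[y yE] : e1 (j x).1 = 0.
    apply: ii; rewrite linear0.
    have : f (j x) = 0 by apply/jE; exists x.
    by rewrite fE x2 linear0 addr0.
  exists y; apply: ij; rewrite aE j1E yE -x2.
  by case: (j x).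
Qed.

(** A cover [P] of [B] with kernel [K] also covers [C], and the kernel [X] of [P -> C] is an
    extension of [A] by [K]. *)
Lemma pdk_cokernel k (A B C : lmodType R) (i : {linear A -> B}) (e : {linear B -> C}) :
  short_exact i e -> pdk k A -> pdk k B -> pdk k.+1 C.
Proof.
move=> [ii es iE] hA; case: k hA => [|k] hA hB; first by exists B, A, i, e.
have [P [K [j [q [hP [ij qs jE] hK]]]]] := hB.
have l1 : linear (e \o q) by move=> a u v; rewrite /= !linearP.
have [f fE] := linear_pack l1.
have fs y : exists x, f x = y.
  have [b bE] := es y; have [p pE] := qs b.
  by exists p; rewrite fE /= pE bE.
have [X [m [im _ mE]]] := short_exact_exists fs.
exists P, X, m, f; split=> //.
have l2 : linear (q \o m) by move=> a u v; rewrite /= !linearP.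
have [qm qmE] := linear_pack l2.
have [x|b bE] := @lift_injective _ _ _ i qm ii.
  apply/iE; rewrite qmE; have /mE : exists z, m z = m x by exists x.
  by rewrite fE.
have [x|a aE] := @lift_injective _ _ _ m j im.
  apply/mE; rewrite fE /=.
  have -> : q (j x) = 0 by apply/jE; exists x.
  by rewrite linear0.
apply: (@pdk_extension _ _ _ _ a b) (pdkS hK) hA; split.
- by move=> x y /(congr1 m); rewrite !aE => /ij.
- move=> y; have [p pE] := qs (i y).
  have /mE[x xE] : f p = 0 by rewrite fE /= pE; apply/iE; exists y.
  by exists x; apply: ii; rewrite bE qmE /= xE.
- move=> x; split=> [bx|[y <-]]; last first.
    by apply: ii; rewrite bE qmE /= aE linear0; apply/jE; exists y.
  have /jE[y yE] : q (m x) = 0 by rewrite -[LHS]qmE -bE bx linear0.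
  by exists y; apply: im; rewrite aE.
Qed.
End Homological.

Section ProjectiveDimension.
Variable R : nzRingType.
Implicit Types M N P K : lmodType R.

Lemma pd_le_pdk n M : pd_le M n -> pdk n M.
Proof.
elim: n M => [|n IH] M [P [d [e [hP P0 es eE dE]]]].
  have ei : injective e.
    move=> x y exy; apply/eqP; rewrite -subr_eq0; apply/eqP.
    have /eE[z <-] : e (x - y) = 0 by rewrite linearB exy subrr.
    by rewrite (P0 1%N isT z) linear0.
  exact: (@pdk_iso _ 0 _ _ e ei es (hP 0%N)).
have [K [i [ii es' iE]]] := short_exact_exists es.
exists (P 0%N), K, i, e; split=> //; apply: IH.
have [x|f fE] := @lift_injective _ _ _ _ i (d 0%N) ii.
  by apply/iE/eE; exists x.
exists (fun j => P j.+1), (fun j => d j.+1), f; split.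
- by move=> j; apply: hP.
- by move=> j nj; apply: P0.
- move=> y; have /eE[x xE] : e (i y) = 0 by apply/iE; exists y.
  by exists x; apply: ii; rewrite fE.
- move=> x; rewrite -dE; split=> [fx|dx]; first by rewrite -fE fx linear0.
  by apply: ii; rewrite fE dx linear0.
- by move=> j x; apply: dE.
Qed.

Lemma projective_zero_module : projective_module 'rV[R]_0.
Proof.
move=> M N f g fs.
have l0 : linear (fun _ : 'rV[R]_0 => 0 : M) by move=> a u v; rewrite /= scaler0 addr0.
have [h hE] := linear_pack l0.
by exists h => x; rewrite hE [x]thinmx0 !linear0.
Qed.

Lemma pdk_pd_le n M : pdk n M -> pd_le M n.
Proof.
elim: n M => [|n IH] M.
  move=> hM; pose P i : lmodType R := if i is _.+1 then 'rV[R]_0 else M.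
  have d i : {linear P i.+1 -> P i}.
    have l0 : linear (fun _ : P i.+1 => 0 : P i).
      by move=> a u v; rewrite /= scaler0 addr0.
    by have /cid[h _] := linear_pack l0.
  have Pz i (x : P i.+1) : x = 0 by apply: thinmx0.
  exists P, d, (idfun : {linear P 0%N -> M}); split.
  - by case=> [|i] //; apply: projective_zero_module.
  - by case.
  - by move=> y; exists y.
  - move=> x; split=> [x0|[y yE]].
      by exists 0; rewrite linear0; apply/esym/x0.
    by rewrite -yE (Pz _ y) !linear0.
  - move=> i x; split=> _; first by exists 0; rewrite linear0 [RHS]Pz.
    by rewrite (Pz _ x) linear0.
move=> [Q [K [i [e [hQ [ii es iE] hK]]]]].
have [P [d [f [hP P0 fs fE dE]]]] := IH K hK.
pose P' j : lmodType R := if j is j'.+1 then P j' else Q.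
pose d' j : {linear P' j.+1 -> P' j} :=
  match j with 0%N => (i \o f : {linear _ -> _}) | j'.+1 => d j' end.
exists P', d', (e : {linear P' 0%N -> M}); split=> //.
- by case.
- by case=> // j nj; apply: P0.
- move=> x; rewrite [X in X <-> _]iE /=; split=> -[y <-].
    by have [z <-] := fs y; exists z.
  by exists (f y).
- case=> [x|j x] /=; last exact: dE.
  rewrite -fE; split=> [|->]; last exact: linear0.
  by rewrite -(linear0 i) => /ii.
Qed.

Lemma pd_leP n M : pd_le M n <-> pdk n M.
Proof. by split; [apply: pd_le_pdk | apply: pdk_pd_le]. Qed.

End ProjectiveDimension.

(** * Reduction modulo a nonzerodivisor *)

Section Torsion.
Variables (R : comNzRingType) (a : R).

Definition torsion_free_at (M : lmodType R) := forall x : M, a *: x = 0 -> x = 0.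

Hypothesis a_reg : forall r : R, a * r = 0 -> r = 0.

Lemma free_on_torsion_free (X : choiceType) : torsion_free_at (free_on R X).
Proof.
move=> g ag; have [D [c gE]] := free_on_rep g; rewrite gE.
rewrite big_seq big1 // => x xD; suff -> : c x = 0 by rewrite scale0r.
apply: a_reg; apply: (@free_on_indep _ _ D (fun x => a * c x)) => //.
rewrite -[RHS]ag gE scaler_sumr; apply: eq_bigr => y _.
by rewrite scalerA.
Qed.

Lemma projective_torsion_free (P : lmodType R) :
  projective_module P -> torsion_free_at P.
Proof.
move=> hP x ax; have [e es] := free_cover P.
have [s sE] := hP _ _ e idfun es.
rewrite -[x]/(idfun x) -sE; suff -> : s x = 0 by rewrite linear0.
by apply: free_on_torsion_free; rewrite -linearZ ax linear0.
Qed.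
End Torsion.

Section BaseChange.
Variables (R : comNzRingType) (R' : nzRingType) (f : {rmorphism R -> R'}).
Variable a : R.
Hypothesis f_surj : forall y, exists x, f x = y.
Hypothesis f_ker : forall x, f x = 0 <-> exists y, x = a * y.
Hypothesis a_reg : forall r : R, a * r = 0 -> r = 0.

Let fa : f a = 0. Proof. by apply/f_ker; exists 1; rewrite mulr1. Qed.

(* M' is M/aM, regarded as a module over R' = R/a. *)
Definition reduction (M : lmodType R) (M' : lmodType R') (q : M -> M') :=
  [/\ forall r x y, q (r *: x + y) = f r *: q x + q y,
      forall y, exists x, q x = y &
      forall x, q x = 0 <-> exists y, x = a *: y].

(** Lifting takes place over [R], where [M] is projective; since [a] acts by zero on [B], the lift
    factors through [M / aM]. *)
Lemma projective_reduction (M : lmodType R) (M' : lmodType R') (q : M -> M') :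
  reduction q -> projective_module M -> projective_module M'.
Proof.
move=> [ql qs qk] hM B C g h gs.
have lg : linear (g : restr_scalars f B -> restr_scalars f C).
  by move=> r x y; rewrite !restr_scaleE linearP.
have [g' g'E] := linear_pack lg.
have lh : linear (h \o q : M -> restr_scalars f C).
  by move=> r x y; rewrite /= ql linearP restr_scaleE.
have [h' h'E] := linear_pack lh.
have g's y : exists x, g' x = y.
  by have [x xE] := gs y; exists x; rewrite g'E.
have [k kE] := hM _ _ g' h' g's.
have [t tE] := choice qs.
have q0 : q 0 = 0.
  have := ql 0 0 0; rewrite scale0r addr0 rmorph0 scale0r add0r.
  by move=> E; apply/qk; exists 0; rewrite scaler0.
have k0 x y : q x = q y -> k x = k y.
  move=> E; apply/eqP; rewrite -subr_eq0 -linearB; apply/eqP.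
  have /qk[z ->] : q (x - y) = 0.
    by rewrite addrC -scaleN1r ql rmorphN1 scaleN1r E addNr.
  by rewrite linearZ /= restr_scaleE fa scale0r.
have lk : linear (fun y => k (t y) : B).
  move=> r' x y; have [r <-] := f_surj r'.
  rewrite -[RHS]/(r *: k (t x) + k (t y)) -linearP; apply: k0.
  by rewrite ql !tE.
have [k' k'E] := linear_pack lk.
exists k' => x; rewrite k'E -[LHS]/(g (k (t x))) -g'E kE h'E /= tE //.
Qed.

(** A free cover of [M] on all its elements reduces to the free [R']-module on the same generators.
    As [a] is regular on [M], the kernel [K'] of the reduced cover is [K / aK], and [K] is again
    torsion-free at [a]. *)
Lemma pdk_reduction k (M : lmodType R) (M' : lmodType R') (q : M -> M') :
  torsion_free_at a M -> reduction q -> pdk k M -> pdk k M'.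
Proof.
elim: k M M' q => [|k IH] M M' q tM red; first exact: projective_reduction red.
move=> hM; have [ql qs qk] := red.
have [e eE] := @free_on_map R M M id.
have es y : exists x, e x = y by exists (free_gen R y).
have [K [i [ii _ iE]]] := short_exact_exists es.
have hK : pdk k K by apply: (pdk_syzygy (i := i) (e := e)) hM; [exact: malg_projective|split].
have [e' e'E] := @free_on_map R' M _ q.
have e's y : exists x, e' x = y.
  by have [x <-] := qs y; exists (free_gen R' x); rewrite e'E.
have [K' [j [ij _ jE]]] := short_exact_exists e's.
exists (free_on R' M), K', j, e'; split=> //; first exact: malg_projective.
have [p pE] := @free_on_map R M (restr_scalars f (free_on R' M)) (fun x => free_gen R' x).
have pl r x y : p (r *: x + y) = f r *: (p x : free_on R' M) + p y.
  by rewrite linearP restr_scaleE.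
have psum (D : {fset M}) c : p (\sum_(x <- D) c x *: free_gen R x) =
    \sum_(x <- D) f (c x) *: free_gen R' x.
  rewrite linear_sum; apply: eq_bigr => x _.
  by rewrite linearZ /= restr_scaleE pE.
have epq x : e' (p x) = q (e x).
  have [D [c ->]] := free_on_rep x.
  rewrite psum linear_sum [X in q X]linear_sum.
  have q0 : q 0 = 0 by apply/qk; exists 0; rewrite scaler0.
  have qD u v : q (u + v) = q u + q v.
    by rewrite -[u]scale1r ql rmorph1 !scale1r.
  rewrite (big_morph q qD q0); apply: eq_bigr => y _.
  have -> : e (c y *: free_gen R y) = c y *: y by rewrite linearZ /= eE.
  by rewrite linearZ /= e'E -[c y *: y]addr0 ql q0 addr0.
have p0 x : p x = 0 -> exists y, x = a *: y.
  have [D [c xE]] := free_on_rep x; rewrite {1}xE psum => px0.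
  have /choice[s sE] (y : M) : exists r, y \in D -> c y = a * r.
    have [yD|] := boolP (y \in D); last by exists 0.
    by have /f_ker[r rE] := free_on_indep px0 yD; exists r.
  exists (\sum_(y <- D) s y *: free_gen R y).
  rewrite xE scaler_sumr big_seq [RHS]big_seq; apply: eq_bigr => y yD.
  by rewrite sE // scalerA.
have ps y : exists x, p x = y.
  have [D [c ->]] := free_on_rep (y : free_on R' M).
  have [s sE] := choice f_surj.
  exists (\sum_(y <- D) s (c y) *: free_gen R y).
  by rewrite psum; apply: eq_bigr => x _; rewrite sE.
have iK x : e (i x) = 0 by apply/iE; exists x.
have q0 : q 0 = 0 by apply/qk; exists 0; rewrite scaler0.
have /choice[g gE] (x : K) : exists y, j y = p (i x).
  by apply/jE; rewrite epq iK q0.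
apply: (IH _ _ g _ _ hK).
  move=> x ax; apply: ii; rewrite linear0.
  by apply: (free_on_torsion_free a_reg); rewrite -linearZ ax linear0.
split.
- by move=> r x y; apply: ij; rewrite linearP !gE linearP pl.
- move=> y; have [x xE] := ps (j y).
  (* The lift [x] is sent by [e] only into [aM]; subtracting [a *: m'] moves it into the kernel, and
     [p] does not see this change. *)
  have /qk[m mE] : q (e x) = 0 by rewrite -epq xE; apply/jE; exists y.
  have [m' m'E] := es m.
  have /iE[z zE] : e (x - a *: m') = 0 by rewrite linearB linearZ /= m'E mE subrr.
  exists z; apply: ij; rewrite gE zE linearB linearZ /= restr_scaleE fa scale0r.
  by rewrite subr0 xE.
- move=> x; split=> [gx|[y ->]].
    have /p0[y yE] : p (i x) = 0 by rewrite -gE gx linear0.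
    (* Torsion-freeness of [M] at [a] enters here, as the injectivity of [K / aK] into the reduced
       free module. *)
    have /iE[z zE] : e y = 0 by apply: tM; rewrite -linearZ -yE iK.
    by exists z; apply: ii; rewrite linearZ /= zE.
  apply: ij; rewrite gE linear0 linearZ linearZ /= restr_scaleE fa.
  by rewrite scale0r.
Qed.
End BaseChange.

(** * Linear forms and hyperplanes *)

Lemma mpoly_ring_ind (K : nzRingType) n (P : {mpoly K[n]} -> Prop) :
  (forall c, P c%:MP) -> (forall i, P 'X_i) ->
  (forall p q, P p -> P q -> P (p + q)) ->
  (forall p q, P p -> P q -> P (p * q)) -> forall p, P p.
Proof.
move=> PC PX PD PM; elim/mpolyind => [|c m p _ _ Pp]; first by rewrite -mpolyC0.
apply: PD => //; rewrite -mul_mpolyC; apply: (PM) => //.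
rewrite mpolyXE_id; apply: (big_ind P _ PM) => [|i _]; first by rewrite -mpolyC1.
by elim: (m i) => [|k IH]; [rewrite expr0 -mpolyC1 | rewrite exprS; apply: (PM)].
Qed.

Section LinearSubstitution.
Variable K : fieldType.

Definition lform n (a : 'rV[K]_n) : {mpoly K[n]} := \sum_i a 0 i *: 'X_i.

Lemma lformD n (a b : 'rV[K]_n) : lform (a + b) = lform a + lform b.
Proof.
by rewrite /lform -big_split; apply: eq_bigr => i _; rewrite mxE scalerDl.
Qed.

Lemma lformZ n c (a : 'rV[K]_n) : lform (c *: a) = c *: lform a.
Proof.
by rewrite /lform scaler_sumr; apply: eq_bigr => i _; rewrite mxE scalerA.
Qed.

Lemma lform_delta n (i : 'I_n) : lform (delta_mx 0 i) = 'X_i.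
Proof.
rewrite /lform (bigD1 i) //= big1 => [|j ji]; rewrite mxE ?eqxx ?scale1r ?addr0 //.
by rewrite (negPf ji) scale0r.
Qed.

Lemma lform0 n : lform (0 : 'rV[K]_n) = 0.
Proof. by rewrite -(scale0r 0) lformZ scale0r. Qed.

Lemma lform_sum n I (r : seq I) (c : I -> 'rV[K]_n) :
  lform (\sum_(i <- r) c i) = \sum_(i <- r) lform (c i).
Proof. by apply: big_morph; [apply: lformD | apply: lform0]. Qed.

Lemma mderiv_lform n (a : 'rV[K]_n) i : (lform a)^`M(i) = (a 0 i)%:MP.
Proof.
rewrite /lform raddf_sum (bigD1 i) //= big1 => [|j ji]; rewrite mderivZ mderivX.
  by rewrite mnm1E eqxx addr0 scale1r -alg_mpolyC; congr (_ *: _); rewrite -mpolyX0; congr mpolyX; apply/mnmP=> j; rewrite mnmBE subnn mnm0E.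
by rewrite mnm1E (negPf ji) scale0r scaler0.
Qed.

Lemma lform_inj n : injective (@lform n).
Proof.
move=> a b ab; apply/rowP => i; apply: (can_inj (@mpolyCK n K)).
by rewrite -!mderiv_lform ab.
Qed.

(** Pullback of polynomials along [y |-> y *m N^T]. Hence the transposes later on: [subst Phi^T]
    restricts to the hyperplane parametrised by the rows of [Phi]. *)
Definition subst n k (N : 'M[K]_(n, k)) : {mpoly K[n]} -> {mpoly K[k]} :=
  mmap (@mpolyC k K) (fun i => lform (row i N)).

HB.instance Definition _ n k (N : 'M[K]_(n, k)) :=
  GRing.RMorphism.copy (@subst n k N)
    (mmap (@mpolyC k K) (fun i => lform (row i N))).

Lemma substC n k (N : 'M[K]_(n, k)) c : subst N c%:MP = c%:MP.
Proof. exact: mmapC. Qed.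

Lemma substZ n k (N : 'M[K]_(n, k)) c p : subst N (c *: p) = c *: subst N p.
Proof. by rewrite -mul_mpolyC rmorphM /= substC mul_mpolyC. Qed.

Lemma substX n k (N : 'M[K]_(n, k)) i : subst N 'X_i = lform (row i N).
Proof. by rewrite /subst mmapX mmap1U. Qed.

Lemma subst_lform n k (N : 'M[K]_(n, k)) a :
  subst N (lform a) = lform (a *m N).
Proof.
rewrite mulmx_sum_row lform_sum rmorph_sum; apply: eq_bigr => i _ /=.
by rewrite substZ substX lformZ.
Qed.

Lemma subst_subst n k m (N : 'M[K]_(n, k)) (N' : 'M[K]_(k, m)) p :
  subst N' (subst N p) = subst (N *m N') p.
Proof.
elim/mpoly_ring_ind: p => [c|i|p q|p q].
- by rewrite !substC.
- by rewrite !substX subst_lform row_mul.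
- by rewrite !rmorphD /= => -> ->.
- by rewrite !rmorphM /= => -> ->.
Qed.

Lemma subst1 n p : subst (1%:M : 'M[K]_n) p = p.
Proof.
elim/mpoly_ring_ind: p => [c|i|p q|p q].
- by rewrite substC.
- by rewrite substX rowE mulmx1 lform_delta.
- by rewrite !rmorphD /= => -> ->.
- by rewrite !rmorphM /= => -> ->.
Qed.

(* Substituting the projection onto the hyperplane a = 0 along v changes a
   polynomial by a multiple of a. *)
Lemma proj_subst_mod l (a v : 'rV[K]_l) p :
  exists q, p - subst (1%:M - a^T *m v)^T p = lform a * q.
Proof.
elim/mpoly_ring_ind: p => [c|i|p q [p' pE] [q' qE]|p q [p' pE] [q' qE]].
- by exists 0; rewrite !substC subrr mulr0.
- exists (v 0 i)%:MP; rewrite substX.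
  have -> : row i (1%:M - a^T *m v)^T = delta_mx 0 i + - v 0 i *: a.
    apply/rowP => j; rewrite !mxE big_ord1 !mxE eqxx mulNr [v 0 i * _]mulrC.
    by rewrite eq_sym.
  rewrite lformD lformZ lform_delta scaleNr opprD opprK addrA subrr add0r.
  by rewrite mulrC mul_mpolyC.
- by exists (p' + q'); rewrite !rmorphD /= opprD addrACA pE qE mulrDr.
- exists (p' * q + subst (1%:M - a^T *m v)^T p * q').
  rewrite !rmorphM /= mulrDr [in RHS]mulrA -pE [lform a * _]mulrCA -qE.
  by rewrite mulrBl mulrBr addrA subrK.
Qed.

(** The projection along a vector [v] with a(v) = 1 is a ring endomorphism whose kernel consists of
    the multiples of [lform a], and its values lie in a domain. *)
Lemma lform_prime l (a : 'rV[K]_l) p q r : a != 0 -> p * q = lform a * r ->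
  (exists p', p = lform a * p') \/ (exists q', q = lform a * q').
Proof.
move=> /rV0Pn[i ai] pq.
pose v : 'rV[K]_l := (a 0 i)^-1 *: delta_mx 0 i.
have va : a *m v^T = 1%:M.
  rewrite /v [_^T]linearZ /= -scalemxAr trmx_delta -colE.
  by apply/matrixP => j k; rewrite !ord1 !mxE mulVf.
have P0 : subst (1%:M - a^T *m v)^T (lform a) = 0.
  rewrite subst_lform linearB /= trmx1 trmx_mul trmxK mulmxBr mulmx1 mulmxA va.
  by rewrite mul1mx subrr lform0.
have ker f : subst (1%:M - a^T *m v)^T f = 0 -> exists f', f = lform a * f'.
  by move=> f0; have [f' E] := proj_subst_mod a v f; exists f'; rewrite -E f0 subr0.
have := congr1 (subst (1%:M - a^T *m v)^T) pq; rewrite !rmorphM /= P0 mul0r.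
by move=> /eqP; rewrite mulf_eq0 => /orP[] /eqP/ker; [left|right].
Qed.

(* The rows of Phi are a basis of the hyperplane a = 0 of K^l, v is a vector
   with a(v) = 1, and G gives the coordinates of the projection along v. *)
Definition hyp_coords l n (a v : 'rV[K]_l) (Phi : 'M[K]_(n, l))
    (G : 'M[K]_(l, n)) : Prop :=
  [/\ v *m a^T = 1%:M, Phi *m a^T = 0, Phi *m G = 1%:M &
      G *m Phi = 1%:M - a^T *m v].

Section HypCoords.
Variables (l n : nat) (a v : 'rV[K]_l) (Phi : 'M[K]_(n, l)) (G : 'M[K]_(l, n)).
Hypothesis hc : hyp_coords a v Phi G.

Lemma hyp_substK p : subst Phi^T (subst G^T p) = p.
Proof.
by case: hc => _ _ PG _; rewrite subst_subst -trmx_mul PG trmx1 subst1.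
Qed.

Lemma hyp_subst_mod p : exists q,
  p - subst G^T (subst Phi^T p) = lform a * q.
Proof.
have [q qE] := proj_subst_mod a v p; exists q; rewrite -qE subst_subst -trmx_mul.
by case: hc => _ _ _ ->.
Qed.

Lemma hyp_subst_form : subst Phi^T (lform a) = 0.
Proof.
case: hc => _ Pa _ _; rewrite subst_lform -[X in X *m _]trmxK -trmx_mul Pa.
by rewrite trmx0 lform0.
Qed.

Lemma hyp_subst_ker p : subst Phi^T p = 0 <-> exists q, p = lform a * q.
Proof.
split=> [p0|[q ->]]; last by rewrite rmorphM /= hyp_subst_form mul0r.
by have [q qE] := hyp_subst_mod p; exists q; rewrite -qE p0 rmorph0 subr0.
Qed.

End HypCoords.

(** The hyperplane where the last variable vanishes, used for the induction on the number of
    variables in the depth argument. *)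
Lemma coord_hyp_coords n : let D := (\matrix_(k < n, i < n.+1)
    (i == lift ord_max k)%:R : 'M[K]_(n, n.+1)) in
  hyp_coords (delta_mx 0 ord_max) (delta_mx 0 ord_max) D D^T.
Proof.
move=> D; split.
- by rewrite trmx_delta mul_delta_mx; apply/matrixP => i j; rewrite !mxE !ord1.
- rewrite trmx_delta -colE; apply/matrixP => i j; rewrite !mxE.
  by rewrite (negPf (neq_lift _ _)).
- apply/matrixP => i j; rewrite !mxE (bigD1 (lift ord_max i)) //= big1 => [|k ki].
    by rewrite !mxE eqxx mul1r addr0 (inj_eq lift_inj).
  by rewrite !mxE (negPf ki) mul0r.
- apply/matrixP => i j; rewrite trmx_delta mul_delta_mx !mxE.
  case: (unliftP ord_max j) => [k ->|->].
    rewrite (bigD1 k) //= big1 => [|m mk].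
      rewrite !mxE eqxx mulr1 addr0 [lift _ _ == _]eq_sym.
      by rewrite (negPf (neq_lift _ _)) andbF subr0.
    by rewrite !mxE (inj_eq lift_inj) [k == m]eq_sym (negPf mk) mulr0.
  rewrite big1 => [|k _]; first by rewrite eqxx andbT; case: eqP; rewrite subrr.
  by rewrite !mxE (negPf (neq_lift _ _)) mulr0.
Qed.
End LinearSubstitution.

(** * Depth of modules over polynomial rings *)

Section Depth.
Variable K : fieldType.

Definition torsion_free (R : idomainType) (M : lmodType R) :=
  forall r : R, r != 0 -> torsion_free_at r M.

Lemma torsion_free_projective (R : idomainType) (P : lmodType R) :
  projective_module P -> torsion_free P.
Proof.
move=> hP r r0; apply: projective_torsion_free hP => s /eqP.
by rewrite mulf_eq0 (negPf r0) => /eqP.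
Qed.

(** A case of the Auslander-Buchsbaum formula: below projective dimension [n] there are no nonzero
    maps from the residue field K to [M]. *)
Definition depth_ge1 n := forall k (M : lmodType {mpoly K[n]}) (y : M),
  (k < n)%N -> pdk k M -> (forall j, 'X_j *: y = 0) -> y = 0.

(** The next case, the vanishing of Ext^1 of K with values in [M], expressed inside a torsion-free
    module containing [M]. *)
Definition depth_ge2 n := forall k (M N : lmodType {mpoly K[n]})
    (i : {linear M -> N}) (y : N),
  (k.+1 < n)%N -> injective i -> torsion_free N -> pdk k M ->
  (forall j, exists m, i m = 'X_j *: y) -> exists m, i m = y.

Lemma mpolyX_neq0 n (j : 'I_n) : 'X_j != 0 :> {mpoly K[n]}.
Proof. by rewrite -msize_poly_eq0 msizeX. Qed.

(** The variables multiply a lift of [y] to a cover into the syzygy, whose projective dimension is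
    smaller by one, so that the second property applies to it. *)
Lemma depth_ge1_of_ge2 n : depth_ge2 n -> depth_ge1 n.
Proof.
move=> d2 [|k] M y kn hM yX.
  by apply: (torsion_free_projective hM) (mpolyX_neq0 (Ordinal kn)) _ (yX _).
have [P [L [i [e [hP [ii es iE] hL]]]]] := hM.
have [p pE] := es y.
have /(_ _)[|x xE] := d2 k L P i p kn ii (torsion_free_projective hP) hL.
  by move=> j; apply/iE; rewrite linearZ /= pE yX.
by rewrite -pE -xE; apply/iE; exists x.
Qed.

(* If y times the last variable x is m, then m vanishes in M / xM: it is killed by
   the other variables, and M / xM has depth at least 1. *)
Lemma depth_ge2_of_ge1 n : depth_ge1 n -> depth_ge2 n.+1.
Proof.
move=> d1 k M N i y kn ii tN hM yX.
set Xm : {mpoly K[n.+1]} := 'X_ord_max.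
have hc := coord_hyp_coords K n; set D := matrix_of_fun _ _ in hc.
have XmE : lform (delta_mx 0 ord_max) = Xm by rewrite lform_delta.
pose pi : {rmorphism {mpoly K[n.+1]} -> {mpoly K[n]}} := subst D^T.
pose sg : {rmorphism {mpoly K[n]} -> {mpoly K[n.+1]}} := subst D^T^T.
have tM : torsion_free M.
  move=> r r0 x rx; apply: ii; rewrite linear0; apply: (tN r) => //.
  by rewrite -linearZ rx linear0.
have [|a u w [u' ->] [w' ->]|C [e [es eE]]] :=
    @quotient_exists _ M (fun x => exists z, x = Xm *: z).
- by exists 0; rewrite scaler0.
- by exists (a *: u' + w'); rewrite scalerDr !scalerA mulrC.
(* The quotient becomes a module in one variable less through the section [sg] of [pi]. Since the
   last variable acts on it by zero, [r] and [sg (pi r)] act alike. *)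
have red : reduction pi Xm (e : M -> restr_scalars sg C).
  split=> // r u w; rewrite restr_scaleE linearP.
  suff rE : r *: e u = sg (pi r) *: e u by rewrite -rE.
  have [q qE] := hyp_subst_mod hc r.
  apply/eqP; rewrite -subr_eq0 -scalerBl qE XmE -linearZ; apply/eqP/eE.
  by exists (q *: u); rewrite scalerA.
have hC : pdk k (restr_scalars sg C).
  apply: pdk_reduction red hM.
  - by move=> z; exists (sg z); apply: hyp_substK hc _.
  - by move=> z; rewrite -XmE; apply: hyp_subst_ker hc _.
  - move=> r /eqP; rewrite mulf_eq0 (negPf (mpolyX_neq0 _)) => /eqP.
    by [].
  - exact: tM (mpolyX_neq0 _).
have [m mE] := yX ord_max.
have /eE[m' m'E] : e m = 0.
  apply: (d1 k (restr_scalars sg C)) => // j.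
  rewrite restr_scaleE /sg /= substX trmxK.
  have -> : row j D = delta_mx 0 (lift ord_max j).
    by apply/rowP => c; rewrite !mxE.
  rewrite lform_delta -linearZ; apply/eE.
  have [w wE] := yX (lift ord_max j); exists w; apply: ii.
  by rewrite !linearZ /= mE wE !scalerA mulrC.
exists m'; apply/eqP; rewrite -subr_eq0; apply/eqP.
apply: (tN Xm); first exact: mpolyX_neq0.
by rewrite scalerBr -mE m'E linearZ subrr.
Qed.

Lemma mpoly_depth_ge2 n : depth_ge2 n.
Proof.
by elim: n => [|n IH]; [move=> k | apply/depth_ge2_of_ge1/depth_ge1_of_ge2].
Qed.
End Depth.

(** * Hilbert's syzygy theorem *)

Section PolyAction.
Variables (R : comNzRingType) (N : lmodType R).

Definition poly_module (y : {linear N -> N}) : Type := N.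

Variable y : {linear N -> N}.
Local Notation T := (poly_module y).

HB.instance Definition _ := GRing.Zmodule.on T.

Definition poly_scale (p : {poly R}) (t : T) : T :=
  \sum_(i < size p) p`_i *: iter i y t.

Lemma poly_scaleE d (p : {poly R}) (t : T) : (size p <= d)%N ->
  poly_scale p t = \sum_(i < d) p`_i *: iter i y t.
Proof.
move=> pd; rewrite /poly_scale (big_ord_widen _ (fun i => p`_i *: iter i y t) pd).
rewrite big_mkcond; apply: eq_bigr => i _; case: ltnP => // /(nth_default 0) ->.
by rewrite scale0r.
Qed.

Lemma iter_linear i a (u v : N) : iter i y (a *: u + v) = a *: iter i y u + iter i y v.
Proof. by elim: i => //= i ->; rewrite linearP. Qed.

Lemma poly_scaleC c (t : T) : poly_scale c%:P t = c *: (t : N).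
Proof.
rewrite (@poly_scaleE 1) ?size_polyC_leq1 // big_ord_recl big_ord0 addr0.
by rewrite coefC.
Qed.

Lemma poly_scaleMX p (t : T) : poly_scale (p * 'X) t = poly_scale p (y t).
Proof.
rewrite (@poly_scaleE (size p).+1) ?(leq_trans (size_polyMleq _ _)) ?size_polyX ?addn2 //.
rewrite big_ord_recl coefMX scale0r add0r; apply: eq_bigr => i _.
by rewrite coefMX /= -iterSr.
Qed.

Fact poly_scaleDl t : {morph poly_scale^~ t : a b / a + b}.
Proof.
move=> p q; pose d := maxn (size p) (size q).
rewrite !(@poly_scaleE d) ?leq_maxl ?leq_maxr ?size_polyD //.
by rewrite -big_split; apply: eq_bigr => i _; rewrite coefD scalerDl.
Qed.

Fact poly_scaleDr : right_distributive poly_scale +%R.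
Proof.
move=> p s t; rewrite -big_split; apply: eq_bigr => i _.
by rewrite -[s]scale1r iter_linear !scale1r scalerDr.
Qed.

Lemma poly_scale_y p (t : T) : poly_scale p (y t) = y (poly_scale p t).
Proof.
by rewrite linear_sum; apply: eq_bigr => i _; rewrite linearZ -iterS -iterSr.
Qed.

Fact poly_scaleA p q t : poly_scale p (poly_scale q t) = poly_scale (p * q) t.
Proof.
elim/poly_ind: p t => [|p c IH] t.
  by rewrite mul0r -[0]/(polyC 0) !poly_scaleC !scale0r.
rewrite mulrDl !poly_scaleDl mulrAC !poly_scaleMX -poly_scale_y IH.
congr (_ + _); rewrite poly_scaleC mul_polyC.
rewrite (@poly_scaleE (size q) (c *: q)) ?size_scale_leq // scaler_sumr.
by apply: eq_bigr => i _; rewrite coefZ scalerA.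
Qed.

Fact poly_scale1 : left_id 1 poly_scale.
Proof. by move=> t; rewrite -[1]/(polyC 1) poly_scaleC scale1r. Qed.

HB.instance Definition _ := GRing.Zmodule_isLmodule.Build {poly R} T
  poly_scaleA poly_scale1 poly_scaleDr poly_scaleDl.

Lemma poly_moduleC c (t : T) : c%:P *: t = c *: (t : N) :> N.
Proof. exact: poly_scaleC. Qed.

Lemma poly_moduleX (t : T) : 'X *: t = y t :> N.
Proof.
rewrite -[LHS]/(poly_scale 'X t) -['X]mul1r poly_scaleMX.
exact: poly_scale1.
Qed.
End PolyAction.

Module Export FinSeqModule.
Section FinSeq.
Variables (R : comNzRingType) (M : lmodType R).
Import monalg.

(** Only the additive group of [{malg M[nat]}] is kept; scalars from [R] act on the coefficients,
    which lie in a module. *)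
Definition finseq : Type := {malg M[nat]}.
#[export] HB.instance Definition _ := GRing.Zmodule.copy finseq {malg M[nat]}.
Definition fcoef (t : finseq) k : M := mcoeff k (t : {malg M[nat]}).

Lemma fcoefD s t k : fcoef (s + t) k = fcoef s k + fcoef t k.
Proof. exact: mcoeffD. Qed.

Lemma fcoef_inj s t : fcoef s =1 fcoef t -> s = t.
Proof. by move=> st; apply/malgP. Qed.

Definition finseq_scale (a : R) (t : finseq) : finseq :=
  [malg k in msupp (t : {malg M[nat]}) => a *: fcoef t k].

Lemma fcoef_scale a t k : fcoef (finseq_scale a t) k = a *: fcoef t k.
Proof.
rewrite /fcoef mcoeffE; case: ifPn => // kt.
by rewrite mcoeff_outdom // scaler0.
Qed.

Fact finseq_scaleA a b x : finseq_scale a (finseq_scale b x) = finseq_scale (a * b) x.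
Proof. by apply: fcoef_inj => k; rewrite !fcoef_scale scalerA. Qed.
Fact finseq_scale1 : left_id 1 finseq_scale.
Proof. by move=> x; apply: fcoef_inj => k; rewrite !fcoef_scale scale1r. Qed.
Fact finseq_scaleDr : right_distributive finseq_scale +%R.
Proof.
by move=> a x y; apply: fcoef_inj => k; rewrite !(fcoef_scale, fcoefD) scalerDr.
Qed.
Fact finseq_scaleDl x : {morph finseq_scale^~ x : a b / a + b}.
Proof.
by move=> a b; apply: fcoef_inj => k; rewrite !(fcoef_scale, fcoefD) scalerDl.
Qed.
#[export] HB.instance Definition _ := GRing.Zmodule_isLmodule.Build R finseq
  finseq_scaleA finseq_scale1 finseq_scaleDr finseq_scaleDl.

Lemma fcoefP a s t k : fcoef (a *: s + t) k = a *: fcoef s k + fcoef t k.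
Proof. by rewrite fcoefD fcoef_scale. Qed.

Lemma fcoef0 k : fcoef 0 k = 0.
Proof. exact: mcoeff0. Qed.

Lemma fcoef_bound t : exists d, forall k, (d <= k)%N -> fcoef t k = 0.
Proof.
exists (\max_(k <- msupp (t : {malg M[nat]})) k).+1 => k tk; apply: mcoeff_outdom.
by apply: contraTN tk => kt; rewrite -ltnNge ltnS; apply: leq_bigmax_seq.
Qed.

Definition shift_seq (t : finseq) : finseq :=
  [malg k in [fset i.+1 | i in msupp (t : {malg M[nat]})]%fset => fcoef t k.-1].

Lemma fcoef_shift t k : fcoef (shift_seq t) k = if k is i.+1 then fcoef t i else 0.
Proof.
rewrite /fcoef mcoeffE; case: k => [|i].
  by case: ifP => // /imfsetP[].
case: ifPn => // it; rewrite mcoeff_outdom //.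
by apply: contra it => it; apply/imfsetP; exists i.
Qed.

Fact shift_seq_linear : linear shift_seq.
Proof.
move=> a s t; apply: fcoef_inj => -[|k]; rewrite fcoefP !fcoef_shift.
  by rewrite scaler0 addr0.
by rewrite fcoefP.
Qed.
#[export] HB.instance Definition _ := GRing.isLinear.Build R finseq finseq *:%R shift_seq
  shift_seq_linear.

Definition const_seq (m : M) : finseq := mkmalgU 0%N m.

Lemma fcoef_const m k : fcoef (const_seq m) k = if k is 0%N then m else 0.
Proof. by rewrite /fcoef mcoeffU; case: k. Qed.
End FinSeq.
End FinSeqModule.

Section PolyExtension.
Variables (R : comNzRingType) (M : lmodType R).

(* M[y], as a module over R[y]. *)
Definition poly_ext : lmodType {poly R} := poly_module (@shift_seq R M).

Definition pcoef (t : poly_ext) k : M := fcoef (t : finseq M) k.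
Definition pconst (m : M) : poly_ext := const_seq m.

Lemma pcoefD s t k : pcoef (s + t) k = pcoef s k + pcoef t k.
Proof. exact: fcoefD. Qed.

Lemma pcoef0 k : pcoef 0 k = 0.
Proof. exact: fcoef0. Qed.

Lemma pcoef_sum I (r : seq I) (F : I -> poly_ext) k :
  pcoef (\sum_(i <- r) F i) k = \sum_(i <- r) pcoef (F i) k.
Proof.
by apply: (big_morph (pcoef^~ k)) => [s t|]; [apply: pcoefD | apply: pcoef0].
Qed.

Lemma pcoefC a t k : pcoef (a%:P *: t) k = a *: pcoef t k.
Proof. by rewrite /pcoef poly_moduleC fcoef_scale. Qed.

Lemma pcoefX t k : pcoef ('X *: t) k = if k is i.+1 then pcoef t i else 0.
Proof. by rewrite /pcoef poly_moduleX fcoef_shift. Qed.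

Lemma pcoef_inj s t : pcoef s =1 pcoef t -> s = t.
Proof. exact: fcoef_inj. Qed.

Lemma pcoef_const m k : pcoef (pconst m) k = if k is 0%N then m else 0.
Proof. exact: fcoef_const. Qed.

Lemma pconstD m m' : pconst (m + m') = pconst m + pconst m'.
Proof.
apply: pcoef_inj => k; rewrite pcoefD !pcoef_const.
by case: k => //; rewrite addr0.
Qed.

Lemma pconstZ a m : pconst (a *: m) = a%:P *: pconst m.
Proof.
by apply: pcoef_inj => -[|k]; rewrite pcoefC !pcoef_const ?scaler0.
Qed.

Lemma pcoefXn i t k : pcoef ('X^i *: t) k = if (i <= k)%N then pcoef t (k - i)%N else 0.
Proof.
elim: i k => [|i IH] k; first by rewrite expr0 scale1r subn0.
by rewrite exprS -scalerA pcoefX; case: k => // k; rewrite IH ltnS subSS.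
Qed.

Lemma poly_ext_decomp t : exists d,
  (forall k, (d <= k)%N -> pcoef t k = 0) /\
  t = \sum_(i < d) 'X^i *: pconst (pcoef t i).
Proof.
have [d dP] := fcoef_bound (t : finseq M); exists d; split=> //.
apply: pcoef_inj => k; rewrite pcoef_sum.
have [dk|kd] := leqP d k.
  rewrite [LHS]dP // big1 // => i _; rewrite pcoefXn pcoef_const.
  case: leqP => // _; have : (0 < k - i)%N by rewrite subn_gt0 (leq_trans _ dk).
  by case: (k - i)%N.
rewrite (bigD1 (Ordinal kd)) //= pcoefXn leqnn subnn pcoef_const.
rewrite big1 ?addr0 // => i ik; rewrite pcoefXn pcoef_const.
case: leqP => // ik'; have : (0 < k - i)%N.
  by rewrite subn_gt0 ltn_neqAle ik' andbT; apply: contra ik => /eqP ik; apply/eqP/val_inj.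
by case: (k - i)%N.
Qed.

(* The map sum_i y^i m_i |-> sum_i s^i (h m_i). *)
Lemma poly_ext_map (B : zmodType) (h : M -> B) (s : B -> B) :
  {morph h : x y / x + y} -> {morph s : x y / x + y} ->
  exists H : poly_ext -> B,
  [/\ {morph H : x y / x + y}, forall m, H (pconst m) = h m &
      forall t, H ('X *: t) = s (H t)].
Proof.
move=> hD sD.
have h0 : h 0 = 0 by apply: (@addrI _ (h 0)); rewrite -hD !addr0.
have s0 : s 0 = 0 by apply: (@addrI _ (s 0)); rewrite -sD !addr0.
have it0 i : iter i s 0 = 0 by elim: i => //= i ->.
have itD i x y : iter i s (x + y) = iter i s x + iter i s y.
  by elim: i => //= i ->.
pose S d t := \sum_(i < d) iter i s (h (pcoef t i)).
have SE d d' t : (forall k, (d <= k)%N -> pcoef t k = 0) -> (d <= d')%N ->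
    S d' t = S d t.
  move=> td dd'; rewrite /S (big_ord_widen _ (fun i => iter i s (h (pcoef t i))) dd').
  rewrite [RHS]big_mkcond; apply: eq_bigr => i _.
  by case: ltnP => // di; rewrite td // h0 it0.
have [b bP] := choice (fun t => poly_ext_decomp t).
have bS t k : (b t <= k)%N -> pcoef t k = 0 by case: (bP t) => + _; apply.
have SbE d t : (b t <= d)%N -> S (b t) t = S d t.
  by move=> td; rewrite (SE _ _ _ (bS t) td).
exists (fun t => S (b t) t); split.
- move=> t u; pose d := maxn (b (t + u)) (maxn (b t) (b u)).
  rewrite !(SbE d) ?leq_max ?leqnn ?orbT // /S -big_split.
  by apply: eq_bigr => i _; rewrite pcoefD hD itD.
- move=> m; pose d := (b (pconst m)).+1.
  rewrite (SbE d) // /S big_ord_recl big1 ?addr0 /= ?pcoef_const // => i _.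
  by rewrite pcoef_const h0 it0 s0.
- move=> t; pose d := maxn (b t) (b ('X *: t)).
  rewrite (SbE d.+1) ?(SbE d t) ?leq_maxl //; last first.
    by apply: leqW; apply: leq_maxr.
  rewrite /S big_ord_recl pcoefX h0 /= add0r (big_morph s sD s0).
  by apply: eq_bigr => i _; rewrite pcoefX.
Qed.
End PolyExtension.

Section LinearSections.
Variables (K : fieldType) (n : nat).
Implicit Types B C M : lmodType {mpoly K[n]}.
Import classical_sets.

Let Klinear B (G : set B) := forall c x y, G x -> G y -> G (c%:MP *: x + y).

(** Surjections split over the field K. Zorn's lemma is applied to partial K-linear sections of [f],
    encoded as their graphs in [C * B]. *)
Lemma linear_section B C (f : {linear B -> C}) :
  (forall y, exists x, f x = y) ->
  exists s : C -> B, (forall y, f (s y) = y) /\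
    forall c x y, s (c%:MP *: x + y) = c%:MP *: s x + s y.
Proof.
move=> fs.
pose P (G : set (C * B)) := [/\ forall c b, G (c, b) -> f b = c,
  forall b, G (0, b) -> b = 0 & Klinear G].
have [F FP Ftot|G [[Gf G0 Gl] Gmax]] := @Zorn_bigcup _ P.
  split.
  - by move=> c b [X FX Xcb]; case: (FP X FX) => + _ _; apply.
  - by move=> b [X FX Xb]; case: (FP X FX) => _ + _; apply.
  - move=> c x y [X FX Xx] [Y FY Yy].
    have [XY|YX] := Ftot X Y FX FY.
      by exists Y => //; case: (FP Y FY) => _ _ Yl; apply: Yl => //; apply: XY.
    by exists X => //; case: (FP X FX) => _ _ Xl; apply: Xl => //; apply: YX.
(* The empty relation satisfies [P] as well. A relation without (0, 0) is empty, because [Gl] with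
   scalar -1 produces (0, 0) from any element; maximality excludes this. *)
have G00 : G (0, 0).
  apply: contrapT => nG; apply: (Gmax (fun z => z = (0, 0))); last first.
    split; first by move=> c b [-> ->]; rewrite linear0.
      by move=> b [->].
    by move=> c x y -> ->; rewrite /= scaler0 addr0.
  split=> [[c b] Gcb|]; last by move=> /(_ (0, 0)) /(_ erefl).
  exfalso; apply: nG.
  have := Gl (-1) _ _ Gcb Gcb.
  by rewrite mpolyCN mpolyC1 scaleN1r addNr.
have dom y : exists x, G (y, x).
  apply: contrapT => ny.
  have [b0 b0E] := fs y.
  pose G' : set (C * B) := fun z => exists c z0, G z0 /\ z = c%:MP *: (y, b0) + z0.
  apply: (Gmax G'); last first.
    split.
    - move=> c b [k [[c1 b1] [Gz [-> ->]]]].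
      by rewrite linearP b0E (Gf _ _ Gz).
    - move=> b [k [[c1 b1] [Gz [E ->]]]]; have [k0|k0] := eqVneq k 0.
        move: E Gz; rewrite k0 mpolyC0 !scale0r !add0r => <- /G0.
        by [].
      exfalso; apply: ny; exists (- (k^-1)%:MP *: b1).
      have := Gl (- k^-1) _ _ Gz G00; rewrite addr0 mpolyCN.
      have -> : y = - (k^-1)%:MP *: c1; last by [].
      move/esym/eqP: E; rewrite addrC addr_eq0 => /eqP ->.
      by rewrite scalerN scaleNr opprK scalerA -mpolyCM mulVf // mpolyC1 scale1r.
    - move=> c x z [k [x0 [Gx ->]]] [k' [z0 [Gz ->]]].
      exists (c * k + k'), (c%:MP *: x0 + z0); split; first exact: Gl.
      by rewrite scalerDr scalerA -mpolyCM addrACA -scalerDl -mpolyCD.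
  split=> [z Gz|sub]; first by exists 0, z; rewrite mpolyC0 scale0r add0r.
  apply: ny; exists b0; apply: sub; exists 1, (0, 0); split=> //.
  by rewrite mpolyC1 scale1r addr0.
have [s sE] := choice dom; exists s; split=> [y|c x y]; first exact: Gf.
have H := Gl c _ _ (sE x) (sE y); have H' := sE (c%:MP *: x + y).
apply/eqP; rewrite -subr_eq0 -oppr_eq0 opprB addrC; apply/eqP/G0.
have := Gl (-1) _ _ H' H; rewrite mpolyCN mpolyC1 scaleN1r.
by congr G; congr (_, _); rewrite /= addNr.
Qed.
End LinearSections.

Section HilbertSyzygy.
Variables (K : fieldType) (n : nat).
Local Notation S := {mpoly K[n]}.
Implicit Types B C M : lmodType S.

Definition linear_over (U : pred 'I_n) M B (h : M -> B) := [/\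
  {morph h : x y / x + y}, forall c x, h (c%:MP *: x) = c%:MP *: h x &
  forall i x, U i -> h ('X_i *: x) = 'X_i *: h x].

(* Projectivity of M over the subring K[x_i | i in U], tested on S-modules. *)
Definition rel_projective (U : pred 'I_n) M :=
  forall B C (f : {linear B -> C}) (g : M -> C),
    (forall y, exists x, f x = y) -> linear_over U g ->
    exists h : M -> B, linear_over U h /\ forall x, f (h x) = g x.

Lemma linear_overT M B (h : M -> B) : linear_over predT h -> linear h.
Proof.
move=> [hD hC hX]; suff hZ a x : h (a *: x) = a *: h x.
  by move=> a x y; rewrite hD hZ.
elim/mpoly_ring_ind: a x => [c|i|p q pE qE|p q pE qE] x.
- exact: hC.
- exact: hX.
- by rewrite !scalerDl hD pE qE.
- by rewrite -!scalerA pE qE.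
Qed.

Lemma rel_projectiveT M : rel_projective predT M -> projective_module M.
Proof.
move=> hM B C f g fs.
have [|h [hl hE]] := hM B C f g fs.
  by split=> [x y|c x|i x _]; rewrite ?linearD ?linearZ.
have [h' h'E] := linear_pack (linear_overT hl).
by exists h' => x; rewrite h'E hE.
Qed.

Lemma rel_projective0 M : rel_projective pred0 M.
Proof.
move=> B C f g fs [gD gC _]; have [s [sE sl]] := linear_section fs.
have s0 : s 0 = 0.
  have := sl (-1) 0 0; rewrite scaler0 addr0 mpolyCN mpolyC1 scaleN1r.
  by rewrite addNr.
exists (s \o g); split=> [|x] /=; last exact: sE.
split=> // [x y|c x] /=.
  by rewrite gD -[g x]scale1r -mpolyC1 sl mpolyC1 !scale1r.
by rewrite gC -[_ *: g x]addr0 sl s0 addr0.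
Qed.

Section Step.
Variables (j : 'I_n) (M : lmodType S).

(** Turns ['X_j] into a new variable and keeps the others as coefficients, so that the module
    [freed] is the base change of [M] from the polynomials without ['X_j] to [S]. *)
Definition free_var : S -> {poly S} :=
  mmap (polyC \o @mpolyC n K) (fun i => if i == j then 'X else ('X_i)%:P).
HB.instance Definition _ := GRing.RMorphism.copy free_var
  (mmap (polyC \o @mpolyC n K) (fun i => if i == j then 'X else ('X_i)%:P)).

Lemma free_varC c : free_var c%:MP = (c%:MP)%:P.
Proof. exact: mmapC. Qed.

Lemma free_varX i : free_var 'X_i = if i == j then 'X else ('X_i)%:P.
Proof. by rewrite /free_var /= mmapX mmap1U. Qed.

Lemma free_var_eval p : (free_var p).['X_j] = p.
Proof.
elim/mpoly_ring_ind: p => [c|i|p q pE qE|p q pE qE].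
- by rewrite free_varC hornerC.
- by rewrite free_varX; case: eqP => [->|_]; rewrite ?hornerX ?hornerC.
- have -> : free_var (p + q) = free_var p + free_var q by exact: rmorphD.
  by rewrite hornerD; congr (_ + _).
- have -> : free_var (p * q) = free_var p * free_var q by exact: rmorphM.
  by rewrite hornerM; congr (_ * _).
Qed.

(* M[y], where x_j acts as multiplication by y. *)
Definition freed : lmodType S := restr_scalars (free_var : {rmorphism _ -> _}) (poly_ext M).

Lemma freedE (p : S) (t : freed) : p *: t = free_var p *: (t : poly_ext M).
Proof. exact: restr_scaleE. Qed.

(** Base change preserves projectivity: a map on M[y] linear over the larger ring is determined by
    its values on constants, so it suffices to lift those over [U] and to extend with
    [poly_ext_map]. *)
Lemma rel_projective_freed (U : pred 'I_n) : ~~ U j ->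
  rel_projective U M -> rel_projective (predU1 j U) freed.
Proof.
move=> Uj hM B C f g fs [gD gC gX].
have Uij i : U i -> i == j = false.
  by move=> Ui; apply/eqP => ij; rewrite -ij Ui in Uj.
have cl : linear_over U (fun m => g (pconst m)).
  split=> [x y|c x|i x Ui].
  - by rewrite pconstD gD.
  - by rewrite -gC freedE free_varC pconstZ.
  - by rewrite -gX ?freedE ?free_varX ?Uij ?pconstZ //= Ui orbT.
have [h [[hD hC hX] hE]] := hM B C f _ fs cl.
have sD : {morph (fun b : B => 'X_j *: b) : x y / x + y}.
  by move=> x y; rewrite scalerDr.
have [H [HD Hc HX]] := poly_ext_map hD sD.
have H0 : H 0 = 0 by apply: (@addrI _ (H 0)); rewrite -HD !addr0.
have HXn i t : H ('X^i *: t) = 'X_j ^+ i *: H t.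
  elim: i t => [|i IH] t; first by rewrite !expr0 !scale1r.
  by rewrite !exprS -!scalerA HX IH.
have Hext (a : S) : (forall m, h (a *: m) = a *: h m) ->
    forall t, H (a%:P *: t) = a *: H t.
  move=> ha t; have [d [_ ->]] := poly_ext_decomp t.
  rewrite scaler_sumr !(big_morph H HD H0) scaler_sumr; apply: eq_bigr => i _.
  rewrite scalerA mulrC -scalerA -pconstZ !HXn !Hc ha.
  by rewrite !scalerA mulrC.
exists H; split.
  split=> // [c t|i t].
    by rewrite freedE free_varC Hext.
  rewrite !inE freedE free_varX; case: eqP => [-> _|_ /= Ui]; first exact: HX.
  by apply: Hext => m; apply: hX.
move=> t; have [d [_ ->]] := poly_ext_decomp t.
have g0 : g 0 = 0 by apply: (@addrI _ (g 0)); rewrite -gD !addr0.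
rewrite (big_morph H HD H0) linear_sum (big_morph g gD g0).
apply: eq_bigr => i _; rewrite HXn Hc linearZ /= hE.
have gXn k u : g ('X^k *: u) = 'X_j ^+ k *: g u.
  elim: k => [|k IH]; first by rewrite !expr0 !scale1r.
  rewrite !exprS -!scalerA -IH -gX ?inE ?eqxx // freedE free_varX eqxx.
  by [].
by rewrite gXn.
Qed.

(** The sequence 0 -> M[y] -> M[y] -> M -> 0, given by multiplication by y - x_j and by evaluation
    of y at x_j. *)
Lemma freed_exact : exists (d : {linear freed -> freed}) (e : {linear freed -> M}),
  short_exact d e.
Proof.
have hD : {morph (id : M -> M) : x y / x + y} by [].
have sD : {morph (fun m : M => 'X_j *: m) : x y / x + y}.
  by move=> x y; rewrite scalerDr.
have [H [HD Hc HX]] := poly_ext_map hD sD.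
have H0 : H 0 = 0 by apply: (@addrI _ (H 0)); rewrite -HD !addr0.
have HXn i t : H ('X^i *: t) = 'X_j ^+ i *: H t.
  elim: i t => [|i IH] t; first by rewrite !expr0 !scale1r.
  by rewrite !exprS -!scalerA HX IH.
have HC (a : S) t : H (a%:P *: t) = a *: H t.
  have [d [_ ->]] := poly_ext_decomp t.
  rewrite scaler_sumr !(big_morph H HD H0) scaler_sumr; apply: eq_bigr => i _.
  rewrite scalerA mulrC -scalerA -pconstZ !HXn !Hc.
  by rewrite !scalerA mulrC.
have HZ p t : H (p *: t) = p.['X_j] *: H t.
  elim/poly_ind: p t => [|p c IH] t.
    by rewrite scale0r H0 horner0 scale0r.
  rewrite scalerDl HD -scalerA IH HX HC hornerMXaddC scalerDl.
  by rewrite scalerA.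
have lH : linear (H : freed -> M).
  by move=> a t u; rewrite HD freedE HZ free_var_eval.
have [e eE] := linear_pack lH.
pose z : {poly S} := 'X - ('X_j)%:P.
have ld : linear (fun t : freed => z *: (t : poly_ext M) : freed).
  by move=> a t u; rewrite !freedE scalerDr !scalerA mulrC.
have [d dE] := linear_pack ld.
exists d, e; split.
- suff ker t : d t = 0 -> t = 0.
    move=> t u tu; apply/eqP; rewrite -subr_eq0; apply/eqP/ker.
    by rewrite linearB tu subrr.
  rewrite dE => zt.
  have [b [bP _]] := poly_ext_decomp t.
  (* If y - x_j kills [t], each coefficient is x_j times the next one, and the coefficients vanish
     from [b] on. *)
  have step k : pcoef (t : poly_ext M) k = 'X_j *: pcoef (t : poly_ext M) k.+1.
    apply/eqP; rewrite -subr_eq0; apply/eqP.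
    have := congr1 (fun u : poly_ext M => pcoef u k.+1) zt.
    rewrite pcoef0 /z scalerBl -scaleN1r -[-1]/(- (1%:P)) -polyCN pcoefD.
    by rewrite pcoefC !pcoefX pcoefC scaleN1r.
  have tz m k : (b <= k + m)%N -> pcoef (t : poly_ext M) k = 0.
    elim: m k => [|m IH] k bk; first by apply: bP; rewrite -[k]addn0.
    by rewrite step IH ?scaler0 // addSn -addnS.
  by apply: pcoef_inj => k; rewrite pcoef0 (tz b) // leq_addl.
- by move=> m; exists (pconst m); rewrite eE Hc.
- move=> t; rewrite eE; split=> [Ht|[u <-]]; last first.
    by rewrite dE HZ !hornerE subrr scale0r.
  have pc0 : pconst (0 : M) = 0.
    by apply: (@addrI _ (pconst (0 : M))); rewrite -pconstD !addr0.
  suff [u uE] : exists u, t = d u + pconst (H t).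
    by exists u; rewrite [RHS]uE Ht pc0 addr0.
  have [b [_ tE]] := poly_ext_decomp (t : poly_ext M).
  (* Modulo multiples of y - x_j, the power y^i may be replaced by x_j^i, by the factorisation of
     the difference of the two powers. *)
  have Xn i m : exists u : poly_ext M,
      'X^i *: pconst m = z *: u + pconst ('X_j ^+ i *: m).
    exists ((\sum_(k < i) 'X^(i.-1 - k) * ('X_j)%:P ^+ k) *: pconst m).
    rewrite pconstZ rmorphXn /= scalerA -subrXX -scalerDl.
    by rewrite subrK.
  have [u uE] := choice (fun i : 'I_b => Xn i (pcoef (t : poly_ext M) i)).
  exists (\sum_i u i); rewrite dE scaler_sumr.
  have -> : H t = \sum_(i < b) 'X_j ^+ i *: pcoef (t : poly_ext M) i.
    by rewrite {1}tE (big_morph H HD H0); apply: eq_bigr => i _; rewrite HXn Hc.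
  rewrite (big_morph _ (@pconstD _ M) pc0) -big_split [LHS]tE.
  by apply: eq_bigr => i _; rewrite uE.
Qed.
End Step.

(** Induction on [d]: freeing one variable gives projectivity over one variable more, and
    [pdk_cokernel] along [freed_exact] costs one step. With [d = n] only linearity over K is left,
    where everything is projective. *)
Lemma pdk_rel_projective d M : (d <= n)%N ->
  rel_projective (fun i : 'I_n => i < n - d)%N M -> pdk d M.
Proof.
elim: d M => [|d IH] M dn hM.
  apply: rel_projectiveT => B C f g fs gl.
  have [|h [hl hE]] := hM B C f g fs.
    by case: gl => gD gC gX; split=> // i x _; apply: gX.
  exists h; split=> //; case: hl => hD hC hX; split=> // i x _; apply: hX.
  by rewrite /= subn0.
have jn : (n - d.+1 < n)%N by rewrite ltn_subrL (leq_trans _ dn).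
have [e [f ef]] := freed_exact (Ordinal jn) M.
suff hF : pdk d (freed (Ordinal jn) M) by apply: (pdk_cokernel ef).
apply: IH; first exact: ltnW.
have -> : (fun i : 'I_n => i < n - d)%N =
    predU1 (Ordinal jn) (fun i : 'I_n => i < n - d.+1)%N.
  apply/funext => i; rewrite /= -val_eqE /= -leq_eqVlt.
  by rewrite -[in RHS]ltnS subnS prednK ?subn_gt0.
by apply: rel_projective_freed => //=; rewrite ltnn.
Qed.

Theorem hilbert_syzygy M : pdk n M.
Proof.
apply: pdk_rel_projective => // B C f g fs [gD gC gX].
have [|h [[hD hC _] hE]] := @rel_projective0 M B C f g fs; first by split.
by exists h; split=> //; split=> // i x; rewrite /= subnn.
Qed.

(** [M] is a first syzygy of the quotient of [F] by it, so Hilbert's bound improves by one. *)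
Lemma submodule_pdk (M F : lmodType S) (i : {linear M -> F}) :
  injective i -> projective_module F -> pdk n.-1 M.
Proof.
move=> ii hF.
have [|a x y [x' <-] [y' <-]|C [e [es eE]]] :=
    @quotient_exists _ F (fun x => exists z, i z = x).
- by exists 0; rewrite linear0.
- by exists (a *: x' + y'); rewrite linearP.
have ie : short_exact i e by split.
apply: (pdk_syzygy hF ie); apply: pdk_le (hilbert_syzygy C).
exact: leqSpred.
Qed.
End HilbertSyzygy.

(** * Exterior algebra *)

(** The diagonal is assumed to vanish and the last index is split off, so that 2 is never divided by
    and characteristic 2 is covered. *)
Lemma sum_alternating (V : zmodType) n (f : 'I_n -> 'I_n -> V) :
  (forall i, f i i = 0) -> (forall i j, f i j = - f j i) ->
  \sum_i \sum_j f i j = 0.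
Proof.
elim: n f => [|n IH] f f0 fN; first by rewrite big_ord0.
rewrite big_ord_recr /=; under eq_bigr do rewrite big_ord_recr /=.
rewrite big_split /= [X in _ + _ + X]big_ord_recr /= f0 addr0.
rewrite (IH (fun i j => f (widen_ord (leqnSn n) i) (widen_ord (leqnSn n) j))) //.
by rewrite add0r -big_split big1 //= => i _; rewrite fN addNr.
Qed.

Section ExteriorAlgebra.
Variables (R : comNzRingType).
Local Notation Lam n := {ffun {set 'I_n} -> R}.

(** A separate function, because on rational forms [*:] denotes the action of polynomials. *)
Definition exs n (c : R) (w : Lam n) : Lam n := [ffun I => c * w I].

Lemma exsE n c (w : Lam n) I : exs c w I = c * w I. Proof. by rewrite ffunE. Qed.
Lemma exsDr n c : {morph @exs n c : w v / w + v}.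
Proof. by move=> w v; apply/ffunP => I; rewrite !ffunE mulrDr. Qed.
Lemma exs0 n c : exs c (0 : Lam n) = 0.
Proof. by apply/ffunP => I; rewrite !ffunE mulr0. Qed.
Lemma exs0l n (w : Lam n) : exs 0 w = 0.
Proof. by apply/ffunP => I; rewrite !ffunE mul0r. Qed.
Lemma exs1 n (w : Lam n) : exs 1 w = w.
Proof. by apply/ffunP => I; rewrite !ffunE mul1r. Qed.
Lemma exsN n c (w : Lam n) : exs c (- w) = - exs c w.
Proof. by apply/ffunP => I; rewrite !ffunE mulrN. Qed.
Lemma exsNl n c (w : Lam n) : exs (- c) w = - exs c w.
Proof. by apply/ffunP => I; rewrite !ffunE mulNr. Qed.
Lemma exsDl n c d (w : Lam n) : exs (c + d) w = exs c w + exs d w.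
Proof. by apply/ffunP => I; rewrite !ffunE mulrDl. Qed.
Lemma exsA n c d (w : Lam n) : exs c (exs d w) = exs (c * d) w.
Proof. by apply/ffunP => I; rewrite !ffunE mulrA. Qed.
Lemma exsC n c d (w : Lam n) : exs c (exs d w) = exs d (exs c w).
Proof. by rewrite !exsA mulrC. Qed.
Lemma exs_sum n c I (r : seq I) (P : pred I) (F : I -> Lam n) :
  exs c (\sum_(i <- r | P i) F i) = \sum_(i <- r | P i) exs c (F i).
Proof. by apply: big_morph; [apply: exsDr | apply: exs0]. Qed.

Section Operators.
Variable n : nat.
Implicit Types (w : Lam n) (I J : {set 'I_n}) (i j : 'I_n).

Definition below i I := #|[set j in I | (j < i)%N]|.
Definition sg i I : R := (-1) ^+ below i I.

Lemma sgD1 i j I : j \in I -> sg i I = (-1) ^+ (j < i)%N * sg i (I :\ j).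
Proof.
move=> jI; rewrite /sg -exprD /below; congr (_ ^+ _).
rewrite (cardsD1 j) inE jI /=; congr (_ + _)%N; apply: eq_card => k.
by rewrite !inE andbA.
Qed.

Lemma sgU1 i j I : j \notin I -> sg i (j |: I) = (-1) ^+ (j < i)%N * sg i I.
Proof. by move=> jI; rewrite (@sgD1 i j) ?setU11 // setU1K. Qed.

Lemma sg_sqr i I : sg i I * sg i I = 1.
Proof. by rewrite -expr2 sqrr_sign. Qed.

Lemma sgD1_id i I : sg i (I :\ i) = sg i I.
Proof.
have [iI|iI] := boolP (i \in I); first by rewrite (sgD1 i iI) ltnn mul1r.
by congr sg; apply/setDidPl; rewrite disjoint_sym disjoints1.
Qed.

Lemma sgU1_id i I : sg i (i |: I) = sg i I.
Proof.
have [iI|iI] := boolP (i \in I); last by rewrite sgU1 // ltnn mul1r.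
by congr sg; apply/setUidPr; rewrite sub1set.
Qed.

Lemma sign_ltn i j : i != j -> (-1) ^+ (i < j)%N = - (-1) ^+ (j < i)%N :> R.
Proof. by rewrite neq_ltn; case: ltngtP => //; rewrite ?expr0 ?expr1 ?opprK. Qed.

(* Exterior multiplication by dx_i, and contraction with the i-th coordinate
   vector field. *)
Definition ei i w : Lam n := [ffun I : {set 'I_n} => if i \in I then sg i I * w (I :\ i) else 0].
Definition ci i w : Lam n := [ffun I : {set 'I_n} => if i \in I then 0 else sg i I * w (i |: I)].

Lemma eiD i : {morph ei i : w v / w + v}.
Proof.
by move=> w v; apply/ffunP => I; rewrite !ffunE; case: ifP; rewrite ?addr0 ?mulrDr.
Qed.
Lemma ciD i : {morph ci i : w v / w + v}.
Proof.
by move=> w v; apply/ffunP => I; rewrite !ffunE; case: ifP; rewrite ?addr0 ?mulrDr.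
Qed.
Lemma ei0 i : ei i 0 = 0.
Proof. by apply/ffunP => I; rewrite !ffunE mulr0 if_same. Qed.
Lemma ci0 i : ci i 0 = 0.
Proof. by apply/ffunP => I; rewrite !ffunE mulr0 if_same. Qed.
Lemma eiZ i c w : ei i (exs c w) = exs c (ei i w).
Proof.
by apply/ffunP => I; rewrite !ffunE; case: ifP => _; rewrite ?mulr0 // mulrCA.
Qed.
Lemma ciZ i c w : ci i (exs c w) = exs c (ci i w).
Proof.
by apply/ffunP => I; rewrite !ffunE; case: ifP => _; rewrite ?mulr0 // mulrCA.
Qed.

Lemma ei_ei i w : ei i (ei i w) = 0.
Proof.
by apply/ffunP => I; rewrite !ffunE setD11 mulr0 if_same.
Qed.

Lemma ci_ci i w : ci i (ci i w) = 0.
Proof.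
by apply/ffunP => I; rewrite !ffunE setU11 mulr0 if_same.
Qed.

Lemma eiC i j w : i != j -> ei i (ei j w) = - ei j (ei i w).
Proof.
move=> ij; apply/ffunP => I; rewrite !ffunE !inE [j == i]eq_sym ij /=.
case: (boolP (i \in I)) => iI; case: (boolP (j \in I)) => jI; rewrite ?mulr0 ?oppr0 //.
rewrite (sgD1 i jI) (sgD1 j iI) setDDl setUC -setDDl (sign_ltn ij).
ring.
Qed.

Lemma ciC i j w : i != j -> ci i (ci j w) = - ci j (ci i w).
Proof.
move=> ij; apply/ffunP => I; rewrite !ffunE !inE [j == i]eq_sym (negPf ij) /=.
case: (boolP (i \in I)) => iI; case: (boolP (j \in I)) => jI; rewrite ?mulr0 ?oppr0 //.
rewrite (sgU1 i jI) (sgU1 j iI) setUCA (sign_ltn ij).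
ring.
Qed.

Lemma ciei i w : ci i (ei i w) + ei i (ci i w) = w.
Proof.
apply/ffunP => I; rewrite !ffunE setU11 setD11.
case: (boolP (i \in I)) => iI.
  by rewrite add0r sgD1_id setD1K // mulrA sg_sqr mul1r.
by rewrite addr0 sgU1_id setU1K // mulrA sg_sqr mul1r.
Qed.

Lemma ciejC i j w : i != j -> ci i (ei j w) = - ei j (ci i w).
Proof.
move=> ij; apply/ffunP => I; rewrite !ffunE !inE [j == i]eq_sym (negPf ij) /=.
case: (boolP (i \in I)) => iI; case: (boolP (j \in I)) => jI; rewrite ?mulr0 ?oppr0 //.
have E : i |: I :\ j = (i |: I) :\ j.
  by apply/setP => k; rewrite !inE; case: eqP => // ->; rewrite ij.
rewrite (sgD1 i jI) (sgU1 j iI) -E (sign_ltn ij).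
set t := (-1) ^+ (j < i)%N; have t2 : t * t = 1 by rewrite -expr2 sqrr_sign.
transitivity (- (t * t) * (sg j I * (sg i (I :\ j) * w (i |: I :\ j)))).
  ring.
by rewrite t2 mulN1r.
Qed.

(** Exterior multiplication by the one-form with coefficients [a]; [ct] is contraction with the
    vector field with coefficients [v]. *)
Definition ew (a : 'rV[R]_n) w : Lam n := \sum_i exs (a 0 i) (ei i w).
Definition ct (v : 'rV[R]_n) w : Lam n := \sum_i exs (v 0 i) (ci i w).

Lemma ewD a : {morph ew a : w v / w + v}.
Proof.
by move=> w v; rewrite -big_split; apply: eq_bigr => i _; rewrite eiD exsDr.
Qed.
Lemma ctD a : {morph ct a : w v / w + v}.
Proof.
by move=> w v; rewrite -big_split; apply: eq_bigr => i _; rewrite ciD exsDr.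
Qed.
Lemma ew0 a : ew a 0 = 0.
Proof. by rewrite /ew big1 // => i _; rewrite ei0 exs0. Qed.
Lemma ct0 a : ct a 0 = 0.
Proof. by rewrite /ct big1 // => i _; rewrite ci0 exs0. Qed.
Lemma ewZ a c w : ew a (exs c w) = exs c (ew a w).
Proof. by rewrite exs_sum; apply: eq_bigr => i _; rewrite eiZ exsC. Qed.
Lemma ctZ a c w : ct a (exs c w) = exs c (ct a w).
Proof. by rewrite exs_sum; apply: eq_bigr => i _; rewrite ciZ exsC. Qed.
Lemma ctN a w : ct a (- w) = - ct a w.
Proof. by rewrite -[- w]exs1 exsN -exsNl ctZ exsNl exs1. Qed.
Lemma ewDl a b w : ew (a + b) w = ew a w + ew b w.
Proof.
by rewrite -big_split; apply: eq_bigr => i _; rewrite mxE exsDl.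
Qed.
Lemma ewZl c a w : ew (c *: a) w = exs c (ew a w).
Proof. by rewrite exs_sum; apply: eq_bigr => i _; rewrite mxE exsA. Qed.
Lemma ew0l w : ew 0 w = 0.
Proof. by rewrite -(scale0r 0) ewZl exs0l. Qed.
Lemma ew_suml (T : Type) (r : seq T) (F : T -> 'rV[R]_n) w :
  ew (\sum_(i <- r) F i) w = \sum_(i <- r) ew (F i) w.
Proof.
by apply: (big_morph (ew^~ w)); [move=> a b; apply: ewDl | apply: ew0l].
Qed.
Lemma ew_sum a (T : Type) (r : seq T) (P : pred T) (F : T -> Lam n) :
  ew a (\sum_(i <- r | P i) F i) = \sum_(i <- r | P i) ew a (F i).
Proof. by apply: big_morph; [apply: ewD | apply: ew0]. Qed.
Let eiS i (r : seq 'I_n) (F : 'I_n -> Lam n) :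
  ei i (\sum_(j <- r) F j) = \sum_(j <- r) ei i (F j).
Proof. by apply: big_morph; [apply: eiD | apply: ei0]. Qed.
Let ciS i (r : seq 'I_n) (F : 'I_n -> Lam n) :
  ci i (\sum_(j <- r) F j) = \sum_(j <- r) ci i (F j).
Proof. by apply: big_morph; [apply: ciD | apply: ci0]. Qed.

Lemma ew_ew a w : ew a (ew a w) = 0.
Proof.
pose f i j := exs (a 0 i * a 0 j) (ei i (ei j w)).
transitivity (\sum_i \sum_j f i j).
  apply: eq_bigr => i _; rewrite eiS exs_sum; apply: eq_bigr => j _.
  by rewrite eiZ exsA.
apply: sum_alternating => [i|i j]; first by rewrite /f ei_ei exs0.
have [->|ij] := eqVneq i j; first by rewrite /f ei_ei exs0 oppr0.
by rewrite /f eiC // exsN mulrC.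
Qed.

Lemma ct_ct a w : ct a (ct a w) = 0.
Proof.
pose f i j := exs (a 0 i * a 0 j) (ci i (ci j w)).
transitivity (\sum_i \sum_j f i j).
  apply: eq_bigr => i _; rewrite ciS exs_sum; apply: eq_bigr => j _.
  by rewrite ciZ exsA.
apply: sum_alternating => [i|i j]; first by rewrite /f ci_ci exs0.
have [->|ij] := eqVneq i j; first by rewrite /f ci_ci exs0 oppr0.
by rewrite /f ciC // exsN mulrC.
Qed.

Lemma ewC a b w : ew a (ew b w) = - ew b (ew a w).
Proof.
have := ew_ew (a + b) w; rewrite !ewDl !ewD !ew_ew add0r addr0 => /eqP.
by rewrite addr_eq0 => /eqP.
Qed.

(** The Clifford relation. For a(v) = 1 it splits a form into a part killed by [v] and a multiple of
    [a]; the Euler splitting is another instance. *)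
Lemma ct_ew v a w : ct v (ew a w) + ew a (ct v w) = exs ((v *m a^T) 0 0) w.
Proof.
have -> : exs ((v *m a^T) 0 0) w = \sum_i exs (v 0 i * a 0 i) w.
  rewrite mxE; elim/big_rec2: _ => [|i c u _ <-]; first by rewrite exs0l.
  by rewrite !mxE exsDl.
rewrite {1}/ct /ew.
under eq_bigr do rewrite ciS exs_sum; rewrite exchange_big /=.
rewrite -big_split; apply: eq_bigr => j _ /=.
rewrite /ct eiS exs_sum -big_split /= (bigD1 j) //= big1 => [|i ij].
  by rewrite ciZ eiZ !exsA [a 0 j * _]mulrC -exsDr ciei addr0.
by rewrite ciZ eiZ !exsA (ciejC _ ij) exsN [a 0 j * _]mulrC addNr.
Qed.
End Operators.
End ExteriorAlgebra.

(** * Functoriality of the exterior algebra *)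

Section ExteriorMap.
Variable R : comNzRingType.
Local Notation Lam n := {ffun {set 'I_n} -> R}.

Definition ext_one n : Lam n := [ffun I => (I == set0)%:R].

Definition eprod n m (M : 'M[R]_(n, m)) (s : seq 'I_n) : Lam m :=
  foldr (fun i w => ew (row i M) w) (ext_one m) s.

Definition elems n (I : {set 'I_n}) : seq 'I_n := [seq i <- enum 'I_n | i \in I].

(* The map of exterior algebras sending dx_i to row i M. *)
Definition Tm n m (M : 'M[R]_(n, m)) (w : Lam n) : Lam m :=
  \sum_I exs (w I) (eprod M (elems I)).

Lemma TmD n m (M : 'M[R]_(n, m)) : {morph Tm M : w v / w + v}.
Proof.
by move=> w v; rewrite -big_split; apply: eq_bigr => I _; rewrite ffunE exsDl.
Qed.

Lemma TmZ n m (M : 'M[R]_(n, m)) c w : Tm M (exs c w) = exs c (Tm M w).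
Proof. by rewrite exs_sum; apply: eq_bigr => I _; rewrite exsE exsA. Qed.

Lemma Tm0 n m (M : 'M[R]_(n, m)) : Tm M 0 = 0.
Proof. by rewrite /Tm big1 // => I _; rewrite ffunE exs0l. Qed.

Lemma Tm_sum n m (M : 'M[R]_(n, m)) (T : Type) (r : seq T) (P : pred T) F :
  Tm M (\sum_(i <- r | P i) F i) = \sum_(i <- r | P i) Tm M (F i).
Proof. by apply: big_morph; [apply: TmD | apply: Tm0]. Qed.

Lemma Tm_one n m (M : 'M[R]_(n, m)) : Tm M (ext_one n) = ext_one m.
Proof.
rewrite /Tm (bigD1 set0) //= big1 => [|I /negPf I0].
  rewrite ffunE eqxx exs1 addr0 /elems (_ : [seq _ <- _ | _] = [::]) //.
  by rewrite -(filter_pred0 (enum 'I_n)); apply: eq_filter => i; rewrite inE.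
by rewrite ffunE I0 exs0l.
Qed.

Lemma enum_ord_sorted n : sorted (fun j k : 'I_n => j < k)%N (enum 'I_n).
Proof. by have := iota_ltn_sorted 0 n; rewrite -val_enum_ord sorted_map. Qed.

(** Bringing [row i M] to its place in the increasing product means passing the factors with index
    below [i], whence the sign. *)
Lemma ew_eprod n m (M : 'M[R]_(n, m)) i (I : {set 'I_n}) :
  ew (row i M) (eprod M (elems I)) =
    if i \in I then 0 else exs (sg R i I) (eprod M (elems (i |: I))).
Proof.
(* As a count, the sign makes sense on every suffix of [enum 'I_n] that contains [i]; the induction
   runs over these. *)
have -> : sg R i I = (-1) ^+ count (fun j => (j \in I) && (j < i)%N) (enum 'I_n).
  rewrite /sg /below -sum1_card -sum1_count big_enum_cond; congr (_ ^+ _).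
  by apply: eq_bigl => j; rewrite !inE.
have := enum_ord_sorted n.
rewrite /elems; move: (mem_enum 'I_n i); rewrite inE.
elim: (enum 'I_n) => [//|j s IH]; rewrite inE => ijs jss.
have js : all (fun k : 'I_n => j < k)%N s.
  move: jss; rewrite /= path_sortedE; last by move=> ? ? ?; apply: ltn_trans.
  by case/andP.
have [ij|ij] := eqVneq i j.
  have nis : i \notin s by apply/negP => /(allP js); rewrite ij ltnn.
  have c0 : count (fun k => (k \in I) && (k < i)%N) s = 0%N.
    apply/eqP; rewrite eqn0Ngt -has_count -all_predC; apply/allP => k /(allP js) /=.
    by rewrite -ij => /ltnW ik; rewrite negb_and -leqNgt ik orbT.
  rewrite /= -ij !inE eqxx ltnn andbF add0n c0 expr0 exs1 /=.
  case: ifP => iI /=; first by rewrite ew_ew.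
  congr (ew _ (eprod M _)); apply: eq_in_filter => k ks; rewrite !inE.
  by case: eqP => // ki; rewrite -ki ks in nis.
have ijlt : (j < i)%N.
  by move: ijs; rewrite (negPf ij) /= => /(allP js).
have {}IH := IH _ (path_sorted jss); move: ijs; rewrite (negPf ij) /= => /IH {}IH.
rewrite !inE [j == i]eq_sym (negPf ij) ijlt andbT /=.
case: (boolP (j \in I)) => jI //=; rewrite ewC IH; case: ifP => _.
  by rewrite ew0 oppr0.
by rewrite ewZ exprS mulN1r exsNl.
Qed.

Lemma Tm_ei n m (M : 'M[R]_(n, m)) i w : Tm M (ei i w) = ew (row i M) (Tm M w).
Proof.
rewrite /Tm ew_sum (bigID (fun I : {set 'I_n} => i \in I)) /=.
rewrite [X in _ + X]big1 => [|I /negPf iI]; last by rewrite ffunE iI exs0l.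
rewrite addr0 [RHS](bigID (fun I : {set 'I_n} => i \in I)) /=.
rewrite [X in _ = X + _]big1 => [|I iI]; last by rewrite ewZ ew_eprod iI exs0.
rewrite add0r (reindex_onto (fun I => i |: I) (fun I => I :\ i)) /=; last first.
  by move=> I iI; rewrite setD1K.
apply: eq_big => [I|I /andP[_ /eqP iI]].
  rewrite setU11 /= setDUl setDv set0U (sameP eqP setDidPl) disjoint_sym.
  by rewrite disjoints1.
have niI : i \notin I by rewrite -iI !inE eqxx.
by rewrite ffunE setU11 ewZ ew_eprod (negPf niI) exsA iI sgU1_id mulrC.
Qed.

Lemma Tm_ew n m (M : 'M[R]_(n, m)) a w : Tm M (ew a w) = ew (a *m M) (Tm M w).
Proof.
rewrite mulmx_sum_row ew_suml {1}/ew Tm_sum; apply: eq_bigr => i _.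
by rewrite TmZ Tm_ei ewZl.
Qed.

Lemma Tm_eprod n m k (M : 'M[R]_(n, m)) (N : 'M[R]_(m, k)) s :
  Tm N (eprod M s) = eprod (M *m N) s.
Proof. by elim: s => [|i s IH]; rewrite /= ?Tm_one // Tm_ew IH row_mul. Qed.

Lemma Tm_Tm n m k (M : 'M[R]_(n, m)) (N : 'M[R]_(m, k)) w :
  Tm N (Tm M w) = Tm (M *m N) w.
Proof.
by rewrite {2}/Tm Tm_sum; apply: eq_bigr => I _; rewrite TmZ Tm_eprod.
Qed.

Lemma eprod1 n (s : seq 'I_n) : sorted (fun j k : 'I_n => j < k)%N s ->
  eprod 1%:M s = [ffun J => (J == [set i in s])%:R].
Proof.
elim: s => [|i s IH] /= ss.
  by apply/ffunP => J; rewrite !ffunE; congr (_ == _)%:R; apply/setP => j; rewrite !inE.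
have si : all (fun k : 'I_n => i < k)%N s.
  move: ss; rewrite path_sortedE; last by move=> ? ? ?; apply: ltn_trans.
  by case/andP.
have nis : i \notin s by apply/negP => /(allP si); rewrite ltnn.
rewrite IH ?(path_sorted ss) //; apply/ffunP => J; rewrite /ew sum_ffunE.
rewrite (bigD1 i) //= big1 => [|j /negPf ji]; last first.
  by rewrite exsE row1 mxE eqxx ji mul0r.
rewrite addr0 exsE row1 mxE !eqxx mul1r !ffunE.
case: ifPn => [iJ|niJ]; last first.
  case: eqP => // E; case/negP: niJ; rewrite E !inE eqxx.
  by [].
have -> : (J == [set j in i :: s]) = (J :\ i == [set j in s]).
  have -> : [set j in i :: s] = i |: [set j in s] by apply/setP => j; rewrite !inE.
  apply/eqP/eqP => [->|<-]; last by rewrite setD1K.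
  by rewrite setU1K // inE.
case: eqP => [E|_]; last by rewrite mulr0.
rewrite -sgD1_id E /sg /below.
rewrite (_ : [set j in _ | _] = set0) ?cards0 ?expr0 ?mul1r //.
apply/setP => j; rewrite !inE; apply/negP => /andP[/(allP si) ij ji].
by have := ltn_trans ij ji; rewrite ltnn.
Qed.

Lemma Tm1 n w : Tm (1%:M : 'M[R]_n) w = w.
Proof.
apply/ffunP => J; rewrite /Tm sum_ffunE (bigD1 J) //= big1 => [|I IJ].
all: rewrite exsE eprod1 ?ffunE; last first.
1,3: by rewrite sorted_filter // => [? ? ?|];
  [apply: ltn_trans | apply: enum_ord_sorted].
- rewrite (_ : [set i in _] = J) ?eqxx ?mulr1 ?addr0 //.
  by apply/setP => i; rewrite inE mem_filter mem_enum andbT.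
- rewrite (_ : [set i in _] = I) 1?eq_sym ?(negPf IJ) ?mulr0 //.
  by apply/setP => i; rewrite inE mem_filter mem_enum andbT.
Qed.

Lemma ext_deg_ew n p a (w : Lam n) : ext_deg p w -> ext_deg p.+1 (ew a w).
Proof.
move=> dw I Ip; rewrite sum_ffunE big1 // => i _; rewrite exsE ffunE.
case: ifP => iI; rewrite ?mulr0 // dw ?mulr0 //.
by apply: contra Ip => /eqP <-; rewrite (cardsD1 i I) iI.
Qed.

Lemma ext_deg_ct n p a (w : Lam n) : ext_deg p.+1 w -> ext_deg p (ct a w).
Proof.
move=> dw I Ip; rewrite sum_ffunE big1 // => i _; rewrite exsE ffunE.
case: ifP => iI; rewrite ?mulr0 // dw ?mulr0 //.
by rewrite cardsU1 iI eqSS.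
Qed.

Lemma ext_deg_ct0 n a (w : Lam n) : ext_deg 0 w -> ct a w = 0.
Proof.
move=> dw; apply/ffunP => I; rewrite sum_ffunE ffunE big1 // => i _.
rewrite exsE ffunE; case: ifP => iI; rewrite ?mulr0 // dw ?mulr0 //.
by rewrite cardsU1 iI.
Qed.

Lemma ext_deg_eprod n m (M : 'M[R]_(n, m)) s : ext_deg (size s) (eprod M s).
Proof.
elim: s => [|i s IH] /=; last exact: ext_deg_ew.
by move=> I; rewrite cards_eq0 ffunE => /negPf ->.
Qed.

Lemma size_elems n (I : {set 'I_n}) : size (elems I) = #|I|.
Proof.
rewrite /elems size_filter -sum1_count big_enum_cond -sum1_card.
by apply: eq_bigl => i; rewrite inE.
Qed.

Lemma ext_deg_sum n p (T : Type) (r : seq T) (P : pred T) (F : T -> Lam n) :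
  (forall i, P i -> ext_deg p (F i)) -> ext_deg p (\sum_(i <- r | P i) F i).
Proof.
move=> dF; apply: big_ind => // [I _|u v du dv I Ip]; rewrite ffunE //.
by rewrite du ?dv ?addr0.
Qed.

Lemma ext_deg_exs n p c (w : Lam n) : ext_deg p w -> ext_deg p (exs c w).
Proof. by move=> dw I Ip; rewrite exsE dw ?mulr0. Qed.

Lemma ext_deg_Tm n m p (M : 'M[R]_(n, m)) (w : Lam n) :
  ext_deg p w -> ext_deg p (Tm M w).
Proof.
move=> dw; apply: ext_deg_sum => I _; have [/eqP Ip|Ip] := boolP (#|I| == p).
  by rewrite -Ip -size_elems; apply/ext_deg_exs/ext_deg_eprod.
by move=> J _; rewrite dw // exsE mul0r.
Qed.

End ExteriorMap.

(** * Poles of rational functions and forms *)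

Section Localization.
Variable R : idomainType.
Local Notation F := {fraction R}.

Definition subring_pred (T : nzRingType) (P : T -> Prop) := [/\ P 1,
  forall x y, P x -> P y -> P (x - y) & forall x y, P x -> P y -> P (x * y)].

Section SubringTheory.
Variables (T : nzRingType) (P : T -> Prop).
Hypothesis hP : subring_pred P.

Lemma subringP1 : P 1. Proof. by case: hP. Qed.
Lemma subringP0 : P 0.
Proof. by case: hP => P1 PB _; rewrite -(subrr 1); apply: PB. Qed.
Lemma subringPN x : P x -> P (- x).
Proof. by case: hP => P1 PB _ Px; rewrite -sub0r; apply: PB => //; apply: subringP0. Qed.
Lemma subringPD x y : P x -> P y -> P (x + y).
Proof.
by case: hP => P1 PB _ Px Py; rewrite -[y]opprK; apply: PB => //; apply: subringPN.
Qed.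
Lemma subringPM x y : P x -> P y -> P (x * y).
Proof. by case: hP => _ _; apply. Qed.
Lemma subringP_sum (I : Type) (r : seq I) (Q : pred I) (f : I -> T) :
  (forall i, Q i -> P (f i)) -> P (\sum_(i <- r | Q i) f i).
Proof. by move=> Pf; apply: big_ind => //; [apply: subringP0 | apply: subringPD]. Qed.
Lemma subringP_sign n : P ((-1) ^+ n).
Proof.
rewrite -signr_odd; case: odd => /=; rewrite ?expr1 ?expr0; last exact: subringP1.
by apply/subringPN/subringP1.
Qed.
End SubringTheory.

Definition loc (G : R -> Prop) (f : F) :=
  exists g s, G g /\ tofrac g * f = tofrac s.

Definition mult_set (G : R -> Prop) := G 1 /\ forall x y, G x -> G y -> G (x * y).

Lemma loc_subring G : mult_set G -> subring_pred (loc G).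
Proof.
move=> [G1 GM]; split.
- by exists 1, 1; rewrite tofrac1 mulr1.
- move=> x y [g [s [Gg gs]]] [h [t [Gh ht]]]; exists (g * h), (h * s - g * t).
  split; first exact: GM.
  rewrite tofracB !tofracM -gs -ht mulrBr; congr (_ - _); last by rewrite mulrA.
  by rewrite mulrAC mulrC mulrA.
- move=> x y [g [s [Gg gs]]] [h [t [Gh ht]]]; exists (g * h), (s * t).
  split; first exact: GM.
  by rewrite !tofracM -gs -ht mulrACA.
Qed.

Lemma loc_tofrac G s : mult_set G -> loc G (tofrac s).
Proof. by move=> [G1 _]; exists 1, s; rewrite tofrac1 mul1r. Qed.

Lemma loc_sub (G G' : R -> Prop) f : (forall g, G g -> G' g) -> loc G f -> loc G' f.
Proof. by move=> GG [g [s [Gg gs]]]; exists g, s; split=> //; apply: GG. Qed.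

End Localization.

Section FormsOver.
Variables (R : comNzRingType) (P : R -> Prop).
Hypothesis hP : subring_pred P.
Local Notation Lam n := {ffun {set 'I_n} -> R}.

Definition forms_over n (w : Lam n) := forall I, P (w I).
Definition mx_over m n (M : 'M[R]_(m, n)) := forall i j, P (M i j).

Lemma forms_overD n (w v : Lam n) :
  forms_over w -> forms_over v -> forms_over (w + v).
Proof. by move=> Pw Pv I; rewrite ffunE; apply: subringPD. Qed.
Lemma forms_overN n (w : Lam n) : forms_over w -> forms_over (- w).
Proof. by move=> Pw I; rewrite ffunE; apply: subringPN. Qed.
Lemma forms_over_exs n c (w : Lam n) : P c -> forms_over w -> forms_over (exs c w).
Proof. by move=> Pc Pw I; rewrite ffunE; apply: subringPM. Qed.
Lemma forms_over_sum n (T : Type) (r : seq T) (Q : pred T) (f : T -> Lam n) :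
  (forall i, Q i -> forms_over (f i)) -> forms_over (\sum_(i <- r | Q i) f i).
Proof.
by move=> Pf I; rewrite sum_ffunE; apply: subringP_sum => // i /Pf.
Qed.
Lemma forms_over_ew n a (w : Lam n) : mx_over a -> forms_over w -> forms_over (ew a w).
Proof.
move=> Pa Pw; apply: forms_over_sum => i _; apply: forms_over_exs => // I.
rewrite ffunE; case: ifP => _; last exact: subringP0.
by apply: subringPM => //; apply: subringP_sign.
Qed.
Lemma forms_over_ct n a (w : Lam n) : mx_over a -> forms_over w -> forms_over (ct a w).
Proof.
move=> Pa Pw; apply: forms_over_sum => i _; apply: forms_over_exs => // I.
rewrite ffunE; case: ifP => _; first exact: subringP0.
by apply: subringPM => //; apply: subringP_sign.
Qed.
Lemma forms_over_eprod n m (M : 'M[R]_(n, m)) s : mx_over M -> forms_over (eprod M s).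
Proof.
move=> PM; elim: s => [|i s IH] /=.
  by move=> I; rewrite ffunE; case: eqP => _; [apply: subringP1 | apply: subringP0].
by apply: forms_over_ew => // j k; rewrite mxE.
Qed.
Lemma forms_over_Tm n m (M : 'M[R]_(n, m)) w :
  mx_over M -> forms_over w -> forms_over (Tm M w).
Proof.
move=> PM Pw; apply: forms_over_sum => I _; apply: forms_over_exs => //.
exact: forms_over_eprod.
Qed.
End FormsOver.

Section MapForms.
Variables (R R' : comNzRingType) (P : R -> Prop) (r : R -> R').
Hypothesis hP : subring_pred P.
Hypotheses (r1 : r 1 = 1) (rB : forall x y, P x -> P y -> r (x - y) = r x - r y)
  (rM : forall x y, P x -> P y -> r (x * y) = r x * r y).
Local Notation Lam n := {ffun {set 'I_n} -> R}.

(** The map [r] is total, but a homomorphism only on [P]: it will be the restriction to a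
    hyperplane, meaningful for functions without a pole there. *)
Definition map_form n (w : Lam n) : {ffun {set 'I_n} -> R'} := [ffun I => r (w I)].

Lemma part_r0 : r 0 = 0.
Proof.
rewrite -(subrr 1); have P1 := subringP1 hP.
by rewrite rB // subrr.
Qed.
Lemma part_rN x : P x -> r (- x) = - r x.
Proof. by move=> Px; rewrite -sub0r rB ?part_r0 ?sub0r //; apply: subringP0. Qed.
Lemma part_rD x y : P x -> P y -> r (x + y) = r x + r y.
Proof.
move=> Px Py; have PNy := subringPN hP Py.
by rewrite -[in LHS](opprK y) rB // part_rN // opprK.
Qed.
Lemma part_r_sum (I : Type) (s : seq I) (Q : pred I) (f : I -> R) :
  (forall i, Q i -> P (f i)) -> r (\sum_(i <- s | Q i) f i) = \sum_(i <- s | Q i) r (f i).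
Proof.
move=> Pf; elim: s => [|i s IH]; first by rewrite !big_nil part_r0.
rewrite !big_cons; case: ifP => // Qi; rewrite part_rD ?IH //; first exact: Pf.
exact: subringP_sum.
Qed.

Lemma map_formD n (w v : Lam n) : forms_over P w -> forms_over P v ->
  map_form (w + v) = map_form w + map_form v.
Proof. by move=> Pw Pv; apply/ffunP => I; rewrite !ffunE part_rD. Qed.
Lemma map_form_exs n c (w : Lam n) : P c -> forms_over P w ->
  map_form (exs c w) = exs (r c) (map_form w).
Proof. by move=> Pc Pw; apply/ffunP => I; rewrite !ffunE rM. Qed.
Lemma map_form_sum n (T : Type) (s : seq T) (Q : pred T) (f : T -> Lam n) :
  (forall i, Q i -> forms_over P (f i)) ->
  map_form (\sum_(i <- s | Q i) f i) = \sum_(i <- s | Q i) map_form (f i).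
Proof.
move=> Pf; apply/ffunP => I; rewrite ffunE !sum_ffunE part_r_sum.
  by apply: eq_bigr => i _; rewrite ffunE.
by move=> i /Pf.
Qed.

Let r_sg n (i : 'I_n) (I : {set 'I_n}) : r (sg R i I) = sg R' i I.
Proof.
rewrite /sg; have P1 := subringP1 hP; have PN1 := subringPN hP P1.
elim: (below i I) => [|k IH]; first by rewrite !expr0.
rewrite !exprS rM ?part_rN ?r1 ?IH //.
exact: subringP_sign.
Qed.

Lemma map_form_ew n (a : 'rV[R]_n) (w : Lam n) : mx_over P a -> forms_over P w ->
  map_form (ew a w) = ew (map_mx r a) (map_form w).
Proof.
move=> Pa Pw; have Pe i : forms_over P (ei i w).
  move=> I; rewrite ffunE; case: ifP => _; last exact: subringP0.
  by apply: subringPM => //; apply: subringP_sign.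
rewrite map_form_sum => [|i _]; last exact: forms_over_exs.
apply: eq_bigr => i _; rewrite map_form_exs // mxE; congr exs.
apply/ffunP => I; rewrite !ffunE; case: ifP => _; last exact: part_r0.
by rewrite rM ?r_sg ?ffunE //; apply: subringP_sign.
Qed.

Lemma map_form_Tm n m (M : 'M[R]_(n, m)) (w : Lam n) : mx_over P M -> forms_over P w ->
  map_form (Tm M w) = Tm (map_mx r M) (map_form w).
Proof.
move=> PM Pw; have Pe s : forms_over P (eprod M s) by apply: forms_over_eprod.
rewrite map_form_sum => [|I _]; last exact: forms_over_exs.
apply: eq_bigr => I _; rewrite map_form_exs // ffunE; congr exs.
elim: (elems I) => [|i s IH] /=.
  apply/ffunP => J; rewrite !ffunE.
  by case: eqP; rewrite ?r1 ?part_r0.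
rewrite map_form_ew ?IH ?map_row //.
by move=> j k; rewrite mxE.
Qed.
End MapForms.

Section Regularity.
Variables (K : fieldType) (l : nat).
Local Notation S := {mpoly K[l]}.
Local Notation F := {fraction S}.
Implicit Types (a : 'rV[K]_l) (A C : 'rV[K]_l -> Prop).

Definition dvl a (g : S) := exists h, g = lform a * h.

(* Rational functions regular at the generic point of the hyperplane a = 0. *)
Definition reg a (f : F) := loc (fun g : S => ~ dvl a g) f.

(** The denominators with factors in [A]. The inductive form lets [loc_gen_clear] remove them factor
    by factor. *)
Inductive gen A : S -> Prop :=
| gen_const c : c != 0 -> gen A c%:MP
| gen_form a : A a -> gen A (lform a)
| gen_mul g h : gen A g -> gen A h -> gen A (g * h).

Lemma gen_mult A : mult_set (gen A).
Proof. by split=> [|x y]; [rewrite -mpolyC1; apply/gen_const/oner_neq0 | apply: gen_mul]. Qed.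

Lemma gen_sub A C g : (forall a, A a -> C a) -> gen A g -> gen C g.
Proof.
by move=> sAC; elim=> [c c0|a Aa|x y _ IHx _ IHy];
  [apply: gen_const | apply/gen_form/sAC | apply: gen_mul].
Qed.

Lemma gen_prod A (T : eqType) (s : seq T) (f : T -> S) :
  (forall i, i \in s -> gen A (f i)) -> gen A (\prod_(i <- s) f i).
Proof.
move=> Af; rewrite big_seq; apply: big_ind => // [|x y].
  by case: (gen_mult A).
exact: gen_mul.
Qed.

Lemma gen_exp A g n : gen A g -> gen A (g ^+ n).
Proof.
move=> Ag; elim: n => [|n IH]; first by rewrite expr0; case: (gen_mult A).
by rewrite exprS; apply: gen_mul.
Qed.

Lemma dvl1 a : a != 0 -> ~ dvl a 1.
Proof.
move=> /rV0Pn[i ai] [h /(congr1 (fun p : S => p.@[fun=> 0]))].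
rewrite mevalM meval1 /lform raddf_sum big1 => [|j _]; last first.
  by rewrite /= mevalZ mevalXU mulr0.
by rewrite mul0r => /eqP; rewrite oner_eq0.
Qed.

Lemma nondvl_mult a : a != 0 -> mult_set (fun g : S => ~ dvl a g).
Proof.
move=> a0; split=> [|x y nx ny [h hE]]; first exact: dvl1.
by case: (lform_prime a0 hE).
Qed.

Lemma reg_subring a : a != 0 -> subring_pred (reg a).
Proof. by move=> a0; apply/loc_subring/nondvl_mult. Qed.

Lemma lform_neq0 a : a != 0 -> lform a != 0.
Proof. by apply: contra_neq => /esym; rewrite -(lform0 K l) => /lform_inj. Qed.

Lemma gen_neq0 A g : (forall a, A a -> a != 0) -> gen A g -> g != 0.
Proof.
move=> A0; elim=> [c|a /A0/lform_neq0 //|x y _ x0 _ y0].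
  by rewrite mpolyC_eq0.
by rewrite mulf_neq0.
Qed.

Lemma gen_nondvl A a g : a != 0 -> (forall b, A b -> ~ dvl a (lform b)) ->
  gen A g -> ~ dvl a g.
Proof.
move=> a0 Aa; elim=> [c c0 [h hE]|b /Aa //|x y _ nx _ ny]; last first.
  by case: (nondvl_mult a0) => _; apply.
apply: (dvl1 a0); exists (c^-1%:MP * h).
by rewrite mulrCA -hE -mpolyCM mulVf // mpolyC1.
Qed.

Lemma loc_gen_reg A a f : a != 0 -> (forall b, A b -> ~ dvl a (lform b)) ->
  loc (gen A) f -> reg a f.
Proof. by move=> a0 Aa; apply: loc_sub => g; apply: gen_nondvl. Qed.

Lemma reg_clear a f s : a != 0 -> reg a f -> tofrac (lform a) * f = tofrac s ->
  exists t, f = tofrac t.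
Proof.
move=> a0 [g [t [ng gt]]] fs.
have /eqP : tofrac (g * s) = tofrac (lform a * t).
  by rewrite !tofracM -fs -gt mulrCA.
rewrite tofrac_eq => /eqP/(lform_prime a0)[//|[u uE]].
exists u; apply: (mulfI (x := tofrac (lform a))).
  by rewrite tofrac_eq0 lform_neq0.
by rewrite fs uE tofracM.
Qed.

(** By induction on the denominator: a factor in [C] is kept, and any other one cancels against the
    numerator by [reg_clear]. For a product [x * y], first [x] is treated with [y] moved into the
    function, then [y]. *)
Lemma loc_gen_clear A C f : (forall a, A a -> a != 0 /\ (C a \/ reg a f)) ->
  loc (gen A) f -> loc (gen C) f.
Proof.
move=> hA [g [s [Ag]]]; elim: Ag f s hA => [c c0|a Aa|x y Ax IHx Ay IHy] f s hA gs.
- by exists c%:MP, s; split=> //; apply: gen_const.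
- have [a0 [Ca|ra]] := hA a Aa; first by exists (lform a), s; split=> //; apply: gen_form.
  have [t ->] := reg_clear a0 ra gs; exact: loc_tofrac (gen_mult C).
- have hA' (h : S) a : A a -> a != 0 /\ (C a \/ reg a (tofrac h * f)).
    move=> /hA[a0 [Ca|ra]]; split=> //; first by left.
    right; apply: subringPM => //; first exact: reg_subring.
    exact/loc_tofrac/nondvl_mult.
  have [|x' [s' [Cx' xs]]] := IHx (tofrac y * f) s (hA' y).
    by rewrite mulrA -tofracM.
  have [|y' [s'' [Cy' ys]]] := IHy (tofrac x' * f) s' (hA' x').
    by rewrite mulrCA.
  by exists (y' * x'), s''; split; [apply: gen_mul | rewrite tofracM -mulrA].
Qed.

Lemma gen_empty g : gen (fun _ => False) g -> exists2 c, c != 0 & g = c%:MP.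
Proof.
elim=> [c c0|//|x y _ [c c0 ->] _ [d d0 ->]]; first by exists c.
by exists (c * d); rewrite ?mulf_neq0 ?mpolyCM.
Qed.

(** This is the form in which factoriality of the polynomial ring enters the arguments about
    poles. *)
Lemma loc_gen_poly A f : (forall a, A a -> a != 0 /\ reg a f) -> loc (gen A) f ->
  exists s, f = tofrac s.
Proof.
move=> hA /(@loc_gen_clear _ (fun _ => False))[a /hA[]|g [s [/gen_empty[c c0 ->] gs]]].
  by split=> //; right.
exists (c^-1 *: s); apply: (mulfI (x := tofrac c%:MP)).
  by rewrite tofrac_eq0 mpolyC_eq0.
by rewrite gs -tofracM -mul_mpolyC mulrA -mpolyCM mulfV // mpolyC1 mul1r.
Qed.
End Regularity.

(** * Logarithmic forms *)

Section LogForms.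
Variables (K : fieldType) (l : nat).
Local Notation V := 'rV[K]_l.
Local Notation S := {mpoly K[l]}.
Local Notation F := {fraction S}.
Local Notation Lam := {ffun {set 'I_l} -> F}.

Definition kfrac (c : K) : F := tofrac c%:MP.
HB.instance Definition _ := GRing.RMorphism.copy kfrac (@tofrac {mpoly K[l]} \o @mpolyC l K).

Definition coefs (f : 'Hom(V, K^o)) : V := \row_i (f (delta_mx 0 i) : K).

Lemma lin_polyE f : lin_poly f = lform (coefs f).
Proof. by apply: eq_bigr => i _; rewrite mxE. Qed.

Lemma coefsE (f : 'Hom(V, K^o)) x : f x = (x *m (coefs f)^T) 0 0 :> K.
Proof.
rewrite [in LHS](matrix_sum_delta x) linear_sum /= mxE big_ord1 linear_sum.
by apply: eq_bigr => i _; rewrite linearZ !mxE.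
Qed.

Lemma ratform_scaleE (c : S) (w : ratform K l) I : (c *: w) I = tofrac c * w I.
Proof. by rewrite ffunE. Qed.

Lemma wedge_dform (f : 'Hom(V, K^o)) (w : Lam) :
  wedge (form_frac (dform (lin_poly f))) w = ew (map_mx kfrac (coefs f)) w.
Proof.
apply/ffunP => J; rewrite ffunE sum_ffunE.
under eq_bigr => I _.
  rewrite !ffunE rmorph_sum /= mulr_suml mulr_sumr big_mkcond /=; over.
rewrite exchange_big /=; apply: eq_bigr => i _.
rewrite exsE !ffunE; case: ifPn => iJ; last first.
  rewrite mulr0 big1 // => I IJ; case: eqP => // IE.
  by case/negP: iJ; rewrite -sub1set -IE.
rewrite (bigD1 [set i]) ?sub1set //= big1 => [|I /andP[_ /negPf ->] //].
rewrite eqxx addr0 lin_polyE mderiv_lform !mxE [RHS]mulrCA; congr (_ * _).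
rewrite /sg /inversions /below; congr (_ ^+ _).
rewrite -(card_imset _ (f := fun j : 'I_l => (i, j))) => [|? ? [] //].
apply: eq_card => -[k j]; rewrite !inE /=; apply/and3P/imsetP.
  move=> [/eqP -> /andP[_ jJ] ji]; exists j => //.
  by rewrite inE jJ.
move=> [j']; rewrite inE => /andP[jJ ji] [-> ->]; split=> //.
by rewrite jJ andbT; apply: contraTneq ji => ->; rewrite ltnn.
Qed.

Variables (A : {fset {vspace V}}) (alpha : {vspace V} -> 'Hom(V, K^o)).
Local Notation c L := (coefs (alpha L)).

Definition arr : V -> Prop := fun b => exists2 L, L \in A & b = c L.

Definition good_arr :=
  (forall L, L \in A -> c L != 0) /\
  (forall L L', L \in A -> L' \in A -> L != L' -> ~ dvl (c L) (lform (c L'))).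

(** The defining condition, read at the generic point of each hyperplane instead of with the product
    of all forms, so that each pole can be checked on its own. *)
Definition logform (m : {vspace V} -> nat) (p : nat) (w : Lam) := [/\ ext_deg p w,
  forms_over (loc (gen arr)) w &
  forall L, L \in A ->
    forms_over (reg (c L)) (exs (tofrac (lform (c L)) ^+ m L) w) /\
    forms_over (reg (c L)) (ew (map_mx kfrac (c L)) w)].

Hypothesis hA : good_arr.

Lemma good_arrP b : arr b -> b != 0.
Proof. by move=> [L LA ->]; apply: hA.1. Qed.

Let c_neq0 L (LA : L \in A) : c L != 0 := hA.1 L LA.

Variables (m : {vspace V} -> nat) (p : nat).

Let Qp (T : {fset {vspace V}}) : S := \prod_(L <- T) lform (c L) ^+ m L.

Let QA : defining_poly A alpha m = Qp A.
Proof. by apply: eq_bigr => L _; rewrite lin_polyE. Qed.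

Let QD L : L \in A -> Qp A = lform (c L) ^+ m L * Qp (A `\ L)%fset.
Proof. by move=> LA; rewrite /Qp (big_fsetD1 L). Qed.

Let Q_gen : gen arr (Qp A).
Proof. by apply: gen_prod => L LA; apply/gen_exp/gen_form; exists L. Qed.

Let Q_nondvl L : L \in A -> ~ dvl (c L) (Qp (A `\ L)%fset).
Proof.
move=> LA; apply: (@gen_nondvl _ _ (fun b => exists2 L', L' \in (A `\ L)%fset & b = c L')).
- exact: hA.1.
- move=> _ [L' + ->]; rewrite !inE => /andP[L'L L'A].
  by apply: hA.2 => //; rewrite eq_sym.
- by apply: gen_prod => L' L'A; apply/gen_exp/gen_form; exists L'.
Qed.

Let Q_neq0 : Qp A != 0.
Proof. exact: gen_neq0 good_arrP Q_gen. Qed.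

Let cL_neq0 L : L \in A -> tofrac (lform (c L)) ^+ m L != 0 :> F.
Proof. by move=> LA; rewrite expf_neq0 // tofrac_eq0 lform_neq0 ?hA.1. Qed.

(** At the generic point of [L] the defining polynomial equals [lform (c L) ^+ m L] up to a factor
    prime to [lform (c L)]. Conversely, functions with denominators from the arrangement and regular
    along all its hyperplanes are polynomials. *)
Lemma is_log_formP (w : Lam) : is_log_form A alpha m p w <-> logform m p w.
Proof.
split=> [[[eta deta Eeta] Hw]|[dw lw rw]].
  have Ew I : tofrac (Qp A) * w I = tofrac (eta I).
    by move/ffunP/(_ I): Eeta; rewrite ratform_scaleE QA ffunE.
  split=> [I Ip|I|L LA].
  - have := Ew I; rewrite deta // tofrac0 => /eqP; rewrite mulf_eq0 tofrac_eq0.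
    by rewrite (negPf Q_neq0) => /eqP.
  - by exists (Qp A), (eta I).
  - split=> I.
      exists (Qp (A `\ L)%fset), (eta I); split; first exact: Q_nondvl.
      by rewrite exsE mulrA -Ew (QD LA) tofracM tofracXn [X in _ = X * _]mulrC.
    have [theta _ Et] := Hw L LA.
    exists (Qp (A `\ L)%fset), (theta I); split; first exact: Q_nondvl.
    move/ffunP/(_ I): Et; rewrite !ratform_scaleE wedge_dform QA (QD LA) lin_polyE.
    rewrite ffunE tofracM tofracXn -mulrA => /mulfI; apply; exact: cL_neq0.
have poly_of f : loc (gen arr) f -> (forall L, L \in A -> reg (c L) f) ->
    exists s, f = tofrac s.
  move=> lf rf; apply: loc_gen_poly lf => b [L LA ->]; split; first exact: hA.1.
  exact: rf.
have regS L s : L \in A -> reg (c L) (tofrac s).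
  by move=> LA; apply/loc_tofrac/nondvl_mult/c_neq0.
have locS s : loc (gen arr) (tofrac s) by apply/loc_tofrac/gen_mult.
have regM L f g : L \in A -> reg (c L) f -> reg (c L) g -> reg (c L) (f * g).
  by move=> LA; apply: (subringPM (reg_subring (c_neq0 LA))).
have locM f g := subringPM (loc_subring (gen_mult arr)) (x := f) (y := g).
split.
  have /choice[eta Eeta] I : exists s, tofrac (Qp A) * w I = tofrac s.
    apply: poly_of; first exact: locM.
    move=> L LA; rewrite (QD LA) tofracM tofracXn mulrAC mulrC; apply: regM => //.
      exact: regS.
    by have [/(_ I)] := rw L LA; rewrite exsE.
  exists [ffun I => eta I].
    move=> I Ip; rewrite ffunE; apply/eqP; rewrite -(tofrac_eq0 (eta I)) -Eeta.
    by rewrite dw // mulr0.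
  by apply/ffunP => I; rewrite ratform_scaleE QA Eeta !ffunE.
move=> L LA; pose w' := ew (map_mx kfrac (c L)) w.
have lw' : forms_over (loc (gen arr)) w'.
  apply: forms_over_ew => //; first exact/loc_subring/gen_mult.
  by move=> i j; rewrite mxE; apply: locS.
(* Regularity along [L] itself is the second local condition; along another [L'] the factor
   [lform (c L') ^+ m L'] cancels the pole of [w]. *)
have /choice[theta Et] I : exists s, tofrac (Qp (A `\ L)%fset) * w' I = tofrac s.
  apply: poly_of; first exact: locM.
  move=> L' L'A; have [<-|LL'] := eqVneq L L'.
    apply: regM => //; first exact: regS.
    by have [_] := rw L LA; apply.
  have L'AL : L' \in (A `\ L)%fset by rewrite !inE eq_sym LL'.
  rewrite /Qp (big_fsetD1 L') //= tofracM tofracXn mulrAC mulrC; apply: regM => //.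
    exact: regS.
  rewrite -exsE -ewZ; apply: forms_over_ew.
  - exact/reg_subring/c_neq0.
  - by move=> i j; rewrite mxE; apply: regS.
  - by have [] := rw L' L'A.
exists [ffun I => theta I].
  move=> I Ip; rewrite ffunE; apply/eqP; rewrite -(tofrac_eq0 (theta I)) -Et.
  by rewrite (ext_deg_ew _ dw) // mulr0.
apply/ffunP => I; rewrite !ratform_scaleE wedge_dform -/w' QA (QD LA) !ffunE -Et.
by rewrite lin_polyE tofracM tofracXn mulrA.
Qed.
End LogForms.

Section DualVector.
Variables (K : fieldType) (l : nat).

Lemma dual_vector (a : 'rV[K]_l) : a != 0 -> exists v : 'rV[K]_l, v *m a^T = 1%:M.
Proof.
move=> /rV0Pn[i ai]; exists ((a 0 i)^-1 *: delta_mx 0 i).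
rewrite -scalemxAl -rowE; apply/matrixP => j k; rewrite !ord1 !mxE.
by rewrite mulVf.
Qed.
End DualVector.

Section OneForms.
Variables (R : comNzRingType) (n : nat).
Local Notation Lam := {ffun {set 'I_n} -> R}.

Lemma ew_one (b : 'rV[R]_n) i : ew b (ext_one R n) [set i] = b 0 i.
Proof.
rewrite sum_ffunE (bigD1 i) //= big1 => [|j ji]; rewrite exsE ffunE inE.
  rewrite eqxx setDv ffunE eqxx addr0 mulr1 /sg /below.
  rewrite (_ : [set j in _ | _] = set0) ?cards0 ?expr0 ?mulr1 //.
  by apply/setP => j; rewrite !inE; case: eqP => // ->; rewrite ltnn.
by rewrite (negPf ji) mulr0.
Qed.

Lemma ext_deg_one : ext_deg 0 (ext_one R n).
Proof. by move=> I; rewrite cards_eq0 ffunE => /negPf ->. Qed.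

Lemma deg1_ew (w : Lam) : ext_deg 1 w ->
  w = ew (\row_i w [set i]) (ext_one R n).
Proof.
move=> dw; apply/ffunP => I; have [/cards1P[i ->]|I1] := boolP (#|I| == 1%N).
  by rewrite ew_one mxE.
by rewrite dw // (ext_deg_ew _ ext_deg_one).
Qed.

Lemma ct_one (v : 'rV[R]_n) : ct v (ext_one R n) = 0.
Proof. exact: ext_deg_ct0 ext_deg_one. Qed.

Lemma ct_ew_one (v b : 'rV[R]_n) :
  ct v (ew b (ext_one R n)) = exs ((v *m b^T) 0 0) (ext_one R n).
Proof. by rewrite -ct_ew ct_one ew0 addr0. Qed.

Lemma ct_ew_unit (v a : 'rV[R]_n) (w : Lam) : v *m a^T = 1%:M ->
  w = ct v (ew a w) + ew a (ct v w).
Proof. by move=> va; rewrite ct_ew va mxE exs1. Qed.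

Lemma ew_ct_ew (v a : 'rV[R]_n) (w : Lam) : v *m a^T = 1%:M ->
  ew a (ct v (ew a w)) = ew a w.
Proof.
by move=> va; rewrite [RHS](ct_ew_unit _ va) ew_ew ct0 add0r.
Qed.

(** As an algebra map, induced by b |-> b - b(v) a on one-forms, this operator can be combined with
    other substitutions by matrix products. *)
Lemma proj_Tm (v a : 'rV[R]_n) (w : Lam) : v *m a^T = 1%:M ->
  ct v (ew a w) = Tm (1%:M - v^T *m a) w.
Proof.
move=> va; pose Z w := ct v (ew a w).
have ZD : {morph Z : w u / w + u} by move=> u u'; rewrite /Z ewD ctD.
have Z0 : Z 0 = 0 by rewrite /Z ew0 ct0.
have Zw b u : Z (ew b u) = ew (b *m (1%:M - v^T *m a)) (Z u).
  have -> : b *m (1%:M - v^T *m a) = b + - (v *m b^T) 0 0 *: a.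
    rewrite mulmxBr mulmx1 mulmxA scaleNr; congr (_ - _).
    rewrite [b *m v^T]mx11_scalar mul_scalar_mx; congr (_ *: _).
    by rewrite !mxE; apply: eq_bigr => i _; rewrite !mxE mulrC.
  rewrite ewDl ewZl /Z ew_ct_ew // exsNl -ct_ew ewC ctN opprD addrC.
  by rewrite subrK.
have Ze s : Z (eprod 1%:M s) = eprod (1%:M - v^T *m a) s.
  elim: s => [|i s IH] /=; last by rewrite Zw IH -row_mul mul1mx.
  by rewrite /Z ct_ew_one va mxE exs1.
rewrite -[in LHS](Tm1 w) -/(Z _) /Tm (big_morph Z ZD Z0); apply: eq_bigr => I _.
by rewrite /Z ewZ ctZ -/(Z _) Ze.
Qed.
End OneForms.

(** * Operations preserving logarithmic forms *)

Section LogOperations.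
Variables (K : fieldType) (l : nat).
Local Notation V := 'rV[K]_l.
Local Notation S := {mpoly K[l]}.
Local Notation F := {fraction S}.
Local Notation Lam := {ffun {set 'I_l} -> F}.
Variables (A : {fset {vspace V}}) (alpha : {vspace V} -> 'Hom(V, K^o)).
Local Notation c L := (coefs (alpha L)).
Local Notation kx := (map_mx (@kfrac K l)).
Local Notation tx := (map_mx (@tofrac S)).
Hypothesis hA : good_arr A alpha.
Local Notation lg := (logform A alpha (@const1 K l)).

Let c_neq0 L (LA : L \in A) : c L != 0 := hA.1 L LA.

Lemma reg_tofrac (a : V) s : a != 0 -> reg a (tofrac s).
Proof. by move=> a0; apply/loc_tofrac/nondvl_mult. Qed.

Lemma reg_kx (a : V) m n (M : 'M[K]_(m, n)) : a != 0 -> mx_over (reg a) (kx M).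
Proof. by move=> a0 i j; rewrite mxE; apply: reg_tofrac. Qed.

Lemma reg_tx (a : V) m n (M : 'M[S]_(m, n)) : a != 0 -> mx_over (reg a) (tx M).
Proof. by move=> a0 i j; rewrite mxE; apply: reg_tofrac. Qed.

Lemma locA_tofrac (C : V -> Prop) s : loc (gen C) (tofrac s).
Proof. by apply/loc_tofrac/gen_mult. Qed.

Let lcA := loc_subring (gen_mult (arr A alpha)).

Definition logvec (b : 'rV[F]_l) := lg 1 (ew b (ext_one F l)).

(** The remainder is i_v(d alpha_L wedge b), and d alpha_L wedge b is regular along [L]. *)
Lemma logvec_split b L (v : V) : logvec b -> L \in A -> v *m (c L)^T = 1%:M ->
  let bv := (kx v *m b^T) 0 0 in
  reg (c L) (tofrac (lform (c L)) * bv) /\ mx_over (reg (c L)) (b - bv *: kx (c L)).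
Proof.
move=> [_ _ lb] LA va bv; have a0 := c_neq0 LA.
have [r1 r2] := lb L LA; have rs := reg_subring a0.
have vaF : kx v *m (kx (c L))^T = 1%:M by rewrite map_trmx -map_mxM va map_mx1.
split.
  rewrite /bv mxE mulr_sumr; apply: (subringP_sum rs) => i _.
  rewrite mulrCA; apply: (subringPM rs); first exact: reg_kx.
  by rewrite mxE; have := r1 [set i]; rewrite exsE ew_one.
move=> i j; rewrite ord1 -ew_one.
have -> : ew (b - bv *: kx (c L)) (ext_one F l) =
    ct (kx v) (ew (kx (c L)) (ew b (ext_one F l))).
  rewrite [RHS](canRL (addrK _) (ct_ew (kx v) (kx (c L)) _)) vaF mxE exs1.
  by rewrite ct_ew_one ewZ ewDl -scaleNr ewZl exsNl.
by apply: (forms_over_ct rs) => //; apply: reg_kx.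
Qed.

(** Only the part bv d alpha_L of [b] could create a double pole along [L]; but alpha_L bv and d
    alpha_L wedge [w] are both regular, as all multiplicities are 1. *)
Lemma ew_logform b p w : logvec b -> lg p w -> lg p.+1 (ew b w).
Proof.
move=> lb [dw lw rw]; split; first exact: ext_deg_ew.
  apply: (forms_over_ew lcA) => // i j; rewrite ord1 -ew_one.
  by case: lb => _ + _; apply.
move=> L LA; have a0 := c_neq0 LA; have rs := reg_subring a0.
have [v va] := dual_vector a0.
have [] := logvec_split lb LA va; set bv := _ 0 0; set b2 := b - _ => rbv rb2.
have [r1 r2] := rw L LA; rewrite expr1 in r1 *.
have bE : b = bv *: kx (c L) + b2 by rewrite addrC subrK.
have Eb : ew b w = exs bv (ew (kx (c L)) w) + ew b2 w.
  by rewrite {1}bE ewDl ewZl.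
split.
  rewrite Eb exsDr exsA -[exs _ (ew b2 w)]ewZ; apply: (forms_overD rs).
    exact: (forms_over_exs rs).
  exact: (forms_over_ew rs).
rewrite Eb ewD ewZ ew_ew exs0 add0r ewC.
exact/(forms_overN rs)/(forms_over_ew rs).
Qed.

(** Moving d alpha_L past the contraction yields th(alpha_L) [w], and divisibility of th(alpha_L) by
    alpha_L cancels the simple pole. *)
Lemma ct_logform (th : 'rV[S]_l) p w :
  (forall L, L \in A -> dvl (c L) ((th *m (map_mx (@mpolyC l K) (c L))^T) 0 0)) ->
  lg p.+1 w -> lg p (ct (tx th) w).
Proof.
move=> hth [dw lw rw]; split; first exact: ext_deg_ct.
  by apply: (forms_over_ct lcA) => // i j; rewrite mxE; apply: locA_tofrac.
move=> L LA; have a0 := c_neq0 LA; have rs := reg_subring a0.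
have [r1 r2] := rw L LA; rewrite expr1 in r1 *.
split; first by rewrite -ctZ; apply: (forms_over_ct rs) => //; apply: reg_tx.
have -> : ew (kx (c L)) (ct (tx th) w) =
   exs ((tx th *m (kx (c L))^T) 0 0) w - ct (tx th) (ew (kx (c L)) w).
  by rewrite -ct_ew addrC addKr.
apply: (forms_overD rs); last first.
  by apply/(forms_overN rs)/(forms_over_ct rs) => //; apply: reg_tx.
have [h hE] := hth L LA.
have -> : (tx th *m (kx (c L))^T) 0 0 = tofrac h * tofrac (lform (c L)).
  rewrite -tofracM mulrC -hE !mxE rmorph_sum /=; apply: eq_bigr => i _.
  by rewrite tofracM !mxE.
by rewrite -exsA; apply: (forms_over_exs rs) => //; apply: reg_tofrac.
Qed.

Lemma logform_tofrac m p s w : logform A alpha m p w ->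
  logform A alpha m p (exs (tofrac s) w).
Proof.
move=> [dw lw rw]; split; first exact: ext_deg_exs.
  by apply: (forms_over_exs lcA) => //; apply: locA_tofrac.
move=> L LA; have a0 := c_neq0 LA; have rs := reg_subring a0.
have [r1 r2] := rw L LA; rewrite ewZ exsC.
by split; apply: (forms_over_exs rs) => //; apply: reg_tofrac.
Qed.

Lemma logformD m p w w' : logform A alpha m p w -> logform A alpha m p w' ->
  logform A alpha m p (w + w').
Proof.
move=> [dw lw rw] [dw' lw' rw']; split.
- by move=> I Ip; rewrite ffunE dw ?dw' ?addr0.
- exact: (forms_overD lcA).
- move=> L LA; have rs := reg_subring (c_neq0 LA).
  have [r1 r2] := rw L LA; have [r1' r2'] := rw' L LA.
  by rewrite exsDr ewD; split; apply: (forms_overD rs).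
Qed.

Lemma logform0 m p : logform A alpha m p 0.
Proof.
split=> [I _|I|L LA]; rewrite ?ffunE //; first exact: (subringP0 lcA).
have rs := reg_subring (c_neq0 LA).
by rewrite exs0 ew0; split=> I; rewrite ffunE; apply: (subringP0 rs).
Qed.

Lemma logform_one : lg 0 (ext_one F l).
Proof.
have one01 (P : F -> Prop) : subring_pred P -> forms_over P (ext_one F l).
  by move=> hP I; rewrite ffunE; case: eqP => _;
    [apply: subringP1 | apply: subringP0].
split; first exact: ext_deg_one.
  exact: one01.
move=> L LA; have a0 := c_neq0 LA; have rs := reg_subring a0.
split; first by apply: (forms_over_exs rs); [rewrite expr1; apply: reg_tofrac | apply: one01].
by apply: (forms_over_ew rs); [apply: reg_kx | apply: one01].
Qed.

Lemma Tm_logform r (Om : 'M[F]_(r, l)) p (s : {ffun {set 'I_r} -> S}) :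
  (forall i, logvec (row i Om)) -> ext_deg p s ->
  lg p (Tm Om [ffun I => tofrac (s I)]).
Proof.
move=> lOm ds; rewrite /Tm; apply: big_ind; first exact: logform0.
  by move=> w w'; apply: logformD.
move=> I _; have [/eqP Ip|Ip] := boolP (#|I| == p); last first.
  by rewrite ffunE ds // tofrac0 exs0l; apply: logform0.
rewrite ffunE; apply: logform_tofrac; rewrite -Ip -size_elems.
elim: (elems I) => [|i t IH]; first exact: logform_one.
exact: ew_logform.
Qed.

Lemma logvec_dlog H : H \in A -> logvec ((tofrac (lform (c H)))^-1 *: kx (c H)).
Proof.
move=> HA; rewrite /logvec ewZl; have cH0 := c_neq0 HA.
have aH0 : tofrac (lform (c H)) != 0 :> F by rewrite tofrac_eq0 lform_neq0.
have one01 (P : F -> Prop) : subring_pred P -> forms_over P (ext_one F l).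
  by move=> hP I; rewrite ffunE; case: eqP => _;
    [apply: subringP1 | apply: subringP0].
have inv_loc (G : S -> Prop) : G (lform (c H)) -> loc G (tofrac (lform (c H)))^-1.
  by move=> GH; exists (lform (c H)), 1; rewrite mulfV ?tofrac1.
split.
- exact/ext_deg_exs/ext_deg_ew/ext_deg_one.
- apply: (forms_over_exs lcA); first by apply/inv_loc/gen_form; exists H.
  apply: (forms_over_ew lcA) => [i j|]; first by rewrite mxE; apply: locA_tofrac.
  exact: one01.
move=> L LA; have a0 := c_neq0 LA; have rs := reg_subring a0.
have rew b : mx_over (reg (c L)) b -> forms_over (reg (c L)) (ew b (ext_one F l)).
  by move=> rb; apply: (forms_over_ew rs) => //; apply: one01.
rewrite expr1 ewZ; have [LH|LH] := eqVneq L H.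
  rewrite LH ew_ew exs0 exsA mulfV // exs1 -LH; split; first by apply/rew/reg_kx.
  by move=> I; rewrite ffunE; apply: (subringP0 rs).
have rinv : reg (c L) (tofrac (lform (c H)))^-1 by apply/inv_loc/hA.2.
split; first apply: (forms_over_exs rs); first exact: reg_tofrac.
  by apply: (forms_over_exs rs) => //; apply/rew/reg_kx.
apply: (forms_over_exs rs) => //; apply: (forms_over_ew rs); first exact: reg_kx.
exact/rew/reg_kx.
Qed.

Definition euler : 'rV[S]_l := \row_i 'X_i.

Lemma euler_form (a : V) : (euler *m (map_mx (@mpolyC l K) a)^T) 0 0 = lform a.
Proof.
by rewrite mxE; apply: eq_bigr => i _; rewrite !mxE mulrC mul_mpolyC.
Qed.

Lemma ct_euler_logform p w : lg p.+1 w -> lg p (ct (tx euler) w).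
Proof.
by apply: ct_logform => L LA; rewrite euler_form; exists 1; rewrite mulr1.
Qed.

Lemma euler_dlog (a : V) : a != 0 ->
  (tx euler *m ((tofrac (lform a))^-1 *: kx a)^T) 0 0 = 1.
Proof.
move=> a0; rewrite linearZ -scalemxAr mxE.
have -> : (tx euler *m (kx a)^T) 0 0 = tofrac (lform a).
  rewrite -euler_form !mxE rmorph_sum /=; apply: eq_bigr => i _.
  by rewrite tofracM !mxE.
by rewrite mulVf // tofrac_eq0 lform_neq0.
Qed.

(* The projection of log forms onto those killed by the Euler field. *)
Definition euler_proj (a : V) (w : Lam) : Lam :=
  ct (tx euler) (ew ((tofrac (lform a))^-1 *: kx a) w).

Lemma euler_projE (a : V) w : a != 0 ->
  w = euler_proj a w + ew ((tofrac (lform a))^-1 *: kx a) (ct (tx euler) w).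
Proof. by move=> a0; rewrite ct_ew euler_dlog // exs1. Qed.

Lemma euler_proj_logform H p w : H \in A -> lg p w -> lg p (euler_proj (c H) w).
Proof.
by move=> HA lw; apply/ct_euler_logform/ew_logform => //; apply: logvec_dlog.
Qed.

Lemma ct_euler_proj a w : ct (tx euler) (euler_proj a w) = 0.
Proof. exact: ct_ct. Qed.

Lemma euler_proj_id a w : a != 0 -> ct (tx euler) w = 0 -> euler_proj a w = w.
Proof. by move=> a0 w0; rewrite [RHS](euler_projE w a0) w0 ew0 addr0. Qed.
End LogOperations.

(** * Restriction of logarithmic forms to a hyperplane *)

Section Residue.
Variables (K : fieldType) (l n : nat).
Local Notation V := 'rV[K]_l.
Local Notation W := 'rV[K]_n.
Local Notation S := {mpoly K[l]}.
Local Notation S' := {mpoly K[n]}.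
Local Notation F := {fraction S}.
Local Notation F' := {fraction S'}.
Variables (A : {fset {vspace V}}) (alpha : {vspace V} -> 'Hom(V, K^o)).
Variables (B : {fset {vspace W}}) (beta : {vspace W} -> 'Hom(W, K^o)).
Variables (mB : {vspace W} -> nat) (H : {vspace V}) (Y : {vspace V} -> {vspace W}).
Variables (v : V) (Phi : 'M[K]_(n, l)) (G : 'M[K]_(l, n)).
Local Notation c L := (coefs (alpha L)).
Local Notation cB Z := (coefs (beta Z)).
Local Notation a := (c H).
Local Notation kx := (map_mx (@kfrac K l)).
Local Notation kB := (map_mx (@kfrac K n)).
Local Notation tx := (map_mx (@tofrac S)).
Local Notation pi := (subst Phi^T).
Local Notation lg := (logform A alpha (@const1 K l)).
Local Notation lgB := (logform B beta mB).

Hypothesis hA : good_arr A alpha.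
Hypothesis hB : good_arr B beta.
Hypothesis HA : H \in A.
Hypothesis hc : hyp_coords a v Phi G.
Hypothesis hY : forall L, L \in A -> L != H -> Y L \in B /\
  exists2 e, e != 0 & c L *m Phi^T = e *: cB (Y L).
Hypothesis hBY : forall Z, Z \in B -> exists L, [/\ L \in A, L != H & Y L = Z].

Definition above (Z : {vspace W}) : {fset {vspace V}} :=
  [fset L in A `\ H | Y L == Z]%fset.

Hypothesis hm : forall Z, Z \in B -> mB Z = #|` above Z|.

Let a0 : a != 0 := hA.1 H HA.
Let va : v *m a^T = 1%:M. Proof. by case: hc. Qed.
Let vaF : kx v *m (kx a)^T = 1%:M.
Proof. by rewrite map_trmx -map_mxM va map_mx1. Qed.

Lemma in_above L Z : (L \in above Z) = [&& L != H, L \in A & Y L == Z].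
Proof. by rewrite !inE /= andbA. Qed.

(** Two fractions for the same [f] with denominators nonzero on [H] restrict to equal fractions, by
    cross-multiplication. *)
Lemma restriction_exists : exists r : F -> F', forall f g s, pi g != 0 ->
  tofrac g * f = tofrac s -> r f = tofrac (pi s) / tofrac (pi g).
Proof.
suff /choice[r rP] : forall f, exists y, forall g s, pi g != 0 ->
    tofrac g * f = tofrac s -> y = tofrac (pi s) / tofrac (pi g).
  by exists r => f; apply: rP.
move=> f.
have [[g [s [g0 gs]]]|nf] :=
    pselect (exists g s, pi g != 0 /\ tofrac g * f = tofrac s); last first.
  (* A function with a pole along [H] gets the value 0. *)
  by exists 0 => g s g0 gs; case: nf; exists g, s.
exists (tofrac (pi s) / tofrac (pi g)) => h t h0 ht.
apply/eqP; rewrite eqr_div ?tofrac_eq0 // -!tofracM tofrac_eq -!rmorphM.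
apply/eqP; congr pi; apply/eqP; rewrite -tofrac_eq !tofracM -gs -ht.
by rewrite mulrAC [X in _ == X]mulrAC [tofrac g * _]mulrC.
Qed.

Lemma dvl_pi g : dvl a g <-> pi g = 0.
Proof. by rewrite (hyp_subst_ker hc). Qed.

Variable r : F -> F'.
Hypothesis rE : forall f g s, pi g != 0 ->
  tofrac g * f = tofrac s -> r f = tofrac (pi s) / tofrac (pi g).

Let ndvl g : ~ dvl a g <-> pi g != 0.
Proof. by rewrite dvl_pi; split=> /eqP. Qed.

Lemma restr_tofrac s : r (tofrac s) = tofrac (pi s).
Proof.
rewrite (@rE _ 1 s) ?rmorph1 ?oner_neq0 ?mul1r //.
by rewrite ?tofrac1 divr1.
Qed.

Lemma restr1 : r 1 = 1.
Proof. by rewrite -tofrac1 restr_tofrac rmorph1 tofrac1. Qed.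

Lemma restrM x y : reg a x -> reg a y -> r (x * y) = r x * r y.
Proof.
move=> [g [s [/ndvl g0 gs]]] [h [t [/ndvl h0 ht]]].
rewrite (rE g0 gs) (rE h0 ht) (@rE _ (g * h) (s * t)).
- by rewrite !rmorphM /= mulf_div.
- by rewrite rmorphM mulf_neq0.
- by rewrite !tofracM -gs -ht mulrACA.
Qed.

Lemma restrB x y : reg a x -> reg a y -> r (x - y) = r x - r y.
Proof.
move=> [g [s [/ndvl g0 gs]]] [h [t [/ndvl h0 ht]]].
rewrite (rE g0 gs) (rE h0 ht) (@rE _ (g * h) (h * s - g * t)).
- rewrite !(rmorphB, rmorphM) /= mulrBl; congr (_ - _).
    by rewrite [X in X / _]mulrC -mulf_div divff ?mulr1 // tofrac_eq0.
  by rewrite -mulf_div divff ?mul1r // tofrac_eq0.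
- by rewrite rmorphM mulf_neq0.
- rewrite tofracB !tofracM -gs -ht mulrBr; congr (_ - _); last by rewrite mulrA.
  by rewrite mulrAC mulrC mulrA.
Qed.

Let ra := reg_subring a0.

Lemma restr_eq0 f : reg a f -> r f = 0 -> reg a ((tofrac (lform a))^-1 * f).
Proof.
move=> [g [s [ng gs]]]; rewrite (rE (iffLR (ndvl g) ng) gs) => /eqP.
rewrite mulf_eq0 invr_eq0 !tofrac_eq0 => /orP[/eqP/dvl_pi[t tE]|/eqP]; last first.
  by move/dvl_pi.
exists g, t; split=> //; rewrite mulrCA gs tE tofracM mulKf //.
by rewrite tofrac_eq0 lform_neq0.
Qed.

(** The origin of the Ziegler multiplicity: each of the hyperplanes above [Z] contributes the form
    of [Z] once, up to a scalar. *)
Lemma pi_above Z : Z \in B -> exists2 e, e != 0 &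
  pi (\prod_(L <- above Z) lform (c L)) = e *: lform (cB Z) ^+ mB Z.
Proof.
move=> ZB; rewrite hm // rmorph_prod.
suff: forall s : seq {vspace V}, {subset s <= above Z} -> exists2 e, e != 0 &
    \prod_(L <- s) pi (lform (c L)) = e *: lform (cB Z) ^+ size s by apply.
elim=> [|L s IH] sZ; first by exists 1; rewrite ?oner_neq0 // big_nil scale1r.
have [|e e0 sE] := IH; first by move=> M Ms; apply: sZ; rewrite inE Ms orbT.
have := sZ L (mem_head _ _); rewrite in_above => /and3P[LH LA /eqP LZ].
have [_ [e' e'0 E]] := hY LA LH.
exists (e' * e); first exact: mulf_neq0.
by rewrite big_cons sE subst_lform E lformZ LZ exprS -scalerAl -scalerAr scalerA.
Qed.

Lemma restr_loc (T : {vspace V} -> Prop) (D : W -> Prop) f :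
  (forall L, T L -> [/\ L \in A, L != H & D (cB (Y L))]) ->
  (forall b, D b -> b != 0) ->
  loc (gen (fun b => exists2 L, T L & b = c L)) f -> loc (gen D) (r f).
Proof.
move=> hT D0 [g [s [Tg gs]]].
have Dg : gen D (pi g).
  elim: Tg => [e e0|_ [L /hT[LA LH DL] ->]|x y _ Dx _ Dy].
  - by rewrite substC; apply: gen_const.
  - have [_ [e e0 E]] := hY LA LH.
    rewrite subst_lform E lformZ -mul_mpolyC; apply: gen_mul; first exact: gen_const.
    exact: gen_form.
  - by rewrite rmorphM; apply: gen_mul.
have g0 := gen_neq0 D0 Dg.
exists (pi g), (pi s); split=> //; rewrite (rE g0 gs) mulrC divfK //.
by rewrite tofrac_eq0.
Qed.

Lemma restr_locB f : loc (gen (arr A alpha)) f -> reg a f ->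
  loc (gen (arr B beta)) (r f).
Proof.
move=> lf rf; apply: (@restr_loc (fun L => L \in A /\ L != H)).
- by move=> L [LA LH]; split=> //; exists (Y L) => //; case: (hY LA LH).
- exact: good_arrP.
apply: loc_gen_clear lf => _ [L LA ->]; split; first exact: hA.1.
by have [->|LH] := eqVneq L H; [right | left; exists L].
Qed.

(** The factors for [H] and for hyperplanes above [Z] can be cleared from the denominator of [f];
    the remaining ones restrict to forms of hyperplanes other than [Z]. *)
Lemma restr_regB Z f : Z \in B -> loc (gen (arr A alpha)) f -> reg a f ->
  (forall L, L \in above Z -> reg (c L) f) -> reg (cB Z) (r f).
Proof.
move=> ZB lf rf rZ.
pose D b := exists2 Z', Z' \in B /\ Z' != Z & b = cB Z'.
apply: (@loc_gen_reg _ _ D).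
- exact: hB.1.
- by move=> _ [Z' [Z'B Z'Z] ->]; apply: hB.2 => //; rewrite eq_sym.
apply: (@restr_loc (fun L => [/\ L \in A, L != H & Y L != Z])).
- move=> L [LA LH LZ]; split=> //; exists (Y L) => //.
  by case: (hY LA LH).
- by move=> _ [Z' [Z'B _] ->]; apply: hB.1.
apply: loc_gen_clear lf => _ [L LA ->]; split; first exact: hA.1.
have [->|LH] := eqVneq L H; [by right|].
have [LZ|LZ] := eqVneq (Y L) Z; last by left; exists L.
by right; apply: rZ; rewrite in_above LH LA LZ eqxx.
Qed.

(* If w = (da / a) w1 + w2 with w2 killed by v, then nopole w = w2. *)
Definition nopole (w : {ffun {set 'I_l} -> F}) := ct (kx v) (ew (kx a) w).
(** Not the residue w1, but the restriction of w2 to [H]. *)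
Definition resid (w : {ffun {set 'I_l} -> F}) : {ffun {set 'I_n} -> F'} :=
  Tm (kB Phi^T) (map_form r (nopole w)).

Lemma nopoleD w w' : nopole (w + w') = nopole w + nopole w'.
Proof. by rewrite /nopole ewD ctD. Qed.
Lemma nopoleZ e w : nopole (exs e w) = exs e (nopole w).
Proof. by rewrite /nopole ewZ ctZ. Qed.

Lemma reg_nopole p w : lg p w -> forms_over (reg a) (nopole w).
Proof.
move=> [_ _ /(_ H HA)[_ rw]]; apply: (forms_over_ct ra) => //.
exact: reg_kx.
Qed.

Lemma loc_nopole p w : lg p w -> forms_over (loc (gen (arr A alpha))) (nopole w).
Proof.
move=> [_ lw _]; have lcA := loc_subring (gen_mult (arr A alpha)).
apply: (forms_over_ct lcA) => [i j|]; first by rewrite mxE; apply: locA_tofrac.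
by apply: (forms_over_ew lcA) => // i j; rewrite mxE; apply: locA_tofrac.
Qed.

Lemma ew_nopole w : ew (kx a) (nopole w) = ew (kx a) w.
Proof. exact: ew_ct_ew. Qed.

Lemma residD p w w' : lg p w -> lg p w' -> resid (w + w') = resid w + resid w'.
Proof.
move=> lw lw'; rewrite /resid nopoleD -TmD; congr Tm.
exact: (map_formD ra restrB (reg_nopole lw) (reg_nopole lw')).
Qed.

Lemma residZ p w s : lg p w ->
  resid (exs (tofrac s) w) = exs (tofrac (pi s)) (resid w).
Proof.
move=> lw; rewrite /resid nopoleZ -TmZ; congr Tm.
rewrite (map_form_exs restrM) ?restr_tofrac //; first exact: reg_tofrac.
exact: reg_nopole lw.
Qed.

Lemma resid_deg p w : ext_deg p w -> ext_deg p (resid w).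
Proof.
move=> dw; apply: ext_deg_Tm => I Ip; rewrite ffunE (ext_deg_ct _ (ext_deg_ew _ dw)) //.
by rewrite -tofrac0 restr_tofrac rmorph0 tofrac0.
Qed.

Let kB_over (P : F' -> Prop) i j (M : 'M[K]_(i, j)) :
  (forall s, P (tofrac s)) -> mx_over P (kB M).
Proof. by move=> PT x y; rewrite mxE; apply: PT. Qed.

Let restr_kx i j (M : 'M[K]_(i, j)) : map_mx r (kx M) = kB M.
Proof. by apply/matrixP => x y; rewrite !mxE restr_tofrac substC. Qed.

(** Both forms restrict to multiples of the form of [Z], and a linear form vanishing on [H] is a
    multiple of the one of [H]. *)
Lemma above_span Z L L' : L \in above Z -> L' \in above Z ->
  exists e d, e != 0 /\ c L = e *: c L' + d *: a.
Proof.
rewrite !in_above => /and3P[LH LA /eqP LZ] /and3P[LH' LA' /eqP LZ'].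
have [_ [e e0 eE]] := hY LA LH; have [_ [e' e'0 e'E]] := hY LA' LH'.
have ker x : x *m Phi^T = 0 -> x = (x *m v^T) 0 0 *: a.
  move=> x0; have : x *m (Phi^T *m G^T) = 0 by rewrite mulmxA x0 mul0mx.
  case: hc => _ _ _; rewrite -trmx_mul => ->.
  rewrite linearB /= trmx1 trmx_mul trmxK mulmxBr mulmx1 mulmxA.
  by rewrite {1}[x *m v^T]mx11_scalar mul_scalar_mx => /eqP; rewrite subr_eq0 => /eqP.
exists (e / e'); exists (((c L - (e / e') *: c L') *m v^T) 0 0).
split; first by rewrite mulf_neq0 ?invr_eq0.
have E : (c L - (e / e') *: c L') *m Phi^T = 0.
  by rewrite mulmxBl eE -scalemxAl e'E LZ LZ' scalerA divfK // subrr.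
by rewrite -(ker _ E) addrC subrK.
Qed.

Lemma resid_logform p w : lg p w -> lgB p (resid w).
Proof.
move=> lw; have [dw lcw rw] := lw; have lcA := loc_subring (gen_mult (arr A alpha)).
have rn := reg_nopole lw; have ln := loc_nopole lw.
split; first exact: resid_deg.
  apply: (forms_over_Tm (loc_subring (gen_mult _))).
    by apply: kB_over => s; apply: locA_tofrac.
  by move=> I; rewrite ffunE; apply: restr_locB.
move=> Z ZB; have cZ0 := hB.1 Z ZB; have rZ := reg_subring cZ0.
have TZ s : reg (cB Z) (tofrac s) by apply: reg_tofrac.
split.
  (* Each factor of [h] cancels the simple pole of [w] along one hyperplane above [Z], and [h]
     restricts to a scalar times the form of [Z] to the power [mB Z]. *)
  pose h : S := \prod_(L <- above Z) lform (c L).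
  have hZ : forms_over (reg (cB Z)) (exs (tofrac (pi h)) (resid w)).
    rewrite -TmZ; apply: (forms_over_Tm rZ); first exact: kB_over.
    move=> I; rewrite exsE ffunE -restr_tofrac -restrM //; last exact: reg_tofrac.
    apply: restr_regB => //.
    - by apply: (subringPM lcA) => //; apply: locA_tofrac.
    - by apply: (subringPM ra) => //; apply: reg_tofrac.
    move=> L LZ; have LA : L \in A by move: LZ; rewrite in_above => /and3P[].
    have cL0 := hA.1 L LA; have rL := reg_subring cL0.
    rewrite /h (big_fsetD1 L) //= tofracM mulrAC; apply: (subringPM rL); last exact: reg_tofrac.
    rewrite -exsE -nopoleZ.
    have [r1 r2] := rw L LA; rewrite expr1 in r1.
    apply: (forms_over_ct rL); first exact: reg_kx.
    by apply: (forms_over_ew rL) => //; apply: reg_kx.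
  have [e e0 eE] := pi_above ZB; rewrite -/h in eE.
  have -> : exs (tofrac (lform (cB Z)) ^+ mB Z) (resid w) =
      exs (kfrac n e^-1) (exs (tofrac (pi h)) (resid w)).
    rewrite exsA eE -mul_mpolyC -tofracM mulrA -mpolyCM mulVf //.
    by rewrite mpolyC1 mul1r tofracXn.
  by apply: (forms_over_exs rZ) => //; apply: TZ.
have [L [LA LH LZ]] := hBY ZB; have LZ' : L \in above Z by rewrite in_above LA LH LZ eqxx.
have [_ [e e0 eE]] := hY LA LH; rewrite LZ in eE.
have aP : kB (a *m Phi^T) = 0.
  case: hc => _ Pa _ _.
  by rewrite -[a]trmxK -trmx_mul Pa trmx0 map_mx0.
have cBE : cB Z = e^-1 *: (c L *m Phi^T) by rewrite eE scalerA mulVf // scale1r.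
(* By the Clifford relation, d alpha_L wedge w2 is a multiple of d alpha wedge [w] minus i_v [u]. On
   [H] the first term vanishes with d alpha, so [u] carries the second condition along [Z]. *)
pose u := ew (kx (c L)) (ew (kx a) w).
have lu : forms_over (loc (gen (arr A alpha))) (ct (kx v) u).
  have lk (x : V) : mx_over (loc (gen (arr A alpha))) (kx x).
    by move=> i j; rewrite mxE; apply: locA_tofrac.
  by apply: (forms_over_ct lcA) => //; do !apply: (forms_over_ew lcA).
have [r1 r2] := rw H HA.
have ru : forms_over (reg a) (ct (kx v) u).
  apply: (forms_over_ct ra); first exact: reg_kx.
  by apply: (forms_over_ew ra) => //; apply: reg_kx.
have -> : ew (kB (cB Z)) (resid w) =
    - exs (kfrac n e^-1) (Tm (kB Phi^T) (map_form r (ct (kx v) u))).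
  rewrite cBE map_mxZ ewZl -exsN; congr exs.
  rewrite map_mxM -Tm_ew -(restr_kx (c L)) -(map_form_ew ra restr1 restrB restrM) //; last first.
    exact: reg_kx.
  have -> : ew (kx (c L)) (nopole w) =
      exs ((kx v *m (kx (c L))^T) 0 0) (ew (kx a) (nopole w)) - ct (kx v) u.
    by rewrite ew_nopole -ct_ew addrC addKr.
  have rwa : forms_over (reg a) (ew (kx a) (nopole w)) by rewrite ew_nopole.
  have rs : reg a ((kx v *m (kx (c L))^T) 0 0).
    by rewrite map_trmx -map_mxM; apply: reg_kx.
  rewrite (map_formD ra restrB (forms_over_exs ra rs rwa) (forms_overN ra ru)).
  rewrite TmD (map_form_exs restrM) // (map_form_ew ra restr1 restrB restrM) //; last first.
    exact: reg_kx.
  rewrite TmZ Tm_ew restr_kx -map_mxM aP ew0l exs0 add0r.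
  have -> : map_form r (- ct (kx v) u) = exs (-1) (map_form r (ct (kx v) u)).
    by apply/ffunP => I; rewrite !ffunE mulN1r; apply: (part_rN ra restrB (ru I)).
  by rewrite TmZ exsNl exs1.
apply: (forms_overN rZ); apply: (forms_over_exs rZ); first exact: TZ.
apply: (forms_over_Tm rZ); first exact: kB_over.
move=> I; rewrite ffunE; apply: (restr_regB ZB (lu I) (ru I)) => L' L'Z.
have L'A : L' \in A by move: L'Z; rewrite in_above => /and3P[].
have cL0 := hA.1 L' L'A; have rL := reg_subring cL0.
apply: (forms_over_ct rL); first exact: reg_kx.
(* In [u] the form of [L] may be replaced by that of any [L'] above [Z], since their difference is
   absorbed by d alpha; hence [u] is regular along every such [L']. *)
have [e' [d [_ cLE]]] := above_span LZ' L'Z.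
rewrite /u cLE map_mxD !map_mxZ ewDl !ewZl ew_ew exs0 addr0.
apply: (forms_over_exs rL); first exact: reg_tofrac.
rewrite ewC; apply/(forms_overN rL)/(forms_over_ew rL); first exact: reg_kx.
by have [] := rw L' L'A.
Qed.

(** If w2 is divisible by alpha, then w = i_E(d alpha wedge (w2 / alpha)) is regular along [H], so
    dividing by alpha creates at most a simple pole there. *)
Lemma resid_ker p w : lg p w -> ct (tx (euler K l)) w = 0 -> resid w = 0 ->
  lg p (exs (tofrac (lform a))^-1 w).
Proof.
move=> lw Ew rw0; have [dw lcw rw] := lw.
have aF0 : tofrac (lform a) != 0 :> F by rewrite tofrac_eq0 lform_neq0.
have rn := reg_nopole lw.
(* Pulling back along the projection recovers all coefficients of w2 on [H], because w2 is fixed by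
   the projection along [v]. *)
have n0 : map_form r (nopole w) = 0.
  have := congr1 (Tm (kB G^T)) rw0; rewrite Tm0 Tm_Tm -map_mxM.
  case: hc => _ _ _ GP; rewrite -trmx_mul GP.
  have -> : (1%:M - a^T *m v)^T = 1%:M - v^T *m a.
    by rewrite linearB /= trmx1 trmx_mul trmxK.
  rewrite -restr_kx -(map_form_Tm ra restr1 restrB restrM) //; last exact: reg_kx.
  rewrite map_mxB map_mx1 map_mxM -map_trmx -(proj_Tm _ vaF).
  by rewrite -/(nopole _) /nopole ew_ct_ew.
have rn' : forms_over (reg a) (exs (tofrac (lform a))^-1 (nopole w)).
  by move=> I; rewrite exsE; apply: restr_eq0 => //; move/ffunP/(_ I): n0; rewrite !ffunE.
have rdl : forms_over (reg a) (ew (kx a) (exs (tofrac (lform a))^-1 (nopole w))).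
  by apply: (forms_over_ew ra) => //; apply: reg_kx.
have wE : w = ct (tx (euler K l)) (ew (kx a) (exs (tofrac (lform a))^-1 (nopole w))).
  by rewrite ewZ ew_nopole -ewZl; apply/esym/(euler_proj_id a0).
have inv_loc (C : S -> Prop) : C (lform a) -> loc C (tofrac (lform a))^-1.
  by move=> Ca; exists (lform a), 1; rewrite mulfV ?tofrac1.
split; first exact: ext_deg_exs.
  apply: (forms_over_exs (loc_subring (gen_mult _))) => //.
  by apply/inv_loc/gen_form; exists H.
move=> L LA; have cL0 := hA.1 L LA; have rL := reg_subring cL0.
have [->|LH] := eqVneq L H.
  rewrite exsA expr1 mulfV // exs1; split.
    by rewrite wE; apply: (forms_over_ct ra) => //; apply: reg_tx.
  by rewrite ewZ -ew_nopole -ewZ.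
have rinv : reg (c L) (tofrac (lform a))^-1 by apply/inv_loc/hA.2.
have [r1 r2] := rw L LA; rewrite exsC ewZ.
by split; apply: (forms_over_exs rL).
Qed.
End Residue.

(** * Lifting forms along free localizations *)

Section DualBasis.
Variables (K : fieldType) (l : nat).
Local Notation V := 'rV[K]_l.
Local Notation S := {mpoly K[l]}.
Local Notation F := {fraction S}.
Variables (A : {fset {vspace V}}) (alpha : {vspace V} -> 'Hom(V, K^o)).
Local Notation c L := (coefs (alpha L)).
Local Notation kx := (map_mx (@kfrac K l)).
Local Notation tx := (map_mx (@tofrac S)).
Local Notation lg := (logform A alpha (@const1 K l)).
Local Notation Om1 := (Omega A alpha (@const1 K l) 1).
Hypothesis hA : good_arr A alpha.

Lemma Omega_logform m p (w : Omega A alpha m p) : logform A alpha m p (log_val w).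
Proof. by apply/(is_log_formP hA)/asboolP; case: w. Qed.

Lemma logform_Omega m p w : logform A alpha m p w ->
  exists u : Omega A alpha m p, log_val u = w.
Proof.
move=> /(is_log_formP hA)/asboolP lw.
by exists (LogForm lw).
Qed.

Lemma log_val_scale m p (s : S) (w : Omega A alpha m p) :
  log_val (s *: w) = exs (tofrac s) (log_val w).
Proof.
have E : log_val (s *: w) = s *: (log_val w : ratform K l) by [].
rewrite E; apply/ffunP => I; rewrite [RHS]ffunE.
exact: ratform_scaleE.
Qed.

Lemma log_valD m p (u w : Omega A alpha m p) :
  log_val (u + w) = log_val u + log_val w.
Proof. by []. Qed.

Lemma log_val_sum m p (T : Type) (s : seq T) (f : T -> Omega A alpha m p) :
  log_val (\sum_(i <- s) f i) = \sum_(i <- s) log_val (f i).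
Proof. by apply: big_morph; [apply: log_valD | ]. Qed.

(** Expansions in a basis may repeat indices, while independence is tested on lists without
    repetition; this brings all expansions to one such list. *)
Lemma sum_on_uniq (R : pzRingType) (M : lmodType R) (I : eqType) (b : I -> M)
    (T s : seq I) (e : I -> R) : uniq T -> {subset s <= T} ->
  exists e' : I -> R, \sum_(i <- s) e i *: b i = \sum_(i <- T) e' i *: b i.
Proof.
move=> uT; elim: s => [|j s IH] sT.
  by exists (fun=> 0); rewrite big_nil big1 // => i _; rewrite scale0r.
have [|e' E] := IH; first by move=> i si; apply: sT; rewrite inE si orbT.
exists (fun i => (if i == j then e j else 0) + e' i); rewrite big_cons E.
under [RHS]eq_bigr do rewrite scalerDl.
rewrite big_split /=; congr (_ + _).
rewrite (bigD1_seq j) ?sT ?mem_head //= eqxx big1 ?addr0 // => i.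
by move=> /negPf ->; rewrite scale0r.
Qed.

(* The entries of C are the coordinates of dx_1, ..., dx_l on a finite part Om
   of a basis of log 1-forms; each column of C is a logarithmic vector field. *)
Lemma free_dual_basis : free_arrangement A alpha ->
  exists r (Om : 'M[F]_(r, l)) (C : 'M[S]_(l, r)),
  [/\ tx C *m Om = 1%:M, forall i, logvec A alpha (row i Om) &
      forall L i, L \in A -> dvl (c L) ((map_mx (@mpolyC l K) (c L) *m C) 0 i)].
Proof.
move=> [I [b [bgen bindep]]].
have dx (j : 'I_l) : exists u : Om1, log_val u = ew (delta_mx 0 j) (ext_one F l).
  apply: logform_Omega; have one := logform_one hA.
  rewrite -[delta_mx 0 j]/(delta_mx 0 j : 'rV[F]_l).
  have one01 (P : F -> Prop) : subring_pred P -> forms_over P (ew (delta_mx 0 j) (ext_one F l)).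
    move=> hP; apply: (forms_over_ew hP).
      by move=> x y; rewrite mxE; case: (_ && _); [apply: subringP1 | apply: subringP0].
    by move=> J; rewrite ffunE; case: eqP => _; [apply: subringP1 | apply: subringP0].
  split; first exact/ext_deg_ew/ext_deg_one.
    exact: (one01 _ (loc_subring (gen_mult _))).
  move=> L LA; have a0 := hA.1 L LA; have rs := reg_subring a0.
  split; first apply: (forms_over_exs rs); [|exact: one01|].
    by rewrite expr1; apply: reg_tofrac.
  by apply: (forms_over_ew rs); [apply: reg_kx | apply: one01].
have [u uE] := choice dx.
have dl L : exists w : Om1, L \in A ->
    log_val w = ew ((tofrac (lform (c L)))^-1 *: kx (c L)) (ext_one F l).
  have [LA|] := boolP (L \in A); last by exists 0.
  by have [w wE] := logform_Omega (logvec_dlog hA LA); exists w.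
have [d dE] := choice dl.
have /choice[su] j := bgen (u j); move=> /choice[cu uS].
have /choice[sd] L := bgen (d L); move=> /choice[cd dS].
(* A basis may a priori be infinite; [T] collects the members occurring in the dx_j and the d
   alpha_L / alpha_L. *)
pose T := undup (flatten [seq su j | j <- enum 'I_l] ++ flatten [seq sd L | L <- A]).
have uT : uniq T by apply: undup_uniq.
have suT j : {subset su j <= T}.
  move=> i ij; rewrite mem_undup mem_cat; apply/orP; left.
  by apply/flattenP; exists (su j) => //; apply: map_f; rewrite mem_enum.
have sdT L : L \in A -> {subset sd L <= T}.
  move=> LA i ij; rewrite mem_undup mem_cat; apply/orP; right.
  by apply/flattenP; exists (sd L) => //; apply: map_f.
have /choice[cu' uT'] j : exists e : I -> S, u j = \sum_(i <- T) e i *: b i.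
  by rewrite uS; apply: sum_on_uniq.
have /choice[cd' dT'] L : exists e : I -> S, L \in A -> d L = \sum_(i <- T) e i *: b i.
  have [LA|] := boolP (L \in A); last by exists (fun=> 0).
  by have [e E] := sum_on_uniq b (cd L) uT (sdT L LA); exists e; rewrite dS.
pose t := in_tuple T; pose r := size T.
pose Om : 'M[F]_(r, l) := \matrix_(i, k) log_val (b (tnth t i)) [set k].
pose C : 'M[S]_(l, r) := \matrix_(j, i) cu' j (tnth t i).
have rowE i : ew (row i Om) (ext_one F l) = log_val (b (tnth t i)).
  have [dw _ _] := Omega_logform (b (tnth t i)).
  rewrite [RHS](deg1_ew dw); congr (ew _ _).
  by apply/rowP => k; rewrite !mxE.
exists r, Om, C; split.
- apply/matrixP => j k; have := @ew_one F l (delta_mx 0 j) k.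
  rewrite -uE uT' log_val_sum sum_ffunE big_tnth => E.
  transitivity ((delta_mx 0 j : 'rV[F]_l) 0 k); last by rewrite !mxE eq_sym.
  rewrite mxE -E.
  by apply: eq_bigr => i _; rewrite log_val_scale exsE !mxE.
- by move=> i; rewrite /logvec rowE; apply: Omega_logform.
move=> L i LA; exists (cd' L (tnth t i)).
(* Coordinates of d alpha_L in the basis, computed once from the dx_j and once as alpha_L times d
   alpha_L / alpha_L. *)
pose e k := (\sum_j (c L 0 j)%:MP * cu' j k) - lform (c L) * cd' L k.
suff e0 : \sum_(k <- T) e k *: b k = 0.
  have := bindep T e uT e0 (tnth t i) (mem_tnth i t) => /eqP.
  rewrite subr_eq0 => /eqP <-; rewrite mxE.
  by apply: eq_bigr => j _; rewrite !mxE.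
have -> : \sum_(k <- T) e k *: b k =
    (\sum_j (c L 0 j)%:MP *: u j) - lform (c L) *: d L.
  rewrite dT' // scaler_sumr; under eq_bigr do rewrite /e scalerBl scaler_suml.
  rewrite sumrB exchange_big /=; congr (_ - _); apply: eq_bigr => j _.
    by rewrite uT' scaler_sumr; apply: eq_bigr => k _; rewrite scalerA.
  by rewrite scalerA.
apply/eqP; rewrite subr_eq0; apply/eqP/val_inj.
rewrite [LHS]log_val_sum [RHS]log_val_scale dE // -ewZl scalerA.
rewrite mulfV ?scale1r ?tofrac_eq0 ?lform_neq0 ?hA.1 //.
under eq_bigr do rewrite log_val_scale uE -ewZl.
rewrite -ew_suml; congr (ew _ _); apply/rowP => k; rewrite summxE (bigD1 k) //=.
rewrite big1 => [|j jk]; first by rewrite !mxE !eqxx mulr1 addr0.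
by rewrite !mxE eq_sym (negPf jk) mulr0.
Qed.
End DualBasis.

Section Lifting.
Variables (K : fieldType) (l n : nat).
Local Notation V := 'rV[K]_l.
Local Notation W := 'rV[K]_n.
Local Notation S := {mpoly K[l]}.
Local Notation S' := {mpoly K[n]}.
Local Notation F := {fraction S}.
Local Notation F' := {fraction S'}.
Variables (A : {fset {vspace V}}) (alpha : {vspace V} -> 'Hom(V, K^o)).
Variables (B : {fset {vspace W}}) (beta : {vspace W} -> 'Hom(W, K^o)).
Variables (mB : {vspace W} -> nat) (H : {vspace V}) (Y : {vspace V} -> {vspace W}).
Variables (v : V) (Phi : 'M[K]_(n, l)) (G : 'M[K]_(l, n)).
Local Notation c L := (coefs (alpha L)).
Local Notation cB Z := (coefs (beta Z)).
Local Notation a := (c H).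
Local Notation kx := (map_mx (@kfrac K l)).
Local Notation kB := (map_mx (@kfrac K n)).
Local Notation tx := (map_mx (@tofrac S)).
Local Notation tB := (map_mx (@tofrac S')).
Local Notation kS := (map_mx (@mpolyC l K)).
Local Notation pi := (subst Phi^T).
Local Notation lg := (logform A alpha (@const1 K l)).
Local Notation lgB := (logform B beta mB).

Hypothesis hA : good_arr A alpha.
Hypothesis hB : good_arr B beta.
Hypothesis HA : H \in A.
Hypothesis hc : hyp_coords a v Phi G.
Hypothesis hY : forall L, L \in A -> L != H -> Y L \in B /\
  exists2 e, e != 0 & c L *m Phi^T = e *: cB (Y L).
Hypothesis hBY : forall Z, Z \in B -> exists L, [/\ L \in A, L != H & Y L = Z].
Local Notation above := (above A H Y).
Hypothesis hm : forall Z, Z \in B -> mB Z = #|` above Z|.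

Variable r : F -> F'.
Hypothesis rE : forall f g s, pi g != 0 ->
  tofrac g * f = tofrac s -> r f = tofrac (pi s) / tofrac (pi g).
Local Notation resid := (resid alpha H v Phi r).

Variable A' : {fset {vspace V}}.
Hypothesis sA : {subset A' <= A}.
Hypothesis HA' : H \in A'.
Hypothesis A'Y : forall L L', L \in A -> L' \in A -> L != H -> L' != H ->
  Y L = Y L' -> L \in A' -> L' \in A'.
Hypothesis fA' : free_arrangement A' alpha.

Let a0 : a != 0 := hA.1 H HA.
Let va : v *m a^T = 1%:M. Proof. by case: hc. Qed.
Let vaF : kx v *m (kx a)^T = 1%:M.
Proof. by rewrite map_trmx -map_mxM va map_mx1. Qed.
Let ra := reg_subring a0.
Let r1 := restr1 rE.
Let rM := restrM hc rE.
Let rB := restrB hc rE.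

Lemma good_sub : good_arr A' alpha.
Proof.
split=> [L /sA|L L' /sA LA /sA]; first exact: hA.1.
exact: hA.2.
Qed.

(** Along a hyperplane outside [A'] the form has no pole, since its denominators involve other
    hyperplanes only. *)
Lemma logform_sub p w : logform A' alpha (@const1 K l) p w -> lg p w.
Proof.
move=> [dw lw rw]; split=> //.
  move=> I; apply: loc_sub (lw I) => g; apply: gen_sub => _ [L LA ->].
  by exists L => //; apply: sA.
move=> L LA; have [/rw//|LA'] := boolP (L \in A').
have cL0 := hA.1 L LA; have rL := reg_subring cL0.
have rwL : forms_over (reg (c L)) w.
  move=> I; apply: loc_gen_reg (lw I) => // _ [L' L'A ->].
  apply: hA.2 => //; first exact: sA.
  by apply: contraNneq LA' => ->.
split; first by apply: (forms_over_exs rL) => //; rewrite expr1; apply: reg_tofrac.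
by apply: (forms_over_ew rL) => //; apply: reg_kx.
Qed.

Lemma nopole_Tm w : nopole alpha H v w = Tm (1%:M - (kx v)^T *m kx a) w.
Proof. exact: proj_Tm. Qed.

Lemma dvl_prod (Z : {vspace W}) (f : S) :
  (forall L, L \in above Z -> dvl (c L) f) ->
  exists g, f = g * \prod_(L <- above Z) lform (c L).
Proof.
move=> hf; pose h : S := \prod_(L <- above Z) lform (c L); rewrite -/h.
have aA L : L \in above Z -> L \in A by rewrite in_above => /and3P[].
pose D b := exists2 L, L \in above Z & b = c L.
have Dh : gen D h by apply: gen_prod => L LZ; apply: gen_form; exists L.
have D0 b : D b -> b != 0 by move=> [L /aA LA ->]; apply: hA.1.
have h0 : tofrac h != 0 :> F by rewrite tofrac_eq0; apply: gen_neq0 Dh.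
have lf : loc (gen D) (tofrac f / tofrac h).
  by exists h, f; split=> //; rewrite mulrC divfK.
suff rf b : D b -> b != 0 /\ reg b (tofrac f / tofrac h).
  have [g gE] := loc_gen_poly rf lf.
  by exists g; apply/eqP; rewrite -tofrac_eq tofracM -gE divfK.
move=> [L LZ ->]; have LA := aA L LZ; split; first exact: hA.1.
have [f' fE] := hf L LZ.
exists (\prod_(L' <- (above Z `\ L)%fset) lform (c L')), f'; split.
  apply: (@gen_nondvl _ _ (fun b => exists2 L', L' \in (above Z `\ L)%fset & b = c L')).
  - exact: hA.1.
  - move=> _ [L' + ->]; rewrite in_fsetD1 => /andP[L'L /aA L'A].
    by apply: hA.2 => //; rewrite eq_sym.
  - by apply: gen_prod => L' L'Z; apply: gen_form; exists L'.
have hE : h = lform (c L) * \prod_(L' <- (above Z `\ L)%fset) lform (c L').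
  by rewrite /h (big_fsetD1 L).
apply: (mulIf h0); rewrite mulrA divfK // fE hE -!tofracM; congr tofrac.
by rewrite mulrC -mulrA [RHS]mulrCA.
Qed.

Local Notation qx := (\prod_(L <- (A `\` A')%fset) lform (c L)).

(* With C Om = 1 as in free_dual_basis, subtracting multiples of the Euler field
   makes the columns of C tangent to H. Pairing the restricted columns with
   qx eta gives polynomials, and these are the coefficients of the lift with
   respect to the rows of Om. *)
Lemma lift_form p eta : lgB p eta -> exists w,
  [/\ lg p w, ct (tx (euler K l)) w = 0 & resid w = exs (tofrac (pi qx)) eta].
Proof.
move=> leta; have [deta lceta reta] := leta.
have lcB := loc_subring (gen_mult (arr B beta)).
have [k [Om [C [COm lOm dC]]]] := free_dual_basis good_sub fA'.
have /choice[q0 q0E] i : exists h, (kS a *m C) 0 i = lform a * h := dC H i HA'.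
pose q : 'rV[S]_k := \row_i q0 i.
have qE : kS a *m C = lform a *: q by apply/rowP => i; rewrite q0E !mxE.
have aE : kS a *m (euler K l)^T = (lform a)%:M.
  apply/matrixP => i j; rewrite !ord1 -(euler_form a) !mxE mulr1n.
  by apply: eq_bigr => x _; rewrite !mxE mulrC.
pose C' := C - (euler K l)^T *m q.
have aC' : kS a *m C' = 0 by rewrite mulmxBr mulmxA aE mul_scalar_mx qE subrr.
have dC' L i : L \in A' -> dvl (c L) ((kS (c L) *m C') 0 i).
  move=> LA; have [h hE] := dC L i LA.
  have cE : kS (c L) *m (euler K l)^T = (lform (c L))%:M.
    apply/matrixP => x y; rewrite !ord1 -(euler_form (c L)) !mxE mulr1n.
    by apply: eq_bigr => z _; rewrite !mxE mulrC.
  exists (h - q 0 i); rewrite mulmxBr mulmxA cE mul_scalar_mx mulrBr -hE.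
  by rewrite !mxE.
pose piC' : 'M[S']_(l, k) := map_mx pi C'.
pose D : 'M[F']_(n, k) := kB G^T *m tB piC'.
have overD (P : F' -> Prop) : subring_pred P -> (forall s, P (tofrac s)) -> mx_over P D.
  move=> hP PT i j; rewrite mxE; apply: (subringP_sum hP) => x _.
  by apply: (subringPM hP); rewrite mxE; apply: PT.
pose eta' := exs (tofrac (pi qx)) (Tm D eta).
have /choice[s' s'E] I : exists s, eta' I = tofrac s.
  have le' : forms_over (loc (gen (arr B beta))) eta'.
    have TB s : loc (gen (arr B beta)) (tofrac s) by apply: locA_tofrac.
    apply: (forms_over_exs lcB) => //; apply: (forms_over_Tm lcB) => //.
    exact: overD.
  apply: (loc_gen_poly _ (le' I)) => _ [Z ZB ->]; have cZ0 := hB.1 Z ZB.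
  split=> //; move: I; rewrite -/(forms_over _ _).
  have rZ := reg_subring cZ0; have [rz1 rz2] := reta Z ZB.
  have TZ s : reg (cB Z) (tofrac s) by apply: reg_tofrac.
  have DZ : mx_over (reg (cB Z)) D by apply: overD.
  have [e e0 eE] := pi_above hY hm ZB.
  set h : S := \prod_(L <- above Z) lform (c L) in eE.
  have [L0 [L0A L0H L0Z]] := hBY ZB.
  have L0Z' : L0 \in above Z by rewrite in_above L0H L0A L0Z eqxx.
  (* Either all hyperplanes above [Z] lie in [A'] or none does. If none, [qx] contains all their
     forms, and its restriction cancels the whole pole of [eta] along [Z]. *)
  have [L0A'|L0A'] := boolP (L0 \in A'); last first.
    have [|g gE] := @dvl_prod Z qx.
      move=> L; rewrite in_above => /and3P[LH LA /eqP LZ].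
      have LAA' : L \in (A `\` A')%fset.
        rewrite in_fsetD LA andbT; apply: contra L0A' => LA'.
        by apply: (A'Y LA L0A LH L0H _ LA'); rewrite LZ L0Z.
      exists (\prod_(L' <- ((A `\` A') `\ L)%fset) lform (c L')).
      by rewrite (big_fsetD1 L).
    rewrite /eta' -TmZ.
    apply: (forms_over_Tm rZ) => //.
    have -> : exs (tofrac (pi qx)) eta =
        exs (tofrac (pi g * e%:MP)) (exs (tofrac (lform (cB Z)) ^+ mB Z) eta).
      by rewrite exsA gE rmorphM /= eE -mul_mpolyC mulrA !tofracM tofracXn.
    by apply: (forms_over_exs rZ).
  have inA' L : L \in above Z -> L \in A'.
    rewrite in_above => /and3P[LH LA /eqP LZ].
    by apply: (A'Y L0A LA L0H LH _ L0A'); rewrite LZ L0Z.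
  apply: (forms_over_exs rZ); first exact: TZ.
  have [v' v'E] := dual_vector cZ0.
  have vE : kB v' *m (kB (cB Z))^T = 1%:M by rewrite map_trmx -map_mxM v'E map_mx1.
  (* The part of [eta] killed by [v'] is regular along [Z]. In the other part the factor
     [ew (kB (cB Z))] becomes, under [D], divisible by the power of the form of [Z] that cancels the
     pole. *)
  rewrite (ct_ew_unit eta vE) TmD Tm_ew; apply: (forms_overD rZ).
    apply: (forms_over_Tm rZ) => //; apply: (forms_over_ct rZ) => //.
    exact: reg_kx.
  suff [rho ->] : exists rho : 'rV[S']_k,
      kB (cB Z) *m D = tofrac (lform (cB Z)) ^+ mB Z *: tB rho.
    rewrite ewZl -ewZ -TmZ -ctZ; apply: (forms_over_ew rZ); first exact: reg_tx.
    apply: (forms_over_Tm rZ) => //; apply: (forms_over_ct rZ) => //.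
    exact: reg_kx.
  have [_ [d d0 dE]] := hY L0A L0H; rewrite L0Z in dE.
  pose f i := (d^-1)%:MP * (kS (c L0) *m C') 0 i.
  have fE i : (kS (cB Z *m G^T) *m C') 0 i = f i.
    have -> : cB Z *m G^T = d^-1 *: (c L0 - (c L0 *m v^T) 0 0 *: a).
      have -> : cB Z = d^-1 *: (c L0 *m Phi^T) by rewrite dE scalerA mulVf ?scale1r.
      rewrite -scalemxAl -mulmxA -trmx_mul; case: hc => _ _ _ ->; congr (_ *: _).
      rewrite linearB /= trmx1 trmx_mul trmxK mulmxBr mulmx1 mulmxA.
      by rewrite {1}[c L0 *m v^T]mx11_scalar mul_scalar_mx.
    rewrite map_mxZ map_mxB map_mxZ -scalemxAl mulmxBl -[X in _ - X]scalemxAl aC'.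
    by rewrite scaler0 subr0 mxE.
  (* The forms above [Z] are proportional modulo alpha_H, which [C'] kills. So tangency to each of
     them shows that [f i] is divisible by their product. *)
  have /choice[g gE] i : exists g, f i = g * h.
    apply: dvl_prod => L LZ.
    have [e' [d' [e'0 E]]] := above_span hc hY LZ L0Z'.
    have [g gE] := dC' L i (inA' L LZ).
    have {}gE : e'%:MP * (kS (c L0) *m C') 0 i = lform (c L) * g.
      rewrite -gE E map_mxD !map_mxZ mulmxDl -!scalemxAl aC' scaler0 addr0.
      by rewrite [RHS]mxE.
    exists ((d^-1)%:MP * (e'^-1)%:MP * g).
    rewrite mulrCA -gE /f mulrA -[_ * e'%:MP]mulrA -mpolyCM mulVf //.
    by rewrite mpolyC1 mulr1.
  exists (\row_i (pi (g i) * e%:MP)).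
  rewrite /D mulmxA -map_mxM.
  apply/rowP => i.
  transitivity (tofrac (pi ((kS (cB Z *m G^T) *m C') 0 i))).
    rewrite [LHS]mxE [X in pi X]mxE (rmorph_sum (subst Phi^T)).
    rewrite (rmorph_sum (@tofrac S')); apply: eq_bigr => x _ /=.
    by rewrite !mxE !rmorphM /= substC.
  rewrite fE gE !mxE rmorphM /= eE -mul_mpolyC -tofracXn -tofracM; congr tofrac.
  by rewrite mulrA mulrC.
have ds' : ext_deg p [ffun I => s' I].
  move=> I Ip; rewrite ffunE; apply/eqP; rewrite -tofrac_eq0 -s'E.
  by rewrite (ext_deg_exs _ (ext_deg_Tm _ deta)).
pose s : {ffun {set 'I_k} -> S} := [ffun I => subst G^T (s' I)].
have ds : ext_deg p s.
  by move=> I Ip; rewrite ffunE -(rmorph0 (subst G^T)); congr subst; rewrite -(ds' I Ip) ffunE.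
pose sF : {ffun {set 'I_k} -> F} := [ffun I => tofrac (s I)].
pose w := Tm Om sF.
have lw : lg p w by apply/logform_sub/Tm_logform => //; apply: good_sub.
exists (euler_proj a w); split.
- exact: euler_proj_logform.
- exact: ct_euler_proj.
(* The two forms differ by a multiple of d alpha_H / alpha_H, which [nopole] kills. *)
have -> : resid (euler_proj a w) = resid w.
  rewrite [in RHS](euler_projE w a0) /resid nopoleD; congr (Tm _ (map_form r _)).
  by rewrite [X in _ + X](_ : _ = 0) ?addr0 // ewZl nopoleZ /nopole ew_ew ct0 exs0.
pose P : 'M[K]_l := 1%:M - v^T *m a.
have PE : 1%:M - (kx v)^T *m kx a = kx P.
  by rewrite map_mxB map_mx1 map_mxM map_trmx.
have rOm : mx_over (reg a) (Om *m kx P).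
  move=> i j; have [_ rb] := logvec_split good_sub (lOm i) HA' va.
  have := rb 0 j; congr (reg a); rewrite -PE mulmxBr mulmx1 mulmxA.
  rewrite !mxE; congr (_ - _); rewrite big_ord1 !mxE; congr (_ * _).
  by apply: eq_bigr => x _; rewrite !mxE mulrC.
have rsF : forms_over (reg a) sF by move=> I; rewrite ffunE; apply: reg_tofrac.
have mapsF : map_form r sF = eta'.
  by apply/ffunP => I; rewrite s'E !ffunE (restr_tofrac rE) (hyp_substK hc).
rewrite /resid nopole_Tm PE /w Tm_Tm (map_form_Tm ra r1 rB rM rOm rsF) Tm_Tm mapsF.
rewrite /eta' TmZ Tm_Tm; congr exs; rewrite -[RHS]Tm1; congr Tm.
have rmap m1 m2 m3 (X : 'M[F]_(m1, m2)) (X' : 'M[F]_(m2, m3)) :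
    mx_over (reg a) X -> mx_over (reg a) X' ->
    map_mx r (X *m X') = map_mx r X *m map_mx r X'.
  move=> rX rX'; apply/matrixP => i j; rewrite !mxE (part_r_sum ra rB) => [|x _].
    by apply: eq_bigr => x _; rewrite !mxE rM.
  exact: (subringPM ra).
have rkx m1 m2 (M : 'M[K]_(m1, m2)) : map_mx r (kx M) = kB M.
  by apply/matrixP => i j; rewrite !mxE (restr_tofrac rE) substC.
have -> : D = kB G^T *m map_mx r (tx C').
  by congr (_ *m _); apply/matrixP => i j; rewrite !mxE (restr_tofrac rE).
rewrite mulmxA -[kB G^T *m _ *m _]mulmxA -rmap //; last exact: reg_tx.
(* The Euler correction in [C'] contributes a multiple of d alpha_H, which the projection [P] kills;
   so [C'] is dual to [Om] along [H], just as [C] is on the whole space. *)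
have -> : tx C' *m (Om *m kx P) = kx P.
  rewrite map_mxB map_mxM mulmxBl mulmxA COm mul1mx -mulmxA [tx q *m _]mulmxA.
  have -> : tx q *m Om = (tofrac (lform a))^-1 *: kx a.
    have -> : kx a = tx (kS a) *m tx C *m Om.
      by rewrite -mulmxA COm mulmx1; apply/matrixP => i j; rewrite !mxE.
    rewrite -map_mxM qE map_mxZ -scalemxAl scalerA mulVf ?scale1r //.
    by rewrite tofrac_eq0 lform_neq0.
  rewrite -scalemxAl -map_mxM mulmxBr mulmx1 mulmxA.
  have -> : a *m v^T = 1%:M by rewrite -[a]trmxK -trmx_mul va trmx1.
  by rewrite mul1mx subrr map_mx0 scaler0 mulmx0 subr0.
rewrite rkx -!map_mxM; have -> : P = Phi^T *m G^T.
  rewrite -trmx_mul; case: hc => _ _ _ ->.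
  by rewrite linearB /= trmx1 trmx_mul trmxK.
have GP : G^T *m Phi^T = 1%:M by rewrite -trmx_mul; case: hc => _ _ -> _; rewrite trmx1.
by rewrite mulmxA GP mul1mx GP map_mx1.
Qed.
End Lifting.

(** * The Ziegler restriction *)

Section Geometry.
Variable K : fieldType.

Lemma mem_lker_coefs l (f : 'Hom('rV[K]_l, K^o)) x :
  (x \in lker f) = (x *m (coefs f)^T == 0).
Proof.
rewrite memv_ker coefsE; apply/eqP/eqP => [x0|->]; last by rewrite mxE.
by apply/matrixP => i j; rewrite !ord1 x0 mxE.
Qed.

Lemma coefs_neq0 l (f : 'Hom('rV[K]_l, K^o)) : lker f != fullv -> coefs f != 0.
Proof.
apply: contra_neq => f0; apply/vspaceP => x.
by rewrite mem_lker_coefs f0 trmx0 mulmx0 eqxx memvf.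
Qed.

Lemma dvl_lform l (a b : 'rV[K]_l) : a != 0 -> dvl a (lform b) ->
  exists e, b = e *: a.
Proof.
move=> a0 [h hE]; have [v va] := dual_vector a0.
have av : a *m v^T = 1%:M by rewrite -[a]trmxK -trmx_mul va trmx1.
have PT : (1%:M - a^T *m v)^T = 1%:M - v^T *m a.
  by rewrite linearB /= trmx1 trmx_mul trmxK.
have := congr1 (subst (1%:M - a^T *m v)^T) hE.
rewrite rmorphM /= !subst_lform PT !mulmxBr !mulmx1 !mulmxA av mul1mx subrr.
rewrite lform0 mul0r -(lform0 K l) => /lform_inj/eqP.
rewrite subr_eq0 => /eqP E; exists ((b *m v^T) 0 0).
by rewrite {1}E {1}[b *m v^T]mx11_scalar mul_scalar_mx.
Qed.

Lemma good_arr_of l (A : {fset {vspace 'rV[K]_l}}) alpha :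
  defining_forms A alpha -> (forall L, L \in A -> L != fullv) -> good_arr A alpha.
Proof.
move=> dA nA; have c0 L : L \in A -> coefs (alpha L) != 0.
  by move=> LA; apply: coefs_neq0; rewrite dA // nA.
split=> // L L' LA LA' /eqP LL' /(dvl_lform (c0 L LA))[e eE]; apply: LL'.
have e0 : e != 0.
  by apply: contraNneq (c0 L' LA') => e0; rewrite eE e0 scale0r.
rewrite -(dA L LA) -(dA L' LA'); apply/vspaceP => x; rewrite !mem_lker_coefs eE.
by rewrite linearZ -scalemxAr scaler_eq0 (negPf e0).
Qed.

Lemma proportional_forms l (a b : 'rV[K]_l) : b != 0 -> a != 0 ->
  (forall x : 'rV[K]_l, x *m a^T = 0 -> x *m b^T = 0) ->
  exists2 e, e != 0 & b = e *: a.
Proof.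
move=> b0 a0 ab; have [v va] := dual_vector a0.
have bE : b = (v *m b^T) 0 0 *: a.
  apply/rowP => i; have := ab (delta_mx 0 i - a 0 i *: v).
  rewrite !mulmxBl -!scalemxAl va -!rowE scalemx1.
  have -> : row i a^T = (a 0 i)%:M.
    by apply/matrixP => x y; rewrite !ord1 !mxE mulr1n.
  rewrite subrr => /(_ erefl)/matrixP/(_ 0 0); rewrite !mxE => /eqP.
  by rewrite subr_eq0 => /eqP ->; rewrite mulrC.
by exists ((v *m b^T) 0 0); rewrite // -?bE //; apply: contraNneq b0 => e0; rewrite bE e0 scale0r.
Qed.

Section Restriction.
Variables (n : nat) (A : {fset {vspace 'rV[K]_n.+1}}).
Variables (alpha : {vspace 'rV[K]_n.+1} -> 'Hom('rV[K]_n.+1, K^o)).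
Variables (H : {vspace 'rV[K]_n.+1}) (phi : 'Hom('rV[K]_n, 'rV[K]_n.+1)).
Variables (beta : {vspace 'rV[K]_n} -> 'Hom('rV[K]_n, K^o)).
Hypothesis arrA : is_arrangement A.
Hypothesis dA : defining_forms A alpha.
Hypothesis HA : H \in A.
Hypothesis cphi : coordinates_of phi H.
Local Notation B := (pull_arrangement phi (restriction A H)).
Hypothesis dB : defining_forms B beta.
Local Notation c L := (coefs (alpha L)).

Definition phi_mx : 'M[K]_(n, n.+1) := \matrix_(k < n) phi (delta_mx 0 k).
Definition restr_hyp (L : {vspace 'rV[K]_n.+1}) : {vspace 'rV[K]_n} :=
  (phi @^-1: (H :&: L))%VS.

Lemma phi_mxE x : phi x = x *m phi_mx.
Proof.
rewrite mulmx_sum_row [in LHS](row_sum_delta x) linear_sum /=.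
by apply: eq_bigr => i _; rewrite linearZ rowK.
Qed.

Lemma phi_inj : injective phi.
Proof. by apply/lker0P; case: cphi => ->. Qed.

Lemma mem_arr L x : L \in A -> (x \in L) = (x *m (c L)^T == 0).
Proof. by move=> LA; rewrite -mem_lker_coefs dA. Qed.

Lemma arr_neq_full L : L \in A -> L != fullv.
Proof.
move=> LA; apply/eqP => Lf; have := arrA LA.
by rewrite Lf dimvf /dim /= mul1n => /eqP; rewrite eqn_leq ltnn.
Qed.

Lemma good_A : good_arr A alpha.
Proof. exact: good_arr_of arr_neq_full. Qed.

Lemma in_restr_hyp L x : (x \in restr_hyp L) = (phi x \in L).
Proof.
rewrite /restr_hyp -memv_preim memv_cap; case: cphi => _ <-.
by rewrite memv_img ?memvf.
Qed.

Lemma restr_hypP L : L \in A -> L != H -> restr_hyp L \in B.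
Proof.
move=> LA LH; apply/imfsetP; exists (H :&: L)%VS => //=.
by apply/imfsetP; exists L => //=; rewrite !inE LH.
Qed.

Lemma restr_hyp_inv Z : Z \in B -> exists L, [/\ L \in A, L != H & restr_hyp L = Z].
Proof.
case/imfsetP => /= X /imfsetP[/= L]; rewrite !inE => /andP[LH LA] -> ->.
by exists L.
Qed.

Lemma restr_hyp_neq_full L : L \in A -> L != H -> restr_hyp L != fullv.
Proof.
move=> LA; apply: contra_neq => Lf.
have HL : (H <= L)%VS.
  case: cphi => _ <-; apply/subvP => _ /memv_imgP[x _ ->].
  by rewrite -in_restr_hyp Lf memvf.
apply/esym/eqP; rewrite eqEdim HL /=.
by have /eqP := etrans (arrA LA) (esym (arrA HA)); rewrite eqSS => /eqP ->.
Qed.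

Lemma good_B : good_arr B beta.
Proof.
apply: good_arr_of => // Z /restr_hyp_inv[L [LA LH <-]].
exact: restr_hyp_neq_full.
Qed.

Lemma restr_coefs L : L \in A -> L != H -> restr_hyp L \in B /\
  exists2 e, e != 0 & c L *m phi_mx^T = e *: coefs (beta (restr_hyp L)).
Proof.
move=> LA LH; have YB := restr_hypP LA LH; split=> //.
have mE (x : 'rV[K]_n) : (x *m (c L *m phi_mx^T)^T == 0) = (x \in restr_hyp L).
  by rewrite in_restr_hyp (mem_arr _ LA) phi_mxE trmx_mul trmxK mulmxA.
apply: proportional_forms.
- apply: contra_neq (restr_hyp_neq_full LA LH) => b0; apply/vspaceP => x.
  by rewrite -mE b0 trmx0 mulmx0 eqxx memvf.
- exact: good_B.1.
- move=> x /eqP; rewrite -mem_lker_coefs dB // -mE => /eqP.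
  by [].
Qed.

Lemma ziegler_multE Z : Z \in B ->
  pull_mult phi (ziegler_mult A H) Z = #|` above A H restr_hyp Z|.
Proof.
move=> /restr_hyp_inv[L0 [L0A L0H ZE]].
rewrite /pull_mult /ziegler_mult; congr #|` _|; apply/fsetP => L.
rewrite in_above !inE /=; case: (L != H) => //=; case: (L \in A) => //=.
have sub M : (H :&: M <= limg phi)%VS by case: cphi => _ ->; apply: capvSl.
apply/eqP/eqP => [E|<-]; last by rewrite lpreimK ?sub // capvC.
apply/vspaceP => x; rewrite in_restr_hyp; have := congr1 (fun U : {vspace 'rV[K]_n.+1} => phi x \in U) E.
rewrite /= memv_cap; have -> : phi x \in H by case: cphi => _ <-; rewrite memv_img ?memvf.
rewrite andbT => ->; apply/memv_imgP/idP => [[y yZ /phi_inj ->] //|xZ].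
by exists x.
Qed.

Lemma hyp_coords_exists : exists v G, hyp_coords (c H) v phi_mx G.
Proof.
have a0 := good_A.1 H HA; have [v va] := dual_vector a0.
have Pa : phi_mx *m (c H)^T = 0.
  apply/row_matrixP => k; rewrite row_mul rowK row0; apply/eqP.
  rewrite -(mem_arr _ HA); case: cphi => _ <-.
  by rewrite memv_img ?memvf.
have free_phi : row_free phi_mx.
  rewrite -kermx_eq0; apply/rowV0P => x /sub_kermxP x0.
  by apply: phi_inj; rewrite linear0 phi_mxE.
have [G0 PG0] := row_freeP free_phi.
have [N NE] : exists N, 1%:M - (c H)^T *m v = N *m phi_mx.
  have /choice[N NE] i : exists y, row i (1%:M - (c H)^T *m v) = y *m phi_mx.
    have : row i (1%:M - (c H)^T *m v) \in limg phi.
      case: cphi => _ ->; rewrite (mem_arr _ HA) -row_mul.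
      suff -> : (1%:M - (c H)^T *m v) *m (c H)^T = 0 by rewrite row0.
      by rewrite mulmxBl mul1mx -mulmxA va mulmx1 subrr.
    by case/memv_imgP => y _ yE; exists y; rewrite -phi_mxE.
  exists (\matrix_i N i); apply/row_matrixP => i.
  by rewrite NE row_mul rowK.
(* An arbitrary right inverse [G0] does not give the projection along [v]; projecting first makes
   [G *m Phi] equal to it. *)
exists v, ((1%:M - (c H)^T *m v) *m G0); split=> //.
- by rewrite mulmxA mulmxBr mulmx1 mulmxA Pa mul0mx subr0.
- by rewrite NE -[_ *m G0]mulmxA PG0 mulmx1.
Qed.
End Restriction.
End Geometry.

Section OmegaSyzygy.
Variables (K : fieldType) (l : nat).
Local Notation V := 'rV[K]_l.
Local Notation S := {mpoly K[l]}.
Variables (A : {fset {vspace V}}) (alpha : {vspace V} -> 'Hom(V, K^o)).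
Variables (m : {vspace V} -> nat) (p : nat).
Hypothesis hA : good_arr A alpha.

Lemma Omega_torsion_free : torsion_free (Omega A alpha m p).
Proof.
move=> s s0 w sw; apply: val_inj; apply/ffunP => I; rewrite [RHS]ffunE.
have := congr1 (fun u : Omega A alpha m p => log_val u I) sw.
rewrite log_val_scale exsE [RHS]ffunE => /eqP.
by rewrite mulf_eq0 tofrac_eq0 (negPf s0) => /eqP.
Qed.

(** Numerators with respect to the defining polynomial embed the log forms in a free module with one
    generator for each subset of the variables. *)
Lemma Omega_pdk : pdk l.-1 (Omega A alpha m p).
Proof.
have Q0 : defining_poly A alpha m != 0.
  apply: (gen_neq0 (good_arrP hA)); apply: gen_prod => L LA.
  by rewrite lin_polyE; apply/gen_exp/gen_form; exists L.
set Q := defining_poly A alpha m in Q0 *.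
have num (w : Omega A alpha m p) : exists eta : polyform K l,
    forall I, tofrac Q * log_val w I = tofrac (eta I).
  have /asboolP[[eta _ /ffunP E] _] := valP w; exists eta => I.
  by have := E I; rewrite ratform_scaleE ffunE.
have [eta etaE] := choice num.
pose g (I : {set 'I_l}) : free_on S {set 'I_l} := free_gen S I.
have lf : linear (fun w => \sum_(I <- [fset I | I in {set 'I_l}]%fset) eta w I *: g I).
  move=> s u w; rewrite scaler_sumr -big_split /=; apply: eq_bigr => I _.
  rewrite scalerA -scalerDl.
  suff -> : eta (s *: u + w) I = s * eta u I + eta w I by [].
  apply/eqP; rewrite -tofrac_eq.
  rewrite tofracD tofracM -!etaE log_valD log_val_scale ffunE exsE mulrDr mulrCA.
  by [].
have [f fE] := linear_pack lf.
apply: (submodule_pdk (i := f)); last exact: malg_projective.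
move=> u w /eqP; rewrite -subr_eq0 -linearB fE => /eqP/free_on_indep uw.
apply/eqP; rewrite -subr_eq0; apply/eqP/val_inj/ffunP => I; rewrite [RHS]ffunE.
have := etaE (u - w) I; rewrite uw ?tofrac0; last by apply/imfsetP; exists I.
by move/eqP; rewrite mulf_eq0 tofrac_eq0 (negPf Q0) => /eqP.
Qed.
End OmegaSyzygy.

Section Spanning.
Variables (K : fieldType) (n : nat).

Lemma span_coordinates (I : eqType) (s : seq I) (f : I -> 'rV[K]_n) : uniq s ->
  (forall x : 'rV[K]_n, (forall i, i \in s -> x *m (f i)^T = 0) -> x = 0) ->
  forall j, exists e : I -> K, 'X_j = \sum_(i <- s) e i *: lform (f i) :> {mpoly K[n]}.
Proof.
move=> us f0 j; pose t := in_tuple s; pose R := \matrix_(i < size s) f (tnth t i).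
have fR : row_free R^T.
  rewrite -kermx_eq0; apply/rowV0P => x /sub_kermxP xR; apply: f0 => b bs.
  have /tnthP[i ->] := (bs : b \in t).
  by rewrite -(rowK (fun i => f (tnth t i)) i) -/R tr_row colE mulmxA xR mul0mx.
have [E RE] := row_freeP fR.
exists (fun b => if insub (index b s) is Some i then E i j else 0).
rewrite -lform_delta.
have -> : delta_mx 0 j = \sum_i E i j *: f (tnth t i) :> 'rV[K]_n.
  rewrite [LHS](_ : _ = row j (E^T *m R)); last first.
    by rewrite -[R]trmxK -trmx_mul RE trmx1 rowE mulmx1.
  rewrite row_mul mulmx_sum_row; apply: eq_bigr => i _.
  by rewrite rowK !mxE.
rewrite lform_sum [RHS]big_tnth; apply: eq_bigr => i _; rewrite lformZ; congr (_ *: _).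
rewrite (tnth_nth (tnth t i)) /= index_uniq // insubT //= => i_s.
by congr (E _ j); apply: val_inj.
Qed.
End Spanning.

Lemma cardfsD_add (T : choiceType) (X U : {fset T}) x : x \in X -> x \notin U ->
  (#|` (X `\` (x |` U))%fset| < #|` (X `\` U)%fset|)%N.
Proof.
move=> xX xU; rewrite [X in (_ < X)%N](cardfsD1 x) in_fsetD xU xX add1n ltnS.
apply/fsubset_leq_card/fsubsetP => y; rewrite !inE negb_or.
by case/andP=> /andP[-> ->] ->.
Qed.

(** * Surjectivity of the restriction map *)

Section ZieglerRestriction.
Variables (K : fieldType) (n : nat).
Local Notation V := 'rV[K]_n.+1.
Local Notation W := 'rV[K]_n.
Local Notation S := {mpoly K[n.+1]}.
Local Notation S' := {mpoly K[n]}.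
Variables (A : {fset {vspace V}}) (alpha : {vspace V} -> 'Hom(V, K^o)).
Variables (H : {vspace V}) (phi : 'Hom(W, V)).
Variables (beta : {vspace W} -> 'Hom(W, K^o)) (p : nat).
Hypothesis arrA : is_arrangement A.
Hypothesis dA : defining_forms A alpha.
Hypothesis HA : H \in A.
Hypothesis cphi : coordinates_of phi H.
Local Notation B := (pull_arrangement phi (restriction A H)).
Local Notation mB := (pull_mult phi (ziegler_mult A H)).
Hypothesis dB : defining_forms B beta.
Hypothesis lfree : locally_free_along A alpha (mem H).
Hypothesis pdA : pdk p (Omega A alpha (@const1 K n.+1) p).
Hypothesis pn : (p.+1 < n)%N.

Local Notation c L := (coefs (alpha L)).
Local Notation a := (c H).
Local Notation tx := (map_mx (@tofrac S)).
Local Notation Phi := (phi_mx phi).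
Local Notation OA := (Omega A alpha (@const1 K n.+1) p).
Local Notation OB := (Omega B beta mB p).

Let hA := good_A arrA dA.
Let hB := good_B arrA HA cphi dB.
Let hY := restr_coefs arrA dA HA cphi dB.
Let hBY := @restr_hyp_inv K n A H phi.
Let hm := ziegler_multE cphi (A := A).
Let a0 : a != 0 := hA.1 H HA.

Lemma Omega0_exists : exists (M : lmodType S) (i : {linear M -> OA}),
  [/\ injective i,
      forall w, ct (tx (euler K n.+1)) (log_val w) = 0 <-> exists u, i u = w &
      pdk p M].
Proof.
have [||M [i [ii iE]]] := @submodule_exists _ OA
    (fun w => ct (tx (euler K n.+1)) (log_val w) = 0).
- exact: ct0.
- move=> s u w Eu Ew; rewrite log_valD log_val_scale ctD ctZ Eu Ew exs0.
  by rewrite addr0.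
exists M, i; split=> //; apply: pdk_retract pdA.
have /choice[q qE] (w : OA) : exists u, log_val (i u) = euler_proj a (log_val w).
  have [w' w'E] := logform_Omega hA (euler_proj_logform hA HA (Omega_logform hA w)).
  have /iE[u uE] : ct (tx (euler K n.+1)) (log_val w') = 0.
    by rewrite w'E ct_euler_proj.
  by exists u; rewrite uE.
have lq : linear q.
  move=> s u w; apply/ii/val_inj; rewrite linearP.
  rewrite -[LHS]/(log_val _) -[RHS]/(log_val _) log_valD log_val_scale !qE.
  by rewrite log_valD log_val_scale /euler_proj ewD ctD ewZ ctZ.
have [r rE] := linear_pack lq.
exists i, r => u; apply/ii/val_inj; rewrite rE -[LHS]/(log_val _) qE.
by apply: euler_proj_id => //; apply/iE; exists u.
Qed.

Lemma restr_generators (T : {fset {vspace V}}) :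
  {subset T <= (A `\ H)%fset} ->
  (forall x, x \in H -> (forall L, L \in T -> x \in L) -> x = 0) ->
  forall j, exists e : {vspace V} -> K,
    'X_j = \sum_(L <- T) e L *: subst Phi^T (lform (c L)) :> S'.
Proof.
move=> TA T0 j.
have fT (x : W) : (forall L, L \in enum_fset T -> x *m (c L *m Phi^T)^T = 0) -> x = 0.
  move=> xs; apply: (phi_inj cphi); rewrite linear0; apply: T0.
    by case: cphi => _ <-; rewrite memv_img ?memvf.
  move=> L LT; have LA : L \in A by have := TA L LT; rewrite !inE => /andP[].
  by rewrite (mem_arr dA _ LA) phi_mxE -mulmxA -[X in X *m (c L)^T]trmxK -trmx_mul xs.
have [e eE] := span_coordinates (fset_uniq T) fT j.
by exists e; rewrite eE; apply: eq_bigr => L _; rewrite subst_lform.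
Qed.

Lemma ziegler_pdk_lt : pdk p OB.
Proof.
have [v [G hc]] := hyp_coords_exists arrA dA HA cphi.
have [r rE] := restriction_exists Phi.
have [M [i [ii iE pdM]]] := Omega0_exists.
pose pi : {rmorphism S -> S'} := subst Phi^T.
have lgi u := Omega_logform hA (i u).
have Ei u : ct (tx (euler K n.+1)) (log_val (i u)) = 0 by apply/iE; exists u.
have /choice[rho0 rho0E] u : exists w : OB,
    log_val w = resid alpha H v Phi r (log_val (i u)).
  apply: (logform_Omega hB).
  exact: (resid_logform hA hB HA hc hY hBY hm rE).
have rho0P s u w : rho0 (s *: u + w) = pi s *: rho0 u + rho0 w.
  apply: val_inj; rewrite -[LHS]/(log_val _) -[RHS]/(log_val _).
  rewrite log_valD log_val_scale !rho0E linearP log_valD log_val_scale.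
  rewrite (residD hA HA hc rE (logform_tofrac hA s (lgi u)) (lgi w)).
  by rewrite (residZ hA HA hc rE s (lgi u)).
have pi_surj y : exists x, pi x = y by exists (subst G^T y); apply: hyp_substK hc _.
have pi_ker x : pi x = 0 <-> exists y, x = lform a * y by apply: hyp_subst_ker hc _.
have rho00 : rho0 0 = 0.
  have := rho0P 0 0 0; rewrite scale0r addr0 rmorph0 scale0r add0r => _.
  have := rho0P (-1) 0 0; rewrite scaler0 addr0 rmorphN rmorph1 scaleN1r addNr.
  by [].
(* The image of [rho0] is closed under the scalars of [H] because [pi] is surjective. *)
have [||N0 [j [ij jE]]] := @submodule_exists _ OB (fun w => exists u, rho0 u = w).
- by exists 0.
- move=> s _ _ [u <-] [w <-]; have [s' <-] := pi_surj s.
  by exists (s' *: u + w); rewrite rho0P.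
have /choice[rho rhoE] u : exists x, j x = rho0 u by apply/jE; exists u.
have tM : torsion_free M.
  move=> s s0 u su; apply: ii; rewrite linear0.
  by apply: (Omega_torsion_free s0); rewrite -linearZ su linear0.
have red : reduction pi (lform a) rho.
  split.
  - by move=> s u w; apply: ij; rewrite linearP !rhoE rho0P.
  - move=> y; have /jE[u uE] : exists x, j x = j y by exists y.
    by exists u; apply: ij; rewrite rhoE.
  - move=> u; split=> [u0|[w ->]]; last first.
      apply: ij; rewrite rhoE linear0 -[_ *: w]addr0 rho0P rho00 addr0.
      have -> : pi (lform a) = 0 by apply/pi_ker; exists 1; rewrite mulr1.
      by rewrite scale0r.
    have res0 : resid alpha H v Phi r (log_val (i u)) = 0.
      by rewrite -rho0E -rhoE u0 linear0.
    have [w wE] := logform_Omega hA (resid_ker hA HA hc rE (lgi u) (Ei u) res0).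
    have /iE[w' w'E] : ct (tx (euler K n.+1)) (log_val w) = 0.
      by rewrite wE ctZ Ei exs0.
    exists w'; apply/ii; rewrite linearZ_LR w'E; apply: val_inj.
    rewrite -[RHS]/(log_val _) log_val_scale wE exsA mulfV ?exs1 //.
    by rewrite tofrac_eq0 lform_neq0.
have a_reg s : lform a * s = 0 -> s = 0.
  by move/eqP; rewrite mulf_eq0 (negPf (lform_neq0 a0)) => /eqP.
have pdN0 : pdk p N0.
  by apply: (pdk_reduction pi_surj pi_ker a_reg _ red pdM); apply/tM/lform_neq0.
suff surj eta : exists x, j x = eta by apply: (pdk_iso ij surj).
pose qU (U : {fset {vspace V}}) : S := \prod_(L <- U) lform (c L).
suff key k (U : {fset {vspace V}}) : {subset U <= (A `\ H)%fset} ->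
    (#|` ((A `\ H) `\` U)%fset| < k)%N -> exists x, j x = pi (qU U) *: eta.
  have [|x xE] := key _ fset0 _ (ltnSn _); first by move=> L; rewrite inE.
  by exists x; rewrite xE /qU big_seq_fset0 rmorph1 scale1r.
(* The induction is on the number of hyperplanes outside [U] and [H], bounded by [k]; each recursive
   call adds one of them to [U]. *)
elim: k U => [//|k IH] U UA; set T := ((A `\ H) `\` U)%fset => cT.
have inT L : (L \in T) = [&& L \notin U, L != H & L \in A] by rewrite !inE.
have [[x [xH x0 xT]]|nT] :=
    pselect (exists x, [/\ x \in H, x != 0 & forall L, L \in T -> x \in L]).
  pose A' := localization A x.
  have sA : {subset A' <= A} by move=> L; rewrite !inE => /andP[].
  have HA' : H \in A' by rewrite !inE HA.
  have A'Y L L' : L \in A -> L' \in A -> L != H -> L' != H ->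
      restr_hyp H phi L = restr_hyp H phi L' -> L \in A' -> L' \in A'.
    move=> LA L'A _ _ LL'; rewrite !inE LA L'A /=.
    have /memv_imgP[y _ ->] : x \in limg phi by case: cphi => _ ->.
    by rewrite -!(in_restr_hyp cphi) LL'.
  have [w [lw Ew wE]] := lift_form hA hB HA hc hY hBY hm rE sA HA' A'Y (lfree xH x0)
    (Omega_logform hB eta).
  have [w' w'E] := logform_Omega hA lw.
  have /iE[u uE] : ct (tx (euler K n.+1)) (log_val w') = 0 by rewrite w'E.
  (* Every hyperplane of [A] not through [x] lies in [U]. Lifting already accounts for these
     factors; the factors of [qU U] still missing are those through [x]. *)
  exists (pi (\prod_(L <- [fset L in U | x \in L]%fset) lform (c L)) *: rho u).
  have jE' : j (rho u) = pi (\prod_(L <- (A `\` A')%fset) lform (c L)) *: eta.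
    rewrite rhoE; apply: val_inj; rewrite -[LHS]/(log_val _) -[RHS]/(log_val _).
    by rewrite rho0E uE w'E wE log_val_scale.
  rewrite linearZ /= jE' scalerA -rmorphM; congr (pi _ *: _).
  rewrite /qU (big_fsetID _ (fun L : {vspace V} => x \in L) U); congr (_ * _).
  apply: eq_fbigl => L; rewrite !inE; case: (boolP (x \in L)) => xL.
    by rewrite !andbT andNb andbF.
  rewrite andbF andbT; case: (boolP (L \in A)) => LA; last first.
    by apply/esym/negbTE; apply: contra LA => /UA; rewrite !inE => /andP[].
  apply/esym; have LH : L != H by apply: contraNneq xL => ->.
  by apply: contraNT xL => LU; apply: xT; rewrite inT LU LH.
have T0 x : x \in H -> (forall L, L \in T -> x \in L) -> x = 0.
  move=> xH xT; apply: contrapT => /eqP x0; apply: nT.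
  by exists x.
have TA : {subset T <= (A `\ H)%fset} by move=> L; rewrite inT !inE => /andP[].
have /choice[y yE] (L : {vspace V}) : exists x, L \in T ->
    j x = pi (lform (c L)) *: (pi (qU U) *: eta).
  have [LT|] := boolP (L \in T); last by exists 0.
  have LU : L \notin U by move: LT; rewrite inT => /and3P[].
  have [||x xE] := IH (L |` U)%fset.
  - by move=> L'; rewrite in_fsetU in_fset1 => /orP[/eqP ->|/UA //]; apply: TA.
  - exact: leq_trans (cardfsD_add (TA L LT) LU) cT.
  by exists x => _; rewrite xE /qU big_fsetU1 // rmorphM scalerA.
(* By induction, alpha_L times the element lies in the image for each [L] in [T]. Since these forms
   span the linear forms on [H], so do its products with all variables. *)
apply: (mpoly_depth_ge2 pn ij) pdN0 _; first exact: Omega_torsion_free.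
move=> j'; have [e ->] := restr_generators TA T0 j'.
exists (\sum_(L <- T) (e L)%:MP *: y L).
rewrite linear_sum scaler_suml big_seq [RHS]big_seq; apply: eq_bigr => L LT.
by rewrite linearZ /= yE // -mul_mpolyC; apply: scalerA.
Qed.

End ZieglerRestriction.

Theorem theorem1p9 (K : fieldType) (l : nat)
    (A : {fset {vspace 'rV[K]_l}})
    (alpha : {vspace 'rV[K]_l} -> 'Hom('rV[K]_l, K^o))
    (H : {vspace 'rV[K]_l})
    (phi : 'Hom('rV[K]_l.-1, 'rV[K]_l))
    (beta : {vspace 'rV[K]_l.-1} -> 'Hom('rV[K]_l.-1, K^o)) :
  is_arrangement A ->
  defining_forms A alpha ->
  H \in A ->
  tame A alpha ->
  locally_free_along A alpha (mem H) ->
  coordinates_of phi H ->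
  defining_forms (pull_arrangement phi (restriction A H)) beta ->
  tame_multi (pull_arrangement phi (restriction A H)) beta
    (pull_mult phi (ziegler_mult A H)).
Proof.
case: l A alpha H phi beta => [|n] A alpha H phi beta arrA dA HA tA lf cphi dB p pn.
  by have := arrA H HA.
(* With n = l - 1 the first case is p <= l - 3; in the second, n - 1 <= p and the bound for a
   submodule of a free module suffices. *)
apply/pd_leP; have [pn'|pn'] := ltnP p.+1 n.
  apply: (ziegler_pdk_lt arrA dA HA cphi dB lf) => //.
  exact/pd_leP/tA/leqW.
apply: pdk_le (Omega_pdk _ _ (good_B arrA HA cphi dB)).
by rewrite /= -subn1 leq_subLR add1n.
Qed.
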